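(* In the two-group factor model described in the context, suppose $\pi_1^{(m)}=o(1/\sqrt m)$ as $m\to\infty$. Fix $\mathbf w\in\mathbb R^k$ and assume that, conditionally on $\mathbf W=\mathbf w$, all of the following hold: (1) $\sup_{1\le i\le m<\infty}\|\mathbf L_{mi}\|_2^2<1$; (2) there exist an even integer $Q>2$ and $\gamma>0$ with $\frac{\gamma}{2+\gamma}+\frac2Q<1$ and $\sum_{d=1}^\infty d^{Q-2}\alpha(d)^{\gamma/(Q+\gamma)}<\infty$; (3) for all $t\in[0,1]$ and $r\in\{0,1\}$ the limit $F_r(t)=\lim_{m\to\infty}F_{m,r}(t)$ exists; (4) $\tau_*>0$, $\tau_*=\sup\{t\in(0,1):G(t)>t/q\}$, and $\tau_*$ is not an accumulation point of $\{t\in(0,1):G(t)=t/q\}$; (5) for all $s,t\in[a,b]$ and $r_0,r_1\in\{0,1\}$ the limits $\lim_{m}\frac{\pi_{r_0}^{(m)}\pi_{r_1}^{(m)}}{m}\sum_{i=1}^m\gamma_{mir_0}(t)\gamma_{mir_1}(s)$ and $\lim_{m}\frac{\pi_{r_0}^{(m)}\pi_{r_1}^{(m)}}{m}\sum_{i\ne j}\tilde\rho\big(\gamma_{mir_0}(t),\gamma_{mjr_1}(s),\Gamma^{(m)}_{ij}\big)$ both exist; (6) $F_0$ and $F_1$ are differentiable at $\tau_*$; (7) $\lim_{m\to\infty}\sup_{t\in[a,b]}\big|\sqrt m\,(F_{m,r}(t)-F_r(t))\big|=0$ for $r\in\{0,1\}$. Then, conditionally on $\mathbf W=\mathbf w$,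 as $m\to\infty$, $$\sqrt m\,(\mathrm{FDP}_m-1)\xrightarrow{p}0\qquad\text{and}\qquad\sqrt m\Big(\frac{V_m}m-\frac{\tau_*}q\Big)\xrightarrow{d}\mathcal N(0,\sigma_{R,3}^2),$$ where $\sigma_{R,3}^2=(1-qG'(\tau_* ))^{-2}\,c^{(0,0)}(\tau_*,\tau_* )$.
   Context: Notation: $\Phi$ is the standard normal CDF, $\bar\Phi=1-\Phi$. Fix $q\in(0,1)$, $\mu_A>0$ and an integer $k\ge0$. Model. For each $m\ge1$: $\pi_1^{(m)}\in(0,1)$, $\pi_0^{(m)}=1-\pi_1^{(m)}$; $H_{m1},\dots,H_{mm}$ are i.i.d. Bernoulli$(\pi_1^{(m)})$ ($H_{mi}=1$ iff hypothesis $i$ is nonnull); $\mathbf L_{mi}\in\mathbb R^k$ ($1\le i\le m$) are deterministic; $(\varepsilon_{m1},\dots,\varepsilon_{mm})\sim\mathcal N(0,\Sigma^{(m)})$ with $\Sigma^{(m)}_{ii}>0$ and $\|\mathbf L_{mi}\|_2^2+\Sigma^{(m)}_{ii}=1$; $\mathbf W\sim\mathcal N(0,I_k)$ is a single latent factor not depending on $m$. The $H$'s, the $\varepsilon$'s and $\mathbf W$ are independent of each other. $\Gamma^{(m)}$ is the correlation matrix corresponding to $\Sigma^{(m)}$. The $p$-values are $P_{mi}=\bar\Phi(\mu_AH_{mi}+\mathbf L_{mi}^{\mathsf T}\mathbf W+\varepsilon_{mi})$. Benjamini-Hochberg (BH) at level $q$: with sorted $p$-values $P_{m(1)}\le\dots\le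 P_{m(m)}$ and $P_{m(0)}=0$, let $R_m=\max\{j\in\{0,\dots,m\}:P_{m(j)}\le jq/m\}$, $\tau_{\mathrm{BH},m}=P_{m(R_m)}$, $V_m=\sum_{i=1}^mI\{P_{mi}\le\tau_{\mathrm{BH},m},H_{mi}=0\}$, $\mathrm{FDP}_m=V_m/\max\{R_m,1\}$. Everything below is conditional on $\mathbf W=\mathbf w$ (i.e. with $\mathbf W$ replaced by the fixed vector $\mathbf w$). Mixing coefficients: $\xi_{mi}=(\varepsilon_{mi},H_{mi})$, $\mathcal A_1^n(m)=\sigma(\xi_{mi}:1\le i\le n)$, $\mathcal A_{n+d}^\infty(m)=\sigma(\xi_{mi}:n+d\le i\le m)$, and $\alpha(d)=\sup_{n,m}\sup\{|P(A_0\cap A_1)-P(A_0)P(A_1)|:A_0\in\mathcal A_1^n(m),A_1\in\mathcal A_{n+d}^\infty(m)\}$. Subdistributions: for $r\in\{0,1\}$, $t\in[0,1]$, $\gamma_{mir}(t)=\Pr(P_{mi}\le t\mid H_{mi}=r,\mathbf W=\mathbf w)=\bar\Phi\Big(\frac{\bar\Phi^{-1}(t)-\mu_Ar-\mathbf L_{mi}^{\mathsf T}\mathbf w}{\sqrt{1-\|\mathbf L_{mi}\|_2^2}}\Big)$, $F_{m,r}(t)=\frac{\pi_r^{(m)}}m\sum_{i=1}^m\gamma_{mir}(t)$, $F_r=\lim_mF_{m,r}$ (pointwise), $G=F_0+F_1$, $\hat F_{m,r}(t)=\frac1m\sum_{i=1}^mI\{H_{mi}=r\}I\{P_{mi}\le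 t\}$. Simes point: $\tau_*=\sup\{t\in(0,1):G(t)\ge t/q\}$, with $\sup\emptyset=0$. Interval $[a,b]$: a fixed interval with $a\in(0,q)$, $b\in(q,1)$, $G(a)>a/q$, and such that $\tau_*$ is the unique $t\in(a,b)$ with $G(t)=t/q$ (such an interval exists under hypotheses (1), (3), (4)). Covariances: for $t,s\in[0,1]$, $|\rho|\le1$, $\tilde\rho(t,s,\rho)=\Pr(Z_1\ge\bar\Phi^{-1}(t),Z_2\ge\bar\Phi^{-1}(s))-ts$ where $(Z_1,Z_2)$ is centered bivariate normal with unit variances and correlation $\rho$. $W_{m,r}(t)=\sqrt m(\hat F_{m,r}(t)-F_{m,r}(t))$, $c_m^{(r_0,r_1)}(t,s)=\mathrm{cov}(W_{m,r_0}(t),W_{m,r_1}(s))$ (conditionally on $\mathbf W=\mathbf w$), and $c^{(r_0,r_1)}(t,s)=\lim_{m\to\infty}c_m^{(r_0,r_1)}(t,s)$, which exists under hypotheses (3) and (5). $\mathcal N(0,0)$ denotes the point mass at $0$.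
   Formalization: The convergence in distribution of √m(V_m/m − τ*/q) is stated under the extra condition qG'(τ* ) ≠ 1, without which the variance (1−qG'(τ* ))^{-2}c^{(0,0)}(τ*,τ* ) is undefined; hypotheses (1)–(7) do not imply this condition. *)

(* Defs.v *)
From HB Require Import structures.
From mathcomp Require Import all_boot all_order all_algebra.
From mathcomp Require Import all_classical all_reals all_analysis.

Set Implicit Arguments.
Unset Strict Implicit.
Unset Printing Implicit Defensive.

Import Order.TTheory GRing.Theory Num.Theory.
Import numFieldNormedType.Exports.

Local Open Scope classical_set_scope.
Local Open Scope ring_scope.

Section general_notions.
Context {R : realType}.

(* The law N(mu, v) with variance [v >= 0].  The case [v = 0] is the point mass
   at [mu], because [normal_prob mu 0] is not. *)
Definition normal_law (mu v : R) : set R -> \bar R :=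
  if v == 0 then (\d_mu : set R -> \bar R) else normal_prob mu (Num.sqrt v).

Definition Phi (x : R) : R := fine (normal_prob 0 1 `]-oo, x]).

Definition barPhi (x : R) : R := 1 - Phi x.

Definition ebarPhi (x : \bar R) : R :=
  match x with
  | x%:E => barPhi x
  | +oo%E => 0
  | -oo%E => 1
  end.

(* The inverse of [ebarPhi], decreasing from [0, 1] onto [-oo, +oo]; in
   particular its values at 0 and 1 are +oo and -oo. *)
Definition barPhi_inv (t : R) : \bar R :=
  ereal_inf [set x%:E | x in [set x : R | barPhi x <= t]].

(* Pr(Z1 >= barPhi_inv t, Z2 >= barPhi_inv s) - t s, where Z1 and Z2 are standard
   normal with correlation [rho], realized on R * R with its standard Gaussian
   measure as Z1(u) = u.1 and Z2(u) = rho u.1 + sqrt (1 - rho^2) u.2. *)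
Definition rho_tilde (t s rho : R) : R :=
  fine ((normal_prob 0 1 \x normal_prob 0 1)%E
    [set u : R * R |
      (barPhi_inv t <= (u.1)%:E)%E /\
      (barPhi_inv s <= (rho * u.1 + Num.sqrt (1 - rho ^+ 2) * u.2)%:E)%E])
  - t * s.

Context {d : measure_display} {Omega : measurableType d}.
Variable P : probability Omega R.

Definition sigma_rv {d' : measure_display} {T : measurableType d'} {I : Type}
    (D : set I) (X : I -> Omega -> T) : set (set Omega) :=
  <<s [set B | exists i A, [/\ D i, measurable A & B = X i @^-1` A]] >>.

Definition mutually_independent {d' : measure_display} {T : measurableType d'}
    {I : finType} (X : I -> Omega -> T) : Prop :=
  forall A : I -> set T, (forall i, measurable (A i)) ->
    P (\bigcap_i (X i @^-1` A i)) = (\prod_(i : I) P (X i @^-1` A i))%E.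

Definition independent3 (F1 F2 F3 : set (set Omega)) : Prop :=
  forall A1 A2 A3, F1 A1 -> F2 A2 -> F3 A3 ->
    P (A1 `&` A2 `&` A3) = (P A1 * P A2 * P A3)%E.

(* X ~ N(0, S), with a possibly singular covariance matrix [S]: every linear
   combination of the coordinates of X is a centered normal variable with the
   variance prescribed by [S]. *)
Definition centered_gaussian {n : nat} (X : 'I_n -> Omega -> R) (S : 'M[R]_n) :
    Prop :=
  [/\ S^T = S,
      forall c : 'rV[R]_n, 0 <= (c *m S *m c^T) 0 0 &
      forall (c : 'rV[R]_n) (A : set R), measurable A ->
        P [set x | A (\sum_i c 0 i * X i x)]
        = normal_law 0 ((c *m S *m c^T) 0 0) A].

Definition cvg_in_probability (X : nat -> Omega -> R) (l : R) : Prop :=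
  forall e : R, 0 < e ->
    P [set x | e <= `|X n x - l|] @[n --> \oo] --> 0%E.

(* Pointwise convergence of the distribution functions at the continuity points
   of the limit. *)
Definition cvg_in_distribution (X : nat -> Omega -> R) (nu : set R -> \bar R) :
    Prop :=
  forall y : R, {for y, continuous (fun z : R => fine (nu [set` `]-oo, z]]))} ->
    P [set x | X n x <= y] @[n --> \oo] --> nu [set` `]-oo, y]].

End general_notions.

Section benjamini_hochberg.
Context {R : realType} {m : nat}.
Variables (q : R) (p : 'I_m -> R) (h : 'I_m -> bool).

(* The [j]-th smallest p-value (1 <= j <= m), with value 0 for j = 0. *)
Definition order_stat (j : nat) : R :=
  nth 0 (0 :: sort <=%R [seq p i | i <- enum 'I_m]) j.

Definition bh_R : nat :=
  \max_(j < m.+1 | order_stat j <= j%:R * q / m%:R) j.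

Definition bh_tau : R := order_stat bh_R.

(* [h i] holds if and only if hypothesis [i] is nonnull. *)
Definition bh_V : nat := #|[pred i : 'I_m | (p i <= bh_tau) && ~~ h i]|.

Definition bh_FDP : R := bh_V%:R / (maxn bh_R 1)%:R.

End benjamini_hochberg.

Section factor_model.
Context {R : realType} {k : nat}.

Definition dotv (u v : 'rV[R]_k) : R := \sum_j u 0 j * v 0 j.

Definition sqnorm2 (u : 'rV[R]_k) : R := dotv u u.

Context {d : measure_display} {Omega : measurableType d}.
Variable P : probability Omega R.

(* The hypotheses 1, ..., m of the m-th problem are indexed by ['I_m], that is
   from 0 to m - 1; the value m = 0 is junk. *)
Record factor_model := FactorModel {
  pi1 : nat -> R ;
  loading : forall m, 'I_m -> 'rV[R]_k ;
  Sigma : forall m, 'M[R]_m ;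
  nonnull : forall m, 'I_m -> {RV P >-> bool} ;
  noise : forall m, 'I_m -> {RV P >-> R} ;
  factor : 'I_k -> {RV P >-> R} ;
  pi1_itv : forall m, (0 < m)%N -> 0 < pi1 m < 1 ;
  nonnull_bernoulli : forall m (i : 'I_m) (A : set bool),
    distribution P (nonnull i) A = bernoulli_prob (pi1 m) A ;
  nonnull_indep : forall m, mutually_independent P (@nonnull m) ;
  noise_gaussian : forall m, centered_gaussian P (@noise m) (Sigma m) ;
  Sigma_gt0 : forall m (i : 'I_m), 0 < Sigma m i i ;
  unit_variance : forall m (i : 'I_m), sqnorm2 (loading i) + Sigma m i i = 1 ;
  factor_gaussian : centered_gaussian P factor 1%:M ;
  model_indep : forall m,
    independent3 P (sigma_rv setT (@nonnull m)) (sigma_rv setT (@noise m))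
      (sigma_rv setT factor)
}.

Variables (M : factor_model) (q muA : R) (w : 'rV[R]_k).

Definition Gam (m : nat) (i j : 'I_m) : R :=
  Sigma M m i j / Num.sqrt (Sigma M m i i * Sigma M m j j).

Definition pi_ (r : bool) (m : nat) : R := if r then pi1 M m else 1 - pi1 M m.

(* The p-values as functions of the value [v] of the latent factor: the p-value
   P_mi of the model is [pvalue m i v x] at v = (factor M j x)_j.  As the factor
   is independent of the other variables, the conditional law of the p-values
   given that it equals [w] is the law of the p-values at the constant v = w,
   and all the definitions below are at this [w]. *)
Definition pvalue (v : 'rV[R]_k) (m : nat) (i : 'I_m) (x : Omega) : R :=
  barPhi (muA * (nonnull M i x)%:R + dotv (loading M i) v + noise M i x).

Definition false_rejections (m : nat) (x : Omega) : nat :=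
  bh_V q (fun i : 'I_m => pvalue w i x) (fun i => nonnull M i x).

Definition FDP (m : nat) (x : Omega) : R :=
  bh_FDP q (fun i : 'I_m => pvalue w i x) (fun i => nonnull M i x).

Definition xi (m : nat) (i : 'I_m) (x : Omega) : R * bool :=
  (noise M i x, nonnull M i x).

(* The ordinal [i] stands for the index i + 1 of the hypothesis. *)
Definition sigma_past (m n : nat) : set (set Omega) :=
  sigma_rv [set i : 'I_m | (i.+1 <= n)%N] (@xi m).

Definition sigma_future (m n : nat) : set (set Omega) :=
  sigma_rv [set i : 'I_m | (n <= i.+1)%N] (@xi m).

(* The set is nonempty and bounded by 1, so the real supremum is faithful. *)
Definition alpha (l : nat) : R :=
  sup [set y | exists m n A0 A1,
    [/\ (0 < m)%N, (0 < n)%N, sigma_past m n A0, sigma_future m (n + l) A1 &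
        y = `|fine (P (A0 `&` A1)) - fine (P A0) * fine (P A1)|]].

(* For 0 <= t <= 1 this is Pr(P_mi <= t | H_mi = r, W = w). *)
Definition gam (r : bool) (m : nat) (i : 'I_m) (t : R) : R :=
  ebarPhi ((barPhi_inv t - (muA * r%:R + dotv (loading M i) w)%:E)
           * ((Num.sqrt (1 - sqnorm2 (loading M i)))^-1)%:E)%E.

Definition Fm (m : nat) (r : bool) (t : R) : R :=
  pi_ r m / m%:R * \sum_(i < m) gam r i t.

Definition F (r : bool) (t : R) : R := limn (fun m => Fm m r t).

Definition G (t : R) : R := F false t + F true t.

Definition Fhat (m : nat) (r : bool) (t : R) (x : Omega) : R :=
  (m%:R)^-1 *
  \sum_(i < m) ((nonnull M i x == r)%:R * (pvalue w i x <= t)%R%:R).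

(* [sup] is 0 on the empty set. *)
Definition tau_star : R := sup [set t | 0 < t < 1 /\ t / q <= G t].

Definition Wm (m : nat) (r : bool) (t : R) (x : Omega) : R :=
  Num.sqrt m%:R * (Fhat m r t x - Fm m r t).

Definition cm (m : nat) (r0 r1 : bool) (t s : R) : R :=
  fine (covariance P (Wm m r0 t) (Wm m r1 s)).

Definition c (r0 r1 : bool) (t s : R) : R := limn (fun m => cm m r0 r1 t s).

(* As 0^-1 = 0, this is not the intended variance when q G'(tau_star) = 1. *)
Definition sigma2_R3 : R :=
  (1 - q * derive1 G tau_star) ^- 2 * c false false tau_star tau_star.

End factor_model.

(* Main.v *)
(* As pi1 = o(1/sqrt m), there are o(sqrt m) nonnulls in probability, so R - V is
   negligible at the scale sqrt m, and G = F_0.  Since R >= a m / q with high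
   probability, sqrt m (FDP - 1) tends to 0.

   The BH threshold R q / m is the last crossing of the empirical distribution
   function of the p-values with the line t / q.  With c = 1 - q G'(tau), the
   linearization of F_0 at tau gives X = sqrt m (V / m - tau / q) ~ W_m(tau) / c:
   for X > y it suffices to look at the empirical process W_m at one point
   tau + O(1/sqrt m), where it is close to W_m(tau) by mixing.  Conversely X > y
   makes W_m exceed the boundary at a point of a grid of step O(1/sqrt m); the
   finitely many near points reduce to tau again, and the far ones are excluded
   by Chebyshev, as the boundary grows at least linearly away from tau.

   Hence no functional limit theorem is needed, only the central limit theorem
   for W_m(tau), a normalized sum of alpha-mixing centred indicators.  It comes
   from Stein's equation for E cos (lam W + th) with blocks of length m^(1/5),
   and passes to distribution functions through trigonometric polynomials that
   approximate half-lines; the same polynomials identify the probabilities of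
   Gaussian quadrants, which enter the covariances, from characteristic
   functions. *)

Require Import Defs.
From mathcomp Require Import all_boot all_order all_algebra.
From mathcomp Require Import all_classical all_reals all_analysis.
From mathcomp Require Import measurable_realfun ring lra zify.

Set Implicit Arguments.
Unset Strict Implicit.
Unset Printing Implicit Defensive.

Import Order.TTheory GRing.Theory Num.Theory.
Import numFieldNormedType.Exports.
Local Open Scope classical_set_scope.
Local Open Scope ring_scope.

(** * Trigonometric polynomials *)

(** For fixed m every event in use is decided by finitely many Booleans: nulls with a p-value below
    a given point, nonnulls, comparisons of p-values with the levels j q / m. The limit theorem is
    therefore proved for weights on a finite set of Boolean vectors, where expectations are finite
    sums, and the sample space returns only through the law of such a vector. Characteristic
    functions stay real: the phase th replaces the complex exponential.

    The obstacle is that R depends on the process at all points at once. A lower bound on R needs a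
    single point, but an upper bound needs a grid whose number of points grows with m; second
    moments still suffice there, because the tails of the series of 1 / j^2 are small.

    The block length m^(1/5) fits alpha(L) = O(L^-3), which the summability of l^2 alpha(l) yields:
    the mixing error sqrt m alpha(L) and the Taylor error L^2 / sqrt m are then both of order
    L^(-1/2).

    Levels t strictly between 0 and 1 are written [barPhi z] with z real, which keeps infinite
    quantiles out of the computations. *)

Section trigonometric_polynomials.
Context {R : realType}.
Implicit Types (f g : R -> R).

(** Each triple holds a coefficient, a frequency and a phase. The phase absorbs the sines, and the
    frequencies are arbitrary reals, so that the class is closed under products. *)
Definition trigpoly f := exists s : seq (R * R * R),
  forall x, f x = \sum_(t <- s) t.1.1 * cos (t.1.2 * x + t.2).

Lemma trigpoly_cos (c a th : R) : trigpoly (fun x => c * cos (a * x + th)).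
Proof. by exists [:: (c, a, th)] => x; rewrite big_seq1. Qed.

Lemma trigpoly_cst (c : R) : trigpoly (fun=> c).
Proof.
by exists [:: (c, 0, 0)] => x; rewrite big_seq1 /= mul0r addr0 cos0 mulr1.
Qed.

Lemma trigpolyD f g : trigpoly f -> trigpoly g -> trigpoly (fun x => f x + g x).
Proof. by move=> [s fs] [u gu]; exists (s ++ u) => x; rewrite big_cat/= -fs -gu. Qed.

Lemma trigpolyM f g : trigpoly f -> trigpoly g -> trigpoly (fun x => f x * g x).
Proof.
move=> [s fs] [u gu].
exists ([seq (t.1.1 * v.1.1 / 2, t.1.2 + v.1.2, t.2 + v.2) | t <- s, v <- u] ++
  [seq (t.1.1 * v.1.1 / 2, t.1.2 - v.1.2, t.2 - v.2) | t <- s, v <- u]) => x.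
rewrite big_cat /= !big_allpairs_dep /= -big_split /= fs gu mulr_suml.
apply: eq_bigr => t _; rewrite mulr_sumr -big_split /=; apply: eq_bigr => v _.
have -> : (t.1.2 + v.1.2) * x + (t.2 + v.2) =
  (t.1.2 * x + t.2) + (v.1.2 * x + v.2) by ring.
have -> : (t.1.2 - v.1.2) * x + (t.2 - v.2) =
  (t.1.2 * x + t.2) - (v.1.2 * x + v.2) by ring.
move: (t.1.2 * x + t.2) (v.1.2 * x + v.2) => A B.
by rewrite cosD cosB; field.
Qed.

Lemma trigpolyX f n : trigpoly f -> trigpoly (fun x => f x ^+ n).
Proof.
move=> fT; elim: n => [|n IH]; first exact: trigpoly_cst.
under eq_fun do rewrite exprS.
exact: trigpolyM.
Qed.

Lemma bernoulli_ge (x : R) n : 0 <= x <= 1 -> 1 - n%:R * x <= (1 - x) ^+ n.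
Proof.
move=> /andP[x0 x1]; elim: n => [|n IH]; first by rewrite expr0 mul0r subr0.
rewrite exprS -natr1.
have : (1 - x) * (1 - n%:R * x) <= (1 - x) * (1 - x) ^+ n by rewrite ler_wpM2l// subr_ge0.
have : 0 <= n%:R * x * x by rewrite !mulr_ge0.
lra.
Qed.

(** (1 - x)^n (1 + x)^n <= 1, while (1 + x)^n >= n x. *)
Lemma bernoulli_le (x : R) n : 0 < x <= 1 -> (0 < n)%N ->
  (1 - x) ^+ n <= (n%:R * x)^-1.
Proof.
move=> /andP[x0 x1] n0.
have nx : 0 < n%:R * x by rewrite mulr_gt0// ltr0n.
rewrite -[leRHS]mul1r ler_pdivlMr//.
have : (1 - x) ^+ n * (1 + x) ^+ n <= 1.
  rewrite -exprMn exprn_ile1//.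
    by rewrite mulr_ge0//; lra.
  by nra.
apply: le_trans; rewrite ler_wpM2l ?exprn_ge0 ?subr_ge0//.
elim: n {n0 nx} => [|n IH]; first by rewrite mul0r.
rewrite exprS mulrDl mul1r -natr1 mulrDl mul1r.
have : 1 <= (1 + x) ^+ n by rewrite exprn_ege1//; lra.
by nra.
Qed.

(* (1 - u^n)^(2^n) tends to 1 for u < 1/2 and to 0 for u > 1/2; compose it
   with u = (1 + sin (c (x - y0))) / 2. *)
Lemma trigpoly_step (y eta del M : R) : 0 < eta -> 0 < del ->
  exists p : R -> R, [/\ trigpoly p, forall x, 0 <= p x <= 1,
    forall x : R, `|x| <= M -> x <= y -> 1 - del <= p x &
    forall x : R, `|x| <= M -> y + eta <= x -> p x <= del].
Proof.
move=> eta0 del0.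
(* [y0] is the middle of the transition window. For |x| <= M the choice of [L] keeps c (x - y0)
   within [-pi/2, pi/2], where sin increases, so [u] is at most (1 - al) / 2 left of the window and
   at least (1 + al) / 2 right of it. *)
pose y0 := y + eta / 2.
pose L := `|M| + `|y0| + eta.
have L0 : 0 < L by rewrite ltr_wpDl// addr_ge0.
pose c := pi / (2 * L).
have c0 : 0 < c by rewrite divr_gt0 ?pi_gt0// mulr_gt0.
have cL : c * L = pi / 2 by rewrite /c; field; rewrite gt_eqF.
pose u x := (1 + sin (c * (x - y0))) / 2.
pose al := sin (c * (eta / 2)).
have p0 := pi_gt0 R.
have al0 : 0 < al.
  apply: sin_gt0_pi; apply/andP; split; first by rewrite mulr_gt0// divr_gt0.
  have : c * (eta / 2) <= c * L.
    rewrite ler_pM2l// /L.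
    by have := normr_ge0 M; have := normr_ge0 y0; lra.
  lra.
have al1 : al <= 1 by apply: sin_le1.
have u01 x : 0 <= u x <= 1.
  by rewrite /u; have := sin_le1 (c * (x - y0)); have := sin_geN1 (c * (x - y0)); lra.
have arg (x : R) : - M <= x <= M -> c * (x - y0) \in `[- (pi / 2), pi / 2].
  move=> /andP[x1 x2]; rewrite in_itv/= -ler_norml.
  have -> : pi / 2 = c * L by rewrite cL.
  rewrite normrM (gtr0_norm c0) ler_pM2l// /L (le_trans (ler_normB _ _))//.
  suff : `|x| <= `|M| by lra.
  by rewrite ler_norml (le_trans _ x1) ?(le_trans x2) ?ler_norm// lerN2 ler_norm.
have arg2 : c * (eta / 2) \in `[- (pi / 2), pi / 2].
  rewrite in_itv/= -ler_norml gtr0_norm; last by rewrite mulr_gt0// divr_gt0.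
  have -> : pi / 2 = c * L by rewrite cL.
  rewrite ler_pM2l//.
  by rewrite /L; have := normr_ge0 M; have := normr_ge0 y0; lra.
have ler_sin : {in `[- (pi / 2), pi / 2] &, {mono @sin R : x y / x <= y}}.
  by move=> x z xI zI; rewrite !leNgt ltr_sin.
have small (x : R) : - M <= x <= M -> x <= y -> u x <= (1 - al) / 2.
  move=> xM xy.
  suff : sin (c * (x - y0)) <= - al by rewrite /u; lra.
  have arg3 : - (c * (eta / 2)) \in `[- (pi / 2), pi / 2].
    by move: arg2; rewrite !in_itv/= lerN2 lerNl andbC.
  rewrite -sinN (ler_sin _ _ (arg _ xM) arg3) -mulrN ler_pM2l// /y0.
  lra.
have big (x : R) : - M <= x <= M -> y + eta <= x -> (1 + al) / 2 <= u x.
  move=> xM xy.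
  suff : al <= sin (c * (x - y0)) by rewrite /u; lra.
  rewrite (ler_sin _ _ arg2 (arg _ xM)) ler_pM2l// /y0.
  lra.
(* The two Bernoulli inequalities, at u^n and with exponent 2^n, leave the errors (2u)^n <= (1 -
   al)^n on the left and (2u)^-n <= (1 + al)^-n on the right. *)
have [n [n0 n1 n2]] : exists n, [/\ (0 < n)%N, (1 - al) ^+ n <= del & ((1 + al) ^+ n)^-1 <= del].
  have h1 : (1 - al) ^+ n @[n --> \oo] --> 0 by apply: cvg_expr; rewrite ger0_norm; lra.
  have h2 : ((1 + al)^-1) ^+ n @[n --> \oo] --> 0.
    apply: cvg_expr; rewrite gtr0_norm ?invr_gt0 ?invf_lt1//; lra.
  have [N _ hN] : \forall n \near \oo, [/\ (0 < n)%N, (1 - al) ^+ n <= del & ((1 + al)^-1) ^+ n <= del].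
    near=> n; split; first by near: n; exact: nbhs_infty_gt.
      by apply: ltW; near: n; apply: (cvgr_lt _ h1).
    by apply: ltW; near: n; apply: (cvgr_lt _ h2).
  by exists N; have [? ? ?] := hN N (leqnn N); split => //; rewrite -exprVn.
pose p x := (1 - u x ^+ n) ^+ (2 ^ n).
have un x : 0 <= u x ^+ n <= 1.
  by have /andP[? ?] := u01 x; rewrite exprn_ge0//= exprn_ile1.
exists p; split.
- apply: trigpolyX.
  apply: trigpolyD; first exact: trigpoly_cst.
  rewrite (_ : (fun _ => _) = (fun x => (-1) * u x ^+ n)); last by apply/funext => x; rewrite mulN1r.
  apply: trigpolyM; first exact: trigpoly_cst.
  apply: trigpolyX.
  apply: trigpolyM; last exact: trigpoly_cst.
  apply: trigpolyD; first exact: trigpoly_cst.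
  rewrite (_ : (fun _ => _) = (fun x => 1 * cos (c * x + (- (c * y0) - pi / 2)))); first exact: trigpoly_cos.
  by apply/funext => x; rewrite mul1r mulrBr -cosBpihalf addrA.
- move=> x; rewrite /p.
  have /andP[? ?] := un x.
  by rewrite exprn_ge0/= ?exprn_ile1//; lra.
- move=> x xM xy; rewrite ler_norml in xM.
  rewrite /p (le_trans _ (bernoulli_ge _ (un x)))// lerD2l lerN2.
  apply: le_trans n1.
  rewrite natrX -exprMn lerXn2r ?nnegrE//.
  + by rewrite mulr_ge0//; case/andP: (u01 x).
  + by rewrite subr_ge0.
  + by have := small x xM xy; lra.
- move=> x xM xy; rewrite ler_norml in xM.
  have bx := big x xM xy.
  have ux : 0 < u x ^+ n by rewrite exprn_gt0//; lra.
  rewrite /p (le_trans (bernoulli_le _ _))//.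
  + by rewrite ux; case/andP: (un x).
  + by rewrite expn_gt0.
  apply: le_trans n2.
  rewrite natrX -exprMn lef_pV2 ?posrE ?exprn_gt0//; try lra.
  by rewrite lerXn2r ?nnegrE//; lra.
Unshelve. all: end_near.
Qed.
End trigonometric_polynomials.

(** * A central limit theorem under strong mixing *)

Section finite_expectation.
Context {R : realType} {T : finType}.
Variable mu : T -> R.

Definition Ex (f : T -> R) : R := \sum_x mu x * f x.

Definition Cov (f g : T -> R) : R := Ex (fun x => f x * g x) - Ex f * Ex g.

Lemma eq_Ex f g : f =1 g -> Ex f = Ex g.
Proof. by move=> fg; apply: eq_bigr => x _; rewrite fg. Qed.

Lemma ExD f g : Ex (fun x => f x + g x) = Ex f + Ex g.
Proof. by rewrite -big_split; apply: eq_bigr => x _ /=; rewrite mulrDr. Qed.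

Lemma ExZ c f : Ex (fun x => c * f x) = c * Ex f.
Proof. by rewrite mulr_sumr; apply: eq_bigr => x _; rewrite mulrCA. Qed.

Lemma ExN f : Ex (fun x => - f x) = - Ex f.
Proof. by rewrite -[RHS]mulN1r -ExZ; apply: eq_Ex => x; rewrite mulN1r. Qed.

Lemma ExB f g : Ex (fun x => f x - g x) = Ex f - Ex g.
Proof. by rewrite ExD ExN. Qed.

Lemma Ex_sum (I : finType) (Q : pred I) (f : I -> T -> R) :
  Ex (fun x => \sum_(i | Q i) f i x) = \sum_(i | Q i) Ex (f i).
Proof. by rewrite exchange_big; apply: eq_bigr => x _ /=; rewrite mulr_sumr. Qed.

Lemma CovDl f1 f2 g : Cov (fun x => f1 x + f2 x) g = Cov f1 g + Cov f2 g.
Proof.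
rewrite /Cov ExD.
have -> : Ex (fun x => (f1 x + f2 x) * g x) = Ex (fun x => f1 x * g x) + Ex (fun x => f2 x * g x).
  by rewrite -ExD; apply: eq_Ex => x; rewrite mulrDl.
by ring.
Qed.

Lemma CovZl c f g : Cov (fun x => c * f x) g = c * Cov f g.
Proof.
rewrite /Cov ExZ.
have -> : Ex (fun x => c * f x * g x) = c * Ex (fun x => f x * g x).
  by rewrite -ExZ; apply: eq_Ex => x; rewrite mulrA.
by ring.
Qed.

Lemma CovC f g : Cov f g = Cov g f.
Proof. by rewrite /Cov mulrC; congr (_ - _); apply: eq_Ex => x; rewrite mulrC. Qed.

Lemma eq_Cov f1 f2 g1 g2 : f1 =1 f2 -> g1 =1 g2 -> Cov f1 g1 = Cov f2 g2.
Proof.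
move=> ff gg; rewrite /Cov (eq_Ex ff) (eq_Ex gg); congr (_ - _).
by apply: eq_Ex => x; rewrite ff gg.
Qed.

Lemma Cov_suml (I : finType) (Q : pred I) (f : I -> T -> R) g :
  Cov (fun x => \sum_(i | Q i) f i x) g = \sum_(i | Q i) Cov (f i) g.
Proof.
rewrite /Cov Ex_sum sumrB -mulr_suml; congr (_ - _).
by rewrite -Ex_sum; apply: eq_Ex => x; rewrite mulr_suml.
Qed.

Hypothesis mu_ge0 : forall x, 0 <= mu x.
Hypothesis mu_sum : \sum_x mu x = 1.

Lemma Ex_cst c : Ex (fun=> c) = c.
Proof. by rewrite /Ex -mulr_suml mu_sum mul1r. Qed.

Lemma Cov_cstl c g : Cov (fun=> c) g = 0.
Proof. by rewrite /Cov ExZ Ex_cst subrr. Qed.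

Lemma le_Ex f g : (forall x, f x <= g x) -> Ex f <= Ex g.
Proof. by move=> fg; apply: ler_sum => x _; rewrite ler_wpM2l. Qed.

Lemma Ex_ge0 f : (forall x, 0 <= f x) -> 0 <= Ex f.
Proof. by move=> f0; apply: sumr_ge0 => x _; rewrite mulr_ge0. Qed.

Lemma ler_norm_Ex f : `|Ex f| <= Ex (fun x => `|f x|).
Proof.
rewrite (le_trans (ler_norm_sum _ _ _))//; apply: ler_sum => x _.
by rewrite normrM ger0_norm.
Qed.

Lemma Ex_le_cst f M : (forall x, `|f x| <= M) -> `|Ex f| <= M.
Proof. by move=> fM; rewrite (le_trans (ler_norm_Ex _))// -[leRHS]Ex_cst le_Ex. Qed.

(** Expand the nonnegative variance of |f|. *)
Lemma Ex_norm_le_sqrt f : Ex (fun x => `|f x|) <= Num.sqrt (Ex (fun x => f x ^+ 2)).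
Proof.
set e := Ex (fun x => `|f x|).
have e0 : 0 <= e by apply: Ex_ge0.
rewrite -[leLHS]ger0_norm// -sqrtr_sqr ler_wsqrtr//.
have : 0 <= Ex (fun x => (`|f x| - e) ^+ 2) by apply: Ex_ge0 => x; rewrite sqr_ge0.
have -> : Ex (fun x => (`|f x| - e) ^+ 2) = Ex (fun x => f x ^+ 2) + (- (2 * e) * e + e ^+ 2).
  rewrite -[e ^+ 2 in RHS]Ex_cst -ExZ -!ExD; apply: eq_Ex => x.
  by rewrite sqrrB real_normK ?num_real//; ring.
by lra.
Qed.

Lemma Cov_le_cst f g M N : (forall x, `|f x| <= M) -> (forall x, `|g x| <= N) ->
  `|Cov f g| <= 2 * (M * N).
Proof.
move=> fM gN; rewrite /Cov (le_trans (ler_normB _ _))//.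
have M0 : 0 <= M by rewrite (le_trans _ (Ex_le_cst fM)).
rewrite mulr2n mulrDl !mul1r lerD//.
  by apply: Ex_le_cst => x; rewrite normrM ler_pM.
by rewrite normrM ler_pM// Ex_le_cst.
Qed.

(** Cov (f o u) h is linear in the values f y, with weights Cov 1{u = y} h. If [A] collects the y of
    nonnegative weight, then 2 1_A - 1 is the sign of the weights, and its constant -1 drops out of
    the covariance. *)
Lemma Cov_sign (X : finType) (u : T -> X) (f : X -> R) (h : T -> R) M :
  (forall x, `|f x| <= M) ->
  exists A : pred X, `|Cov (f \o u) h| <= M * (2 * Cov (fun x => (A (u x))%:R) h).
Proof.
move=> fM.
have decomp (k : X -> R) : Cov (k \o u) h = \sum_y k y * Cov (fun x => (u x == y)%:R) h.
  under eq_bigr do rewrite -CovZl.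
  rewrite -Cov_suml; apply: eq_Cov => // x /=.
  by rewrite (bigD1 (u x))//= eqxx mulr1 big1 ?addr0// => y /negPf; rewrite eq_sym => ->; rewrite mulr0.
pose A y := 0 <= Cov (fun x => (u x == y)%:R) h.
exists A.
have -> : 2 * Cov (fun x => (A (u x))%:R) h = Cov ((fun y => 2 * (A y)%:R - 1) \o u) h.
  rewrite -CovZl -[RHS]addr0 -(Cov_cstl 1 h) -CovDl.
  by apply: eq_Cov => // x /=; rewrite subrK.
rewrite !decomp mulr_sumr (le_trans (ler_norm_sum _ _ _))//.
apply: ler_sum => y _; rewrite normrM.
have -> : (2 * (A y)%:R - 1) * Cov (fun x => (u x == y)%:R) h = `|Cov (fun x => (u x == y)%:R) h|.
  rewrite /A; case: lerP => /= h0; first by rewrite ger0_norm//; ring.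
  by rewrite ltr0_norm//; ring.
by rewrite ler_wpM2r.
Qed.

(* Only the values of f on the range of u and of g on that of v matter, and
   |Cov f g| is largest for functions with values +-1, where it is four times
   a covariance of indicators. *)
Lemma Cov_mixing (X Y : finType) (u : T -> X) (v : T -> Y) (f : X -> R) (g : Y -> R) al M N :
  (forall (A : pred X) (B : pred Y),
    `|Cov (fun x => (A (u x))%:R) (fun x => (B (v x))%:R)| <= al) ->
  (forall x, `|f x| <= M) -> (forall y, `|g y| <= N) -> 0 <= M -> 0 <= N ->
  `|Cov (f \o u) (g \o v)| <= 4 * (M * N) * al.
Proof.
move=> mix fM gN M0 N0.
have [A hA] := Cov_sign u (g \o v) fM.
rewrite (le_trans hA)//.
have [B hB] := Cov_sign v (fun x => (A (u x))%:R) gN.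
have -> : 4 * (M * N) * al = M * (2 * (N * (2 * al))) by ring.
rewrite ler_wpM2l// ler_wpM2l// CovC (le_trans (ler_norm _))// (le_trans hB)//.
rewrite ler_wpM2l// ler_wpM2l// CovC.
exact: le_trans (ler_norm _) (mix _ _).
Qed.

End finite_expectation.

(** * Sums over the distance between two indices *)

Section distance_sums.
Context {R : realType}.

(** This is |i - j|, as one of the two truncated differences vanishes. *)
Definition dst (i j : nat) : nat := (i - j + (j - i))%N.

(** Each distance d >= 1 occurs at most once on either side of i, whence the factor 2. *)
Lemma sum_dst_le (a : nat -> R) (m : nat) (K : R) (i : 'I_m) :
  (forall d, 0 <= a d) -> (forall n, \sum_(1 <= d < n) a d <= K) ->
  \sum_(j < m | j != i) a (dst i j) <= 2 * K.
Proof.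
move=> a0 aK.
have -> : \sum_(j < m | j != i) a (dst i j) =
    \sum_(0 <= j < i) a (i - j)%N + \sum_(i.+1 <= j < m) a (j - i)%N.
  rewrite -(big_mkord (fun j => j != i :> nat) (fun j => a (dst i j))).
  rewrite (big_cat_nat (n := i))//=; last exact/ltnW.
  rewrite [X in _ + X]big_ltn_cond ?ltn_ord//= eqxx/=; congr (_ + _).
    rewrite big_nat_cond [RHS]big_nat_cond; apply: eq_big => j.
      by rewrite andbT; lia.
    by move=> ji; congr a; rewrite /dst; lia.
  rewrite big_nat_cond [RHS]big_nat_cond; apply: eq_big => j.
    by rewrite andbT; lia.
  by move=> ji; congr a; rewrite /dst; lia.
suff [h1 h2] : \sum_(0 <= j < i) a (i - j)%N <= K /\ \sum_(i.+1 <= j < m) a (j - i)%N <= K.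
  by rewrite mulr2n mulrDl mul1r lerD.
split.
  rewrite big_nat_rev/= add0n.
  rewrite (eq_big_nat _ _ (F2 := fun j => a j.+1)); last first.
    by move=> j ji; congr a; lia.
  by have := aK i.+1; rewrite big_add1.
rewrite -[X in \sum_(X <= _ < _) _]addn1 addnC big_addn.
by under eq_bigr do rewrite addnK.
Qed.

Lemma sum_near_le (m : nat) (L : nat) (i : 'I_m) (c : R) : 0 <= c ->
  \sum_(j < m | (dst i j < L)%N) c <= (2 * L)%:R * c.
Proof.
move=> c0; rewrite sumr_const -[leLHS]mulr_natl ler_wpM2r// ler_nat.
rewrite cardE -(size_map val) -[leqRHS](size_iota (i.+1 - L)).
apply: uniq_leq_size; first by rewrite map_inj_uniq ?enum_uniq//; exact: val_inj.
move=> _ /mapP[j + ->]; rewrite mem_enum mem_iota unfold_in /dst /= => h.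
by apply/andP; split; lia.
Qed.

End distance_sums.

(** * Second moments of mixing arrays of Booleans *)

Section mixing_array.
Context {R : realType} {m : nat}.
Local Notation T := {ffun 'I_m -> bool}.
Variables (mu : T -> R) (al : nat -> R) (K : R).

(** The finite counterpart of measurability with respect to the coordinates in [D]. *)
Definition depends_on {Y : Type} (D : pred 'I_m) (f : T -> Y) :=
  forall x y : T, (forall i, D i -> x i = y i) -> f x = f y.

(* Coordinate i stands for the index i + 1. *)
Definition mixing_array := forall n l (A B : pred T), (0 < n)%N ->
  depends_on (fun i => i.+1 <= n)%N A -> depends_on (fun i => n + l <= i.+1)%N B ->
  `|Cov mu (fun x => (A x)%:R) (fun x => (B x)%:R)| <= al l.

Hypothesis mu_ge0 : forall x, 0 <= mu x.
Hypothesis mu_sum : \sum_x mu x = 1.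
Hypothesis al_ge0 : forall d, 0 <= al d.
Hypothesis al_le : forall d e, (d <= e)%N -> al e <= al d.
Hypothesis al_sum : forall n, \sum_(1 <= d < n) d%:R ^+ 2 * al d <= K.
Hypothesis mix : mixing_array.

Local Notation E := (Ex mu).

(** By monotonicity al(l) times the sum of d^2 over d <= l is at most K, and that sum of squares is
    at least l^3 / 3. *)
Lemma al_cube l : (0 < l)%N -> al l <= 3 * K / l%:R ^+ 3.
Proof.
move=> l0; rewrite ler_pdivlMr ?exprn_gt0 ?ltr0n// mulrC.
suff : l%:R ^+ 3 / 3 <= \sum_(1 <= d < l.+1) d%:R ^+ 2 :> R.
  move=> h; have := al_sum l.+1.
  have h2 : \sum_(1 <= d < l.+1) d%:R ^+ 2 * al l <= \sum_(1 <= d < l.+1) d%:R ^+ 2 * al d.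
    rewrite big_nat_cond [leRHS]big_nat_cond; apply: ler_sum => d /andP[/andP[_ dl] _].
    by rewrite ler_wpM2l ?exprn_ge0// al_le.
  move: h2; rewrite -mulr_suml.
  by have := ler_wpM2r (al_ge0 l) h; lra.
elim: l {l0} => [|l IH]; first by rewrite expr0n mul0r big_geq.
rewrite big_nat_recr//= -natr1.
have : 0 <= l%:R :> R by [].
by move: IH; move: (\sum_(_ <= _ < _) _) => S; nra.
Qed.

(** A function that depends only on the coordinates in D factors through the projection which resets
    all others to false; [Cov_mixing] applies to the two projections. *)
Lemma Cov_dep n l (f g : T -> R) (M N : R) :
  depends_on (fun i => i.+1 <= n)%N f -> depends_on (fun i => n + l <= i.+1)%N g ->
  (forall x, `|f x| <= M) -> (forall x, `|g x| <= N) ->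
  `|Cov mu f g| <= 4 * (M * N) * al l.
Proof.
move=> fd gd fM gN.
have x0 : T := [ffun=> false].
have M0 : 0 <= M := le_trans (normr_ge0 _) (fM x0).
have N0 : 0 <= N := le_trans (normr_ge0 _) (gN x0).
(* The case n = 0 is outside the scope of [mixing_array]: there [f] depends on no coordinate, so it
   is constant and the covariance vanishes. *)
case: n => [|n] in fd gd *.
  rewrite (@eq_Cov _ _ mu f (fun=> f x0) g g)// ?Cov_cstl ?normr0 ?mulr_ge0//.
  by move=> x; exact: fd.
pose proj (D : pred 'I_m) (x : T) : T := [ffun i => D i && x i].
have projP D (Y : Type) (h : T -> Y) : depends_on D h -> forall x, h (proj D x) = h x.
  by move=> hD x; apply: hD => i Di; rewrite ffunE Di.
have projD D (Y : Type) (h : T -> Y) : depends_on D (h \o proj D).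
  move=> x y xy /=; congr h; apply/ffunP => i; rewrite !ffunE.
  by case: (boolP (D i)) => //= /xy ->.
rewrite -(eq_Cov mu (projP _ _ _ fd) (projP _ _ _ gd)).
apply: Cov_mixing => // A B.
apply: (@mix n.+1 l (A \o proj (fun i => i.+1 <= n.+1)%N)
  (B \o proj (fun i => n.+1 + l <= i.+1)%N)) => //; exact: projD.
Qed.

Definition prob1 (i : 'I_m) : R := E (fun x => (x i)%:R).
Definition cind (i : 'I_m) (x : T) : R := (x i)%:R - prob1 i.
Definition csum (x : T) : R := \sum_i cind i x.

Lemma prob1_01 i : 0 <= prob1 i <= 1.
Proof.
rewrite Ex_ge0//= -(Ex_cst mu_sum 1); apply: le_Ex => // x.
by case: (x i).
Qed.

Lemma cind_le1 i x : `|cind i x| <= 1.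
Proof.
have /andP[? ?] := prob1_01 i.
by rewrite /cind ler_norml; case: (x i) => /=; lra.
Qed.

Lemma Ex_cind i : E (cind i) = 0.
Proof. by rewrite ExB Ex_cst// subrr. Qed.

Lemma Ex_cind2 i j : E (fun x => cind i x * cind j x) =
  Cov mu (fun x => (x i)%:R) (fun x => (x j)%:R).
Proof.
rewrite /Cov -/(prob1 i) -/(prob1 j).
have -> : E (fun x => cind i x * cind j x) =
  E (fun x => (x i)%:R * (x j)%:R + (- prob1 j * (x i)%:R + (- prob1 i * (x j)%:R + prob1 i * prob1 j))).
  by apply: eq_Ex => x; rewrite /cind; ring.
by rewrite !ExD !ExZ Ex_cst//; rewrite -/(prob1 i) -/(prob1 j); ring.
Qed.

Lemma Ex_cind2_mix i j : i != j -> `|E (fun x => cind i x * cind j x)| <= al (dst i j).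
Proof.
have aux (u v : 'I_m) : (u < v)%N -> `|E (fun x => cind u x * cind v x)| <= al (dst u v).
  move=> uv; rewrite Ex_cind2.
  apply: (@mix u.+1 _ (fun x => x u) (fun x => x v)) => //.
    by move=> x y; apply.
  by move=> x y; apply; rewrite /dst; lia.
rewrite neq_ltn => /orP[|ji]; first exact: aux.
rewrite (_ : dst i j = dst j i); last by rewrite /dst addnC.
under eq_Ex do rewrite mulrC.
exact: aux.
Qed.

(** For pairs at short distance, where mixing gives nothing. The bound is small for rare events,
    which is what makes increments of the empirical process small. *)
Lemma Ex_cind2_prob i j : `|E (fun x => cind i x * cind j x)| <= prob1 i.
Proof.
rewrite Ex_cind2 /Cov -/(prob1 i) -/(prob1 j).
have /andP[i0 i1] := prob1_01 i; have /andP[j0 j1] := prob1_01 j.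
have e0 : 0 <= E (fun x => (x i)%:R * (x j)%:R) by apply: Ex_ge0 => // x; rewrite mulr_ge0.
have e1 : E (fun x => (x i)%:R * (x j)%:R) <= prob1 i.
  by apply: le_Ex => // x; case: (x i); case: (x j); rewrite /= ?mulr0 ?mulr1.
rewrite ler_norml; nra.
Qed.

Lemma Ex_csum2 : E (fun x => csum x ^+ 2) = \sum_i \sum_j E (fun x => cind i x * cind j x).
Proof.
under eq_bigr do rewrite -Ex_sum.
rewrite -Ex_sum; apply: eq_Ex => x.
by rewrite expr2 mulr_suml; apply: eq_bigr => i _; rewrite mulr_sumr.
Qed.

(** On these indices L^2 <= dst^2, so L^2 times the sum is at most the sum of d^2 al(d) over both
    sides of i. *)
Lemma sum_far (L : nat) (i : 'I_m) : (0 < L)%N ->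
  \sum_(j < m | (L <= dst i j)%N) al (dst i j) <= 2 * K / L%:R ^+ 2.
Proof.
move=> L0; rewrite ler_pdivlMr ?exprn_gt0 ?ltr0n//.
apply: le_trans (sum_dst_le i (a := fun d => d%:R ^+ 2 * al d) _ al_sum); last first.
  by move=> d; rewrite mulr_ge0 ?exprn_ge0.
rewrite mulr_suml [leRHS](bigID (fun j : 'I_m => (L <= dst i j)%N))/=.
rewrite -[leLHS]addr0 lerD//; last first.
  by apply: sumr_ge0 => j _; rewrite mulr_ge0 ?exprn_ge0.
rewrite big_mkcond [leRHS]big_mkcond; apply: ler_sum => j _.
case: ifPn => h; last by rewrite andbF.
rewrite andbT ifT; last first.
  by apply: contraTneq h => ->; rewrite /dst subnn; lia.
by rewrite mulrC ler_wpM2r// lerXn2r ?nnegrE// ler_nat.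
Qed.

(** Pairs closer than L are bounded by the probability of one event, the others by mixing. [L] is
    left free: a large [L] makes the second term small, after which rarity of the events makes the
    first one small. *)
Lemma Ex_csum2_le (L : nat) : (0 < L)%N ->
  E (fun x => csum x ^+ 2) <= (2 * L)%:R * \sum_i prob1 i + m%:R * (2 * K / L%:R ^+ 2).
Proof.
move=> L0; rewrite Ex_csum2 mulr_sumr.
have -> : m%:R * (2 * K / L%:R ^+ 2) = \sum_(i < m) (2 * K / L%:R ^+ 2).
  by rewrite sumr_const card_ord mulr_natl.
rewrite -big_split /=; apply: ler_sum => i _.
rewrite (bigID (fun j : 'I_m => (dst i j < L)%N))/= lerD//.
  apply: le_trans (sum_near_le L i _); last by case/andP: (prob1_01 i).
  apply: ler_sum => j _; exact: le_trans (ler_norm _) (Ex_cind2_prob _ _).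
apply: le_trans (sum_far i L0).
under eq_bigl do rewrite -leqNgt.
apply: ler_sum => j h; apply: le_trans (ler_norm _) (Ex_cind2_mix _).
by apply: contraTneq h => ->; rewrite /dst subnn; lia.
Qed.

Lemma Ex_csum2_le_lin : E (fun x => csum x ^+ 2) <= m%:R * (2 + 2 * K).
Proof.
rewrite (le_trans (Ex_csum2_le (ltn0Sn 0)))// mulrDr lerD//; last first.
  by rewrite expr1n divr1.
rewrite muln1 mulrC ler_wpM2r//.
rewrite -[leRHS](mulr1 m%:R) mulr_natl -[in leRHS](card_ord m) -sumr_const.
by apply: ler_sum => i _; case/andP: (prob1_01 i).
Qed.

End mixing_array.

(** * Lipschitz and Taylor bounds for sine and cosine *)

Section lipschitz_trigo.
Context {R : realType}.

Lemma sin_lip (x y : R) : `|sin x - sin y| <= `|x - y|.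
Proof.
wlog xy : x y / x < y.
  move=> H; case: (ltgtP x y) => [/H //|/H|->]; last by rewrite !subrr normr0.
  by rewrite distrC (distrC x).
have [c _ h] := MVT xy (fun z _ => is_derive_sin z) (continuous_subspaceT (@continuous_sin R)).
by rewrite distrC (distrC x) h normrM ler_piMl// cos_max.
Qed.

Lemma cos_lip (x y : R) : `|cos x - cos y| <= `|x - y|.
Proof.
have cE (z : R) : cos z = sin (z + pi / 2) by rewrite sinDpihalf.
by rewrite !cE (le_trans (sin_lip _ _))// opprD addrACA subrr addr0.
Qed.

(** Mean value theorem for sin z - z cos v, whose derivative cos z - cos v is at most |z - v| in
    absolute value. *)
Lemma sin_taylor1 (v e : R) : `|sin (v - e) - (sin v - e * cos v)| <= e ^+ 2.
Proof.
pose g z := sin z - z * cos v.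
have dg (z : R) : is_derive z (1 : R) g (cos z - cos v).
  by rewrite /g; apply: is_derive_eq; rewrite /GRing.scale/=; ring.
have cg : continuous g by move=> z; apply/differentiable_continuous/derivable1_diffP; have [] := dg z.
have key (x y : R) : x < y -> v \in `[x, y] -> `|g y - g x| <= (y - x) ^+ 2.
  move=> xy; rewrite in_itv/= => /andP[xv vy].
  have [c /[!in_itv]/= /andP[xc cy] h] := MVT xy (fun z _ => dg z) (continuous_subspaceT cg).
  rewrite h normrM expr2 [`|y - x|]ger0_norm ?subr_ge0 ?(ltW xy)//.
  rewrite ler_wpM2r ?subr_ge0 ?(ltW xy)// (le_trans (cos_lip _ _))//.
  by rewrite ler_norml; lra.
have -> : sin (v - e) - (sin v - e * cos v) = g (v - e) - g v.
  by rewrite /g; ring.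
case: (ltgtP e 0) => e0.
- have := key v (v - e); rewrite in_itv/= lexx/= => h.
  have -> : e ^+ 2 = (v - e - v) ^+ 2 by ring.
  by apply: h; lra.
- have := key (v - e) v; rewrite in_itv/= lexx/= => h.
  have -> : e ^+ 2 = (v - (v - e)) ^+ 2 by ring.
  by rewrite distrC; apply: h; lra.
- by rewrite e0 subr0 subrr normr0 expr0n.
Qed.

End lipschitz_trigo.

Lemma sum_cst_ord {R : pzRingType} m (c : R) : \sum_(i < m) c = m%:R * c.
Proof. by rewrite sumr_const card_ord mulr_natl. Qed.

(** * Stein's equation for a normalized mixing sum *)

Section stein_mixing.
Context {R : realType} {m : nat}.
Local Notation T := {ffun 'I_m -> bool}.
Variables (mu : T -> R) (al : nat -> R) (K : R).
Hypothesis mu_ge0 : forall x, 0 <= mu x.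
Hypothesis mu_sum : \sum_x mu x = 1.
Hypothesis al_ge0 : forall d, 0 <= al d.
Hypothesis al_le : forall d e, (d <= e)%N -> al e <= al d.
Hypothesis al_sum : forall n, \sum_(1 <= d < n) d%:R ^+ 2 * al d <= K.
Hypothesis mix : mixing_array mu al.
Variables (L : nat) (r : R).
Hypothesis L_gt0 : (0 < L)%N.
Hypothesis r_gt0 : 0 < r.
Hypothesis r2 : r ^+ 2 = m%:R.

Local Notation E := (Ex mu).
Local Notation X := (cind mu).

Let near_sum (i : 'I_m) x := \sum_(j < m | (dst i j < L)%N) X j x.
Let past_sum (i : 'I_m) x := \sum_(j < m | (j + L <= i)%N) X j x.
Let future_sum (i : 'I_m) x := \sum_(j < m | (i + L <= j)%N) X j x.

Let csumE (i : 'I_m) x : csum mu x = near_sum i x + (past_sum i x + future_sum i x).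
Proof.
rewrite /csum (bigID (fun j : 'I_m => (dst i j < L)%N))/=; congr (_ + _).
rewrite (bigID (fun j : 'I_m => (j <= i)%N))/=; congr (_ + _); apply: eq_bigl => j.
  by rewrite /dst; apply/idP/idP; lia.
by rewrite /dst; apply/idP/idP; lia.
Qed.

Let dep_past (i : 'I_m) : depends_on (fun j => j.+1 <= i.+1 - L)%N (past_sum i).
Proof. by move=> x y xy; apply: eq_bigr => j ji; rewrite /cind xy//; lia. Qed.

Let dep_future (i : 'I_m) : depends_on (fun j => i.+1 + L <= j.+1)%N (future_sum i).
Proof. by move=> x y xy; apply: eq_bigr => j ji; rewrite /cind xy//; lia. Qed.

Let near_sum_le (i : 'I_m) x : `|near_sum i x| <= (2 * L)%:R.
Proof.
rewrite (le_trans (ler_norm_sum _ _ _))// -[leRHS]mulr1.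
apply: le_trans (sum_near_le L i (@ler01 R)).
by apply: ler_sum => j _; apply: cind_le1.
Qed.

(** Mixing is used twice, at a cost of 4 al(L) each time: to split the future off X_i f(past), and
    then the past off X_i, which has mean zero. *)
Let Ex_separated (i : 'I_m) (f g : R -> R) : (forall z, `|f z| <= 1) -> (forall z, `|g z| <= 1) ->
  `|E (fun x => X i x * (f (past_sum i x) * g (future_sum i x)))| <= 8 * al L.
Proof.
move=> f1 g1.
have X1 := cind_le1 mu_ge0 mu_sum i.
have h1 : `|Cov mu (fun x => X i x * f (past_sum i x)) (fun x => g (future_sum i x))| <= 4 * (1 * 1) * al L.
  apply: (Cov_dep mu_sum al_ge0 mix (n := i.+1)) => //.
  - move=> x y xy; rewrite /cind xy// (@dep_past i x y)// => j ji.
    by apply: xy; lia.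
  - by move=> x y xy; rewrite (@dep_future i x y).
  - by move=> x; rewrite normrM mulr_ile1.
have h2 : `|E (fun x => X i x * f (past_sum i x))| <= 4 * (1 * 1) * al L.
  have -> : E (fun x => X i x * f (past_sum i x)) = Cov mu (fun x => f (past_sum i x)) (X i).
    by rewrite /Cov Ex_cind// mulr0 subr0; apply: eq_Ex => x; rewrite mulrC.
  have [iL|iL] := leqP L i.+1.
    apply: (Cov_dep mu_sum al_ge0 mix (n := i.+1 - L)) => //.
    - by move=> x y xy; rewrite (@dep_past i x y).
    - by move=> x y xy; rewrite /cind xy//; lia.
  (* Fewer than L coordinates end at i, so the past sum is empty and [f] is taken at 0. *)
  rewrite (@eq_Cov _ _ mu _ (fun=> f 0) _ (X i))//; last first.
    by move=> x; rewrite /past_sum big_pred0// => j; lia.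
  by rewrite Cov_cstl// normr0 !mulr_ge0.
have -> : E (fun x => X i x * (f (past_sum i x) * g (future_sum i x))) =
  Cov mu (fun x => X i x * f (past_sum i x)) (fun x => g (future_sum i x)) +
  E (fun x => X i x * f (past_sum i x)) * E (fun x => g (future_sum i x)).
  by rewrite /Cov subrK; apply: eq_Ex => x; rewrite mulrA.
have h3 : `|E (fun x => g (future_sum i x))| <= 1 by apply: Ex_le_cst.
rewrite (le_trans (ler_normD _ _))// normrM.
have : `|E (fun x => X i x * f (past_sum i x))| * `|E (fun x => g (future_sum i x))| <= 4 * (1 * 1) * al L * 1.
  by rewrite ler_pM.
lra.
Qed.

Variables (lam th : R).
Let W x := csum mu x / r.
Let s2 := E (fun x => W x ^+ 2).
(** The random coefficient of lam cos (lam W + th) in the first-order expansion of W sin (lam W +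
    th). Stein's equation holds approximately because [Y] concentrates near the variance [s2]. *)
Let Y x := \sum_i X i x * near_sum i x / r ^+ 2.

(** The addition formula splits the sine into two products of a function of the past and a function
    of the future, each covered by [Ex_separated]. *)
Let head_le (i : 'I_m) : `|E (fun x => X i x * sin (lam * ((past_sum i x + future_sum i x) / r) + th))| <= 16 * al L.
Proof.
have -> : E (fun x => X i x * sin (lam * ((past_sum i x + future_sum i x) / r) + th)) =
  E (fun x => X i x * (sin (lam * (past_sum i x / r) + th) * cos (lam * (future_sum i x / r)))) +
  E (fun x => X i x * (cos (lam * (past_sum i x / r) + th) * sin (lam * (future_sum i x / r)))).
  rewrite -ExD; apply: eq_Ex => x; rewrite -mulrDr -sinD; congr (_ * sin _).
  by rewrite mulrDl mulrDr addrAC.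
rewrite (le_trans (ler_normD _ _))//.
have := @Ex_separated i (fun z => sin (lam * (z / r) + th)) (fun z => cos (lam * (z / r))) (fun=> sin_max _) (fun=> cos_max _).
have := @Ex_separated i (fun z => cos (lam * (z / r) + th)) (fun z => sin (lam * (z / r))) (fun=> cos_max _) (fun=> sin_max _).
lra.
Qed.

(** E Y lacks, compared with [s2], exactly the pairs at distance at least L. *)
Let Y_bias : `|E Y - s2| <= 2 * K / L%:R ^+ 2.
Proof.
have -> : E Y - s2 = - (\sum_(i < m) \sum_(j < m | (L <= dst i j)%N) E (fun x => X i x * X j x)) / r ^+ 2.
  have -> : s2 = E (fun x => csum mu x ^+ 2) / r ^+ 2.
    by rewrite [RHS]mulrC -ExZ; apply: eq_Ex => x; rewrite /W expr_div_n mulrC.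
  have -> : E Y = (\sum_(i < m) \sum_(j < m | (dst i j < L)%N) E (fun x => X i x * X j x)) / r ^+ 2.
    rewrite mulr_suml Ex_sum; apply: eq_bigr => i _.
    rewrite -Ex_sum mulrC -ExZ; apply: eq_Ex => x.
    by rewrite /near_sum -mulr_sumr mulrC.
  rewrite -mulrBl; congr (_ / _); rewrite Ex_csum2// -sumrB -sumrN; apply: eq_bigr => i _.
  rewrite [X in _ - X](bigID (fun j : 'I_m => (dst i j < L)%N))/= opprD addrA subrr add0r.
  by congr (- _); apply: eq_bigl => j; rewrite -leqNgt.
rewrite normrM normrN [`|_^-1|]gtr0_norm ?invr_gt0 ?exprn_gt0// ler_pdivrMr ?exprn_gt0// r2.
rewrite [leRHS]mulrC -sum_cst_ord.
rewrite (le_trans (ler_norm_sum _ _ _))//; apply: ler_sum => i _.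
rewrite (le_trans (ler_norm_sum _ _ _))//; apply: le_trans (sum_far al_ge0 al_sum i L_gt0).
apply: ler_sum => j h; apply: (Ex_cind2_mix mu_sum mix).
by apply: contraTneq h => ->; rewrite /dst subnn; lia.
Qed.

(** [Z i] reads only coordinates closer than L to i, so [Z i] and [Z k] are separated by a gap of at
    least L once |i - k| >= 3 L. For each i there remain at most 6 L indices k, with a covariance of
    at most 8 L^2 each, hence 48 L^3. *)
Let Y_var : E (fun x => (Y x - E Y) ^+ 2) <=
  48 * L%:R ^+ 3 / m%:R + 16 * L%:R ^+ 2 * al L.
Proof.
pose Z i x := X i x * near_sum i x.
have Z1 i x : `|Z i x| <= (2 * L)%:R.
  by rewrite normrM -[leRHS]mul1r ler_pM// cind_le1.
have YE x : Y x = \sum_i r ^- 2 * Z i x by apply: eq_bigr => i _; rewrite mulrC.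
have -> : E (fun x => (Y x - E Y) ^+ 2) = Cov mu Y Y.
  rewrite /Cov.
  have -> : E (fun x => (Y x - E Y) ^+ 2) = E (fun x => Y x * Y x + (- (2 * E Y) * Y x + E Y ^+ 2)).
    by apply: eq_Ex => x; ring.
  by rewrite !ExD ExZ Ex_cst//; ring.
have -> : Cov mu Y Y = r ^- 4 * \sum_(i < m) \sum_(k < m) Cov mu (Z i) (Z k).
  rewrite (@eq_Cov _ _ mu Y _ Y Y YE (fun=> erefl)) Cov_suml mulr_sumr; apply: eq_bigr => i _.
  rewrite CovZl CovC (@eq_Cov _ _ mu Y _ (Z i) (Z i) YE (fun=> erefl)) Cov_suml !mulr_sumr; apply: eq_bigr => k _.
  rewrite CovZl CovC mulrA; congr (_ * _).
  by rewrite -invfM -exprD.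
have far (i k : 'I_m) : (3 * L <= dst i k)%N -> `|Cov mu (Z i) (Z k)| <= 16 * L%:R ^+ 2 * al L.
  have dep_near (u : 'I_m) (x y : T) : (forall j : 'I_m, (dst u j < L)%N -> x j = y j) -> Z u x = Z u y.
    move=> xy; congr (_ * _); first by rewrite /cind xy// /dst subnn.
    by apply: eq_bigr => j ju; rewrite /cind xy.
  have aux (u v : 'I_m) : (u + 3 * L <= v)%N -> `|Cov mu (Z u) (Z v)| <= 16 * L%:R ^+ 2 * al L.
    move=> uv.
    apply: (@le_trans _ _ (4 * ((2 * L)%:R * (2 * L)%:R) * al L)); last first.
      by rewrite natrM le_eqVlt; apply/orP; left; apply/eqP; ring.
    apply: (Cov_dep mu_sum al_ge0 mix (n := u + L)) => //.
    - by move=> x y xy; apply: dep_near => j; rewrite /dst => h; apply: xy; lia.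
    - by move=> x y xy; apply: dep_near => j; rewrite /dst => h; apply: xy; lia.
  move=> h; have [ik|ki] := leqP i k; first by apply: aux; move: h; rewrite /dst; lia.
  by rewrite CovC; apply: aux; move: h; rewrite /dst; lia.
have bound (i : 'I_m) : \sum_(k < m) Cov mu (Z i) (Z k) <= 48 * L%:R ^+ 3 + m%:R * (16 * L%:R ^+ 2 * al L).
  rewrite (bigID (fun k : 'I_m => (dst i k < 3 * L)%N))/= lerD//.
    have -> : 48 * L%:R ^+ 3 = (2 * (3 * L))%:R * (8 * L%:R ^+ 2) :> R.
      by rewrite !natrM; ring.
    apply: le_trans (sum_near_le (3 * L) i _); last by rewrite mulr_ge0 ?exprn_ge0.
    apply: ler_sum => k _; rewrite (le_trans (ler_norm _))//.
    rewrite (le_trans (Cov_le_cst mu_ge0 mu_sum (Z1 i) (Z1 k)))// natrM le_eqVlt.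
    by apply/orP; left; apply/eqP; ring.
  rewrite -sum_cst_ord big_mkcond/=; apply: ler_sum => k _.
  case: ifPn => h; last by rewrite !mulr_ge0 ?exprn_ge0.
  by rewrite (le_trans (ler_norm _))// far// leqNgt.
have r4 : r ^+ 4 = m%:R ^+ 2 by rewrite -r2 -exprM.
have m0 : 0 < m%:R :> R by rewrite -r2 exprn_gt0.
rewrite mulrC ler_pdivrMr ?exprn_gt0// r4.
have -> : (48 * L%:R ^+ 3 / m%:R + 16 * L%:R ^+ 2 * al L) * m%:R ^+ 2 =
  m%:R * (48 * L%:R ^+ 3 + m%:R * (16 * L%:R ^+ 2 * al L)).
  by field; rewrite gt_eqF.
by rewrite -sum_cst_ord ler_sum.
Qed.

(* The three terms bound the dependence of X_i on the coordinates at distance at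
   least L, the Taylor remainder of the nearby ones, and the L^1 distance of
   sum_i X_i near_sum_i / r^2 to the variance of W. *)
Definition stein_error : R := 16 * (r * al L) + 4 * (lam ^+ 2 * L%:R ^+ 2 / r) +
  `|lam| * (Num.sqrt (48 * L%:R ^+ 3 / m%:R + 16 * L%:R ^+ 2 * al L) + 2 * K / L%:R ^+ 2).

(** For each i the block around i is removed from W: [U i] is the sine without the block, nearly
    uncorrelated with X_i, the first-order term in the block sums up to [Y], and [rho i] is the
    Taylor remainder. *)
Lemma stein_le : `|E (fun x => W x * sin (lam * W x + th)) -
  s2 * lam * E (fun x => cos (lam * W x + th))| <= stein_error.
Proof.
pose c x := cos (lam * W x + th).
pose U i x := sin (lam * ((past_sum i x + future_sum i x) / r) + th).
pose rho i x := U i x - (sin (lam * W x + th) - lam * (near_sum i x / r) * c x).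
have rho_le i x : `|rho i x| <= lam ^+ 2 * (2 * L)%:R ^+ 2 / r ^+ 2.
  have := sin_taylor1 (lam * W x + th) (lam * (near_sum i x / r)).
  have -> : lam * W x + th - lam * (near_sum i x / r) =
    lam * ((past_sum i x + future_sum i x) / r) + th.
    by rewrite /W (csumE i); ring.
  move=> h; apply: le_trans h _.
  rewrite exprMn expr_div_n mulrA ler_pM2r ?invr_gt0 ?exprn_gt0//.
  rewrite ler_wpM2l ?sqr_ge0// -real_normK ?num_real// lerXn2r ?nnegrE//.
have m0 : 0 < m%:R :> R by rewrite -r2 exprn_gt0.
have -> : E (fun x => W x * sin (lam * W x + th)) =
  \sum_(i < m) r^-1 * E (fun x => X i x * U i x) + lam * E (fun x => Y x * c x)
  - \sum_(i < m) r^-1 * E (fun x => X i x * rho i x).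
  under eq_bigr do rewrite -ExZ.
  under [X in _ - X]eq_bigr do rewrite -ExZ.
  rewrite -ExZ -!Ex_sum -ExD -ExB; apply: eq_Ex => x.
  have -> : W x * sin (lam * W x + th) = \sum_i X i x / r * sin (lam * W x + th).
    by rewrite -!mulr_suml.
  rewrite [Y x]/Y mulr_suml mulr_sumr -big_split -sumrB/=; apply: eq_bigr => i _.
  rewrite /rho; move: (sin _) (U i x) (c x) => s1 u1 c1; field.
  by rewrite gt_eqF.
have -> : lam * E (fun x => Y x * c x) = s2 * lam * E c +
  lam * (E (fun x => (Y x - E Y) * c x) + (E Y - s2) * E c).
  have -> : E (fun x => (Y x - E Y) * c x) = E (fun x => Y x * c x) - E Y * E c.
    by rewrite -ExZ -ExB; apply: eq_Ex => x; rewrite mulrBl.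
  by ring.
set A := \sum_i _; set B := \sum_i _.
have Ec1 : `|E c| <= 1 by apply: Ex_le_cst => // x; exact: cos_max.
have hA : `|A| <= 16 * (r * al L).
  rewrite (le_trans (ler_norm_sum _ _ _))//.
  have -> : 16 * (r * al L) = \sum_(i < m) r^-1 * (16 * al L).
    by rewrite sum_cst_ord -r2; field; rewrite gt_eqF.
  apply: ler_sum => i _; rewrite normrM gtr0_norm ?invr_gt0//.
  by rewrite ler_pM2l ?invr_gt0// head_le.
have hB : `|B| <= 4 * (lam ^+ 2 * L%:R ^+ 2 / r).
  rewrite (le_trans (ler_norm_sum _ _ _))//.
  have -> : 4 * (lam ^+ 2 * L%:R ^+ 2 / r) = \sum_(i < m) r^-1 * (lam ^+ 2 * (2 * L)%:R ^+ 2 / r ^+ 2).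
    by rewrite sum_cst_ord -r2 natrM; field; rewrite gt_eqF.
  apply: ler_sum => i _; rewrite normrM gtr0_norm ?invr_gt0//.
  rewrite ler_pM2l ?invr_gt0//; apply: Ex_le_cst => // x.
  by rewrite normrM -[leRHS]mul1r ler_pM// cind_le1.
have hC : `|E (fun x => (Y x - E Y) * c x)| <= Num.sqrt (48 * L%:R ^+ 3 / m%:R + 16 * L%:R ^+ 2 * al L).
  rewrite (le_trans (ler_norm_Ex mu_ge0 _))//.
  apply: (@le_trans _ _ (E (fun x => `|Y x - E Y|))).
    by apply: le_Ex => // x; rewrite normrM ler_piMr// cos_max.
  by rewrite (le_trans (Ex_norm_le_sqrt mu_ge0 mu_sum _))// ler_wsqrtr// Y_var.
have hD : `|(E Y - s2) * E c| <= 2 * K / L%:R ^+ 2.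
  rewrite normrM -[leRHS]mulr1 ler_pM//; exact: Y_bias.
have -> : A + (s2 * lam * E c + lam * (E (fun x => (Y x - E Y) * c x) + (E Y - s2) * E c)) - B
  - s2 * lam * E (fun x => cos (lam * W x + th)) =
  A - B + lam * (E (fun x => (Y x - E Y) * c x) + (E Y - s2) * E c).
  by rewrite -/c; ring.
rewrite /stein_error (le_trans (ler_normD _ _))// lerD//.
  by rewrite (le_trans (ler_normB _ _))// lerD.
rewrite normrM ler_wpM2l// (le_trans (ler_normD _ _))// lerD//.
Qed.

End stein_mixing.

Lemma is_derive_bigsum {R : realType} {I : Type} (s : seq I) (f df : I -> R -> R) (x : R) :
  (forall i, is_derive x (1 : R) (f i) (df i x)) ->
  is_derive x (1 : R) (fun l => \sum_(i <- s) f i l) (\sum_(i <- s) df i x).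
Proof.
move=> h; elim: s => [|i s IH].
  under eq_fun do rewrite big_nil.
  by rewrite big_nil; exact: is_derive_cst.
under eq_fun do rewrite big_cons.
by rewrite big_cons; exact: is_deriveD.
Qed.

(** * Characteristic function of a normalized mixing sum *)

Section charfun_mixing.
Context {R : realType} {m : nat}.
Local Notation T := {ffun 'I_m -> bool}.
Variables (mu : T -> R) (al : nat -> R) (K : R).
Hypothesis mu_ge0 : forall x, 0 <= mu x.
Hypothesis mu_sum : \sum_x mu x = 1.
Hypothesis al_ge0 : forall d, 0 <= al d.
Hypothesis al_sum : forall n, \sum_(1 <= d < n) d%:R ^+ 2 * al d <= K.
Hypothesis mix : mixing_array mu al.
Variables (L : nat) (r : R).
Hypothesis L_gt0 : (0 < L)%N.
Hypothesis r_gt0 : 0 < r.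
Hypothesis r2 : r ^+ 2 = m%:R.

Local Notation E := (Ex mu).
Let W x := csum mu x / r.
Let s2 := E (fun x => W x ^+ 2).

Lemma stein_error_le (l1 l2 : R) : 0 <= l1 <= l2 ->
  stein_error al K L r l1 (m := m) <= stein_error al K L r l2 (m := m).
Proof.
move=> /andP[l10 l12]; have l20 := le_trans l10 l12.
have K0 : 0 <= K by have := al_sum 0; rewrite big_geq.
rewrite /stein_error lerD//.
  rewrite lerD2l ler_wpM2l// ler_wpM2r ?invr_ge0 ?(ltW r_gt0)// ler_wpM2r ?exprn_ge0//.
  by rewrite lerXn2r.
by rewrite !ger0_norm// ler_wpM2r// addr_ge0 ?sqrtr_ge0// divr_ge0 ?exprn_ge0// mulr_ge0.
Qed.

(** [stein_le] says that phi' is close to - s2 l phi. With the integrating factor exp (s2 l^2 / 2)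
    the derivative of [g] is small, and the mean value theorem on [0, lam] concludes;
    [stein_error_le] moves the error from the intermediate point to lam. *)
Lemma charfun_le (lam th : R) : 0 <= lam ->
  `|E (fun x => cos (lam * W x + th)) - expR (- (s2 * lam ^+ 2 / 2)) * cos th| <=
  lam * expR (s2 * lam ^+ 2 / 2) * stein_error al K L r lam (m := m).
Proof.
rewrite le_eqVlt => /predU1P[<-|lam0].
  rewrite expr0n/= mulr0 mul0r oppr0 expR0 !mul0r mul1r.
  have -> : E (fun x => cos (0 * W x + th)) = cos th.
    by rewrite -[RHS](Ex_cst mu_sum); apply: eq_Ex => x; rewrite mul0r add0r.
  by rewrite subrr normr0.
have s20 : 0 <= s2 by apply: Ex_ge0 => // x; exact: sqr_ge0.
pose phi l := E (fun x => cos (l * W x + th)).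
pose dphi l := - E (fun x => W x * sin (l * W x + th)).
have dphiP (l : R) : is_derive l (1 : R) phi (dphi l).
  rewrite /phi /dphi /Ex -sumrN.
  apply: (@is_derive_bigsum _ _ _ (fun x l => mu x * cos (l * W x + th)) (fun x l => - (mu x * (W x * sin (l * W x + th))))) => x.
  by apply: is_derive_eq; rewrite /GRing.scale/=; ring.
pose g l := expR (s2 * l ^+ 2 / 2) * phi l.
pose dg l := expR (s2 * l ^+ 2 / 2) * (s2 * l * phi l + dphi l).
have dgP (l : R) : is_derive l (1 : R) g (dg l).
  have := dphiP l => dl.
  by rewrite /g; apply: is_derive_eq; rewrite /dg /GRing.scale/= !mulr0 add0r; field.
have cg : continuous g.
  by move=> z; apply/differentiable_continuous/derivable1_diffP; have [] := dgP z.
have [c /[!in_itv]/= /andP[c0 cl] h] := MVT lam0 (fun z _ => dgP z) (continuous_subspaceT cg).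
have g0 : g 0 = cos th.
  rewrite /g expr0n/= mulr0 mul0r expR0 mul1r -[RHS](Ex_cst mu_sum); apply: eq_Ex => x.
  by rewrite mul0r add0r.
have -> : E (fun x => cos (lam * W x + th)) - expR (- (s2 * lam ^+ 2 / 2)) * cos th =
  expR (- (s2 * lam ^+ 2 / 2)) * (g lam - g 0).
  by rewrite g0 mulrBr /g [expR _ * (expR _ * _)]mulrA -expRD addNr expR0 mul1r.
rewrite h subr0 normrM ger0_norm ?expR_ge0//.
have e1 : expR (- (s2 * lam ^+ 2 / 2)) <= 1.
  by rewrite -expR0 ler_expR oppr_le0 divr_ge0// mulr_ge0// sqr_ge0.
rewrite (le_trans (ler_wpM2r (normr_ge0 _) e1))// mul1r normrM mulrC (gtr0_norm lam0) -mulrA.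
rewrite ler_pM2l// /dg normrM ger0_norm ?expR_ge0// ler_pM ?expR_ge0//.
  by rewrite ler_expR ler_wpM2r// ler_wpM2l// lerXn2r ?nnegrE ?(ltW c0) ?(ltW lam0) ?(ltW cl).
apply: le_trans (stein_error_le (l1 := c) (l2 := lam) _); last by rewrite (ltW c0) (ltW cl).
have := stein_le mu_ge0 mu_sum al_ge0 al_sum mix L_gt0 r_gt0 r2 c th.
by rewrite -normrN opprB /dphi /phi.
Qed.

End charfun_mixing.

Lemma fifth_root (m : nat) : exists L, (L ^ 5 <= m < L.+1 ^ 5)%N.
Proof.
elim: m => [|m [L /andP[h1 h2]]]; first by exists 0%N.
have [h|h] := leqP (L.+1 ^ 5) m.+1.
  exists L.+1; rewrite h/= (leq_ltn_trans h2)// ltn_exp2r//.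
by exists L; rewrite h leqW.
Qed.

(* Blocks of length about m^(1/5) make every error term O(L^(-1/2)). *)
Lemma stein_error_small {R : realType} (al : nat -> R) (K lam e : R) :
  (forall d, 0 <= al d) -> (forall d d', (d <= d')%N -> al d' <= al d) ->
  (forall n, \sum_(1 <= d < n) d%:R ^+ 2 * al d <= K) -> 0 < e ->
  exists N : nat, forall m, (N <= m)%N -> exists2 L, (0 < L)%N &
    stein_error al K L (Num.sqrt m%:R) lam (m := m) <= e.
Proof.
move=> al0 al_le al_sum e0.
have K0 : 0 <= K by have := al_sum 0; rewrite big_geq.
(* With s = sqrt L, [C] collects the coefficients of 1 / s in [E1] to [E4]. Here 288 = 16 * 6 * 3
   comes from r <= 6 s^5 and al(L) <= 3 K / s^6, and [N0] is chosen so that C / s <= e. *)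
pose C := 288 * K + 4 * lam ^+ 2 + `|lam| * (Num.sqrt (48 + 48 * K) + 2 * K).
have C0 : 0 <= C.
  apply: addr_ge0; first by apply: addr_ge0; rewrite mulr_ge0 ?ler0n ?sqr_ge0.
  by rewrite mulr_ge0// addr_ge0 ?sqrtr_ge0// mulr_ge0.
pose N0 := (Num.truncn ((C / e) ^+ 2)).+1.
exists (N0 ^ 5)%N => m Nm.
have [L /andP[L1 L2]] := fifth_root m.
have NL : (N0 <= L)%N by rewrite -ltnS -(@ltn_exp2r _ _ 5)// (leq_ltn_trans Nm).
have L0 : (0 < L)%N by apply: leq_trans NL.
exists L => //.
have L0R : 0 < L%:R :> R by rewrite ltr0n.
pose s := Num.sqrt (L%:R : R).
have s0 : 0 < s by rewrite sqrtr_gt0.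
have s2 : s ^+ 2 = L%:R by rewrite sqr_sqrtr// ltW.
have s1 : 1 <= s by rewrite -sqrtr1 ler_wsqrtr// ler1n.
have m0 : 0 < m%:R :> R by rewrite ltr0n (leq_trans _ L1)// expn_gt0 L0.
pose r := Num.sqrt (m%:R : R).
have r2 : r ^+ 2 = m%:R by rewrite sqr_sqrtr// ltW.
have r0 : 0 < r by rewrite sqrtr_gt0.
have rs : s ^+ 5 <= r.
  rewrite -(@ler_pXn2r _ 2)// ?nnegrE ?exprn_ge0 ?(ltW s0) ?(ltW r0)// r2.
  by rewrite -exprM mulnC exprM s2 -natrX ler_nat.
(* m < (L + 1)^5 <= 32 L^5, and 36 is the next perfect square. *)
have rs6 : r <= 6 * s ^+ 5.
  rewrite -(@ler_pXn2r _ 2)// ?nnegrE ?mulr_ge0 ?exprn_ge0 ?(ltW s0) ?(ltW r0)// r2.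
  rewrite exprMn -exprM (exprM s 2 5) s2 -!natrX -natrM ler_nat.
  rewrite (leq_trans (ltnW L2))// (leq_trans (n := (2 * L) ^ 5))//.
    by rewrite leq_exp2r//; lia.
  by rewrite expnMn leq_mul2r orbT.
have alL := al_cube al0 al_le al_sum L0.
have Cs : C / s <= e.
  rewrite ler_pdivrMr// mulrC -ler_pdivrMr//.
  rewrite -(@ler_pXn2r _ 2)// ?nnegrE ?divr_ge0 ?(ltW s0) ?(ltW e0)// s2.
  have hN : (C / e) ^+ 2 < N0%:R by rewrite truncnS_gt.
  by rewrite (le_trans (ltW hN))// ler_nat.
apply: le_trans Cs.
rewrite /stein_error -/r /C; rewrite -s2 in alL *.
have E1 : 16 * (r * al L) <= 288 * K / s.
  have -> : 288 * K / s = 16 * (6 * s ^+ 5 * (3 * K / (s ^+ 2) ^+ 3)).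
    by field; rewrite gt_eqF.
  by rewrite ler_wpM2l// ler_pM// ltW.
have E2 : 4 * (lam ^+ 2 * (s ^+ 2) ^+ 2 / r) <= 4 * lam ^+ 2 / s.
  have -> : 4 * lam ^+ 2 / s = 4 * (lam ^+ 2 * (s ^+ 2) ^+ 2 / s ^+ 5).
    by field; rewrite gt_eqF.
  apply: ler_wpM2l => //; apply: ler_wpM2l; first by rewrite mulr_ge0// sqr_ge0.
  by rewrite lef_pV2 ?posrE ?exprn_gt0.
have E3 : Num.sqrt (48 * (s ^+ 2) ^+ 3 / m%:R + 16 * (s ^+ 2) ^+ 2 * al L) <= Num.sqrt (48 + 48 * K) / s.
  rewrite ler_pdivlMr// -(@ler_pXn2r _ 2)// ?nnegrE ?mulr_ge0 ?sqrtr_ge0 ?(ltW s0)//.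
  have h1 : 48 * (s ^+ 2) ^+ 3 / m%:R <= 48 / s ^+ 2.
    have -> : 48 / s ^+ 2 = 48 * (s ^+ 2) ^+ 3 / (s ^+ 5 * s ^+ 3) by field; rewrite gt_eqF.
    rewrite ler_wpM2l ?mulr_ge0 ?exprn_ge0 ?(ltW s0)//.
    rewrite lef_pV2 ?posrE ?mulr_gt0 ?exprn_gt0// -r2 expr2 ler_pM ?exprn_ge0 ?(ltW s0)//.
    by rewrite (le_trans _ rs)// ler_weXn2l.
  have h2 : 16 * (s ^+ 2) ^+ 2 * al L <= 48 * K / s ^+ 2.
    have -> : 48 * K / s ^+ 2 = 16 * (s ^+ 2) ^+ 2 * (3 * K / (s ^+ 2) ^+ 3) by field; rewrite gt_eqF.
    by rewrite ler_wpM2l ?mulr_ge0 ?exprn_ge0 ?(ltW s0).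
  have q1 : 0 <= 48 + 48 * K by apply: addr_ge0; rewrite ?mulr_ge0 ?ler0n.
  have q2 : 0 <= 48 * (s ^+ 2) ^+ 3 / m%:R + 16 * (s ^+ 2) ^+ 2 * al L.
    apply: addr_ge0; last by apply: mulr_ge0 => //; apply: mulr_ge0; [rewrite ler0n|exact: sqr_ge0].
    by rewrite divr_ge0 ?(ltW m0)// mulr_ge0 ?ler0n// exprn_ge0// sqr_ge0.
  rewrite exprMn (sqr_sqrtr q1) (sqr_sqrtr q2).
  rewrite -ler_pdivlMr ?exprn_gt0// [leRHS]mulrDl.
  exact: lerD.
have E4 : 2 * K / (s ^+ 2) ^+ 2 <= 2 * K / s.
  rewrite ler_wpM2l ?mulr_ge0// lef_pV2 ?posrE ?exprn_gt0// -exprM.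
  by rewrite -[leLHS]expr1 ler_weXn2l.
have E5 := ler_wpM2l (normr_ge0 lam) (lerD E3 E4).
apply: le_trans (lerD (lerD E1 E2) E5) _.
by rewrite le_eqVlt; apply/orP; left; apply/eqP; ring.
Qed.

(** * Characteristic functions of Gaussian laws *)

Section gaussian_stein.
Context {R : realType}.
Variable s : R.
Hypothesis s_gt0 : 0 < s.
Local Notation mu := (@lebesgue_measure R).
Local Notation p := (normal_pdf 0 s).

Let s_neq0 : s != 0. Proof. by rewrite gt_eqF. Qed.

Lemma normal_pdf0E (x : R) : p x = normal_peak s * expR (- x ^+ 2 / (2 * s ^+ 2)).
Proof. by rewrite normal_pdfE// /normal_fun subr0 -[s ^+ 2 *+ 2]mulr_natl. Qed.

Lemma is_derive_normal_pdf (x : R) : is_derive x (1 : R) p (- x / s ^+ 2 * p x).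
Proof.
rewrite (_ : p = fun x => normal_peak s * expR (- x ^+ 2 / (2 * s ^+ 2))); last first.
  by apply/funext => z; rewrite normal_pdf0E.
apply: is_derive_eq; rewrite /GRing.scale/= !mulr0 add0r.
by field.
Qed.

(** Dominates |x| p(x) by an integrable function without computing Gaussian moments. Doubling the
    standard deviation gains the factor e^u with u = 3 x^2 / (8 s^2), and e^u >= 1 + u absorbs |x|
    <= 1 + x^2. *)
Lemma norm_mul_pdf_le : exists2 C : R, 0 <= C & forall x : R, `|x| * p x <= C * normal_pdf 0 (2 * s) x.
Proof.
have s20 : 2 * s != 0 by rewrite mulf_neq0.
exists (normal_peak s / normal_peak (2 * s) * (1 + 8 / 3 * s ^+ 2)).
  by rewrite mulr_ge0 ?divr_ge0 ?normal_peak_ge0// addr_ge0// mulr_ge0 ?sqr_ge0// divr_ge0 ?ler0n.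
move=> x; rewrite normal_pdf0E normal_pdfE// /normal_fun subr0.
have pk0 : 0 < normal_peak (2 * s) by rewrite normal_peak_gt0.
set e1 := expR _; set e2 := expR _.
have -> : normal_peak s / normal_peak (2 * s) * (1 + 8 / 3 * s ^+ 2) * (normal_peak (2 * s) * e2) =
  normal_peak s * ((1 + 8 / 3 * s ^+ 2) * e2) by field; rewrite gt_eqF.
rewrite mulrCA ler_wpM2l ?normal_peak_ge0//.
pose u := 3 / 8 * (x ^+ 2 / s ^+ 2).
have -> : e2 = expR u * e1.
  by rewrite /e2 /e1 -expRD; congr expR; rewrite /u -mulr_natl; field.
rewrite mulrA ler_wpM2r ?expR_ge0//.
have u0 : 0 <= u by rewrite mulr_ge0 ?divr_ge0 ?sqr_ge0 ?ler0n.
have h1 := expR_ge1Dx u.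
apply: (@le_trans _ _ ((1 + 8 / 3 * s ^+ 2) * (1 + u))); last first.
  by rewrite ler_wpM2l// addr_ge0// mulr_ge0 ?sqr_ge0// divr_ge0 ?ler0n.
have -> : (1 + 8 / 3 * s ^+ 2) * (1 + u) = 1 + x ^+ 2 + (8 / 3 * s ^+ 2 + u).
  by rewrite /u; field.
have h2 : 0 <= 8 / 3 * s ^+ 2 by rewrite mulr_ge0 ?sqr_ge0// divr_ge0 ?ler0n.
have : 0 <= (`|x| - 1) ^+ 2 by exact: sqr_ge0.
rewrite sqrrB real_normK ?num_real//; have := normr_ge0 x; lra.
Qed.

Lemma integrable_mul_pdf (f : R -> R) : measurable_fun setT f -> (forall x, `|f x| <= `|x|) ->
  mu.-integrable setT (fun x => (f x * p x)%:E).
Proof.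
move=> mf fx; have [C C0 hC] := norm_mul_pdf_le.
apply: (@le_integrable _ _ _ mu setT measurableT _ (fun x => (C%:E * (normal_pdf 0 (2 * s) x)%:E)%E)) => //.
- by apply/measurable_EFinP/measurable_funM => //; exact: measurable_normal_pdf.
- move=> x _; rewrite -EFinM !abse_EFin lee_fin !normrM (ger0_norm C0).
  rewrite !(ger0_norm (normal_pdf_ge0 _ _ _)); apply: le_trans (hC x).
  by rewrite ler_wpM2r// normal_pdf_ge0.
- by apply: integrableZl => //; exact: integrable_normal_pdf.
Qed.

Lemma integrable_bounded_pdf (f : R -> R) (M : R) : measurable_fun setT f -> (forall x, `|f x| <= M) ->
  mu.-integrable setT (fun x => (f x * p x)%:E).
Proof.
move=> mf fM.
apply: (@le_integrable _ _ _ mu setT measurableT _ ( fun x => (M%:E * (p x)%:E)%E)) => //.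
- by apply/measurable_EFinP/measurable_funM => //; exact: measurable_normal_pdf.
- move=> x _; rewrite -EFinM !abse_EFin lee_fin !normrM ler_wpM2r//.
  exact: le_trans (fM x) (ler_norm _).
- by apply: integrableZl => //; exact: integrable_normal_pdf.
Qed.

Lemma cvg_pdf_nat : p n.+1%:R @[n --> \oo] --> 0.
Proof.
have [C C0 hC] := norm_mul_pdf_le.
have s20 : 2 * s != 0 by rewrite mulf_neq0.
apply: (@squeeze_cvgr _ _ _ _ (fun=> 0) (fun n => C * normal_peak (2 * s) * harmonic n)).
- apply: nearW => n; rewrite normal_pdf_ge0/= /harmonic/= ler_pdivlMr ?ltr0n// mulrC.
  have := hC n.+1%:R; rewrite ger0_norm// => h; apply: le_trans h _.
  by rewrite ler_wpM2l// normal_pdf_ub.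
- exact: cvg_cst.
- rewrite -[X in _ --> X](mulr0 (C * normal_peak (2 * s))).
  by apply: cvgMr; exact: cvg_harmonic.
Qed.

End gaussian_stein.

Section gaussian_charfun.
Context {R : realType}.
Variable s : R.
Hypothesis s_gt0 : 0 < s.
Local Notation mu := (@lebesgue_measure R).
Local Notation p := (normal_pdf 0 s).

Lemma measurable_cos_affine (lam th : R) : measurable_fun setT (fun x : R => cos (lam * x + th)).
Proof.
apply: measurableT_comp; first by apply: continuous_measurable_fun; exact: continuous_cos.
by apply: measurable_funD => //; apply: measurable_funM.
Qed.

Lemma measurable_sin_affine (lam th : R) : measurable_fun setT (fun x : R => sin (lam * x + th)).
Proof.
apply: measurableT_comp; first by apply: continuous_measurable_fun; exact: continuous_sin.
by apply: measurable_funD => //; apply: measurable_funM.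
Qed.

Variables (lam th : R).

Let cosp (x : R) := cos (lam * x + th) * p x.
Let xsinp (x : R) := x * sin (lam * x + th) * p x.

Let integrable_cosp : mu.-integrable setT (EFin \o cosp).
Proof.
apply: (@integrable_bounded_pdf _ s (fun x => cos (lam * x + th)) 1); first exact: measurable_cos_affine.
by move=> x; exact: cos_max.
Qed.

Let integrable_xsinp : mu.-integrable setT (EFin \o xsinp).
Proof.
apply: (@integrable_mul_pdf _ _ s_gt0 (fun x => x * sin (lam * x + th))).
  by apply: measurable_funM => //; exact: measurable_sin_affine.
by move=> x; rewrite normrM ler_piMr// sin_max.
Qed.

Let h (x : R) := sin (lam * x + th) * p x.
Let dh (x : R) := lam * cosp x - s ^- 2 * xsinp x.

Let dhP (x : R) : is_derive x (1 : R) h (dh x).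
Proof.
have := is_derive_normal_pdf s_gt0 x => ?.
apply: is_derive_eq; rewrite /dh /cosp /xsinp /GRing.scale/=.
by field; rewrite gt_eqF.
Qed.

Let continuous_dh : continuous dh.
Proof.
have cp : continuous p by apply: continuous_normal_pdf; rewrite gt_eqF.
have ca (x : R) : (lam * z + th) @[z --> x] --> lam * x + th.
  by apply: cvgD; [apply: cvgMr; exact: cvg_id|exact: cvg_cst].
move=> x; apply: cvgB; apply: cvgMr.
  apply: cvgM; last exact: cp.
  by apply: (cvg_comp _ cos (ca x)); exact: continuous_cos.
apply: cvgM; last exact: cp.
apply: cvgM; first exact: cvg_id.
by apply: (cvg_comp _ sin (ca x)); exact: continuous_sin.
Qed.

Let integrable_dh : mu.-integrable setT (EFin \o dh).
Proof.
rewrite /comp /dh; under eq_fun do rewrite EFinB !EFinM.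
by apply: integrableB => //; apply: integrableZl.
Qed.

Let I (n : nat) : set R := `[- n.+1%:R, n.+1%:R].

Let integral_dh_itv n :
  (\int[mu]_(x in I n) (dh x)%:E = (h n.+1%:R - h (- n.+1%:R))%:E)%E.
Proof.
have ch : continuous h.
  by move=> z; apply/differentiable_continuous/derivable1_diffP; have [] := dhP z.
rewrite (continuous_FTC2 (F := h)) ?EFinB//.
- by rewrite gtrN// ltr0n.
- exact: continuous_subspaceT.
- split; first by move=> x _; have [] := dhP x.
  + exact/cvg_at_right_filter/ch.
  + exact/cvg_at_left_filter/ch.
- by move=> x _; rewrite derive1E; have := dhP x => ?; rewrite derive_val.
Qed.

(** The integral over [-n-1, n+1] is a difference of two values of [h], which tend to 0 with the
    density; dominated convergence under |dh| passes to the whole line. *)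
Let integral_dh : (\int[mu]_x (dh x)%:E = 0)%E.
Proof.
have [|||||_ _] := @dominated_convergence _ _ _ mu setT measurableT
  (fun n => EFin \o (dh \_ (I n))) (EFin \o dh) (fun x => `|(dh x)%:E|%E).
- move=> n; apply/measurable_EFinP; apply/measurable_restrict => //.
    exact: measurable_itv.
  by apply/measurable_EFinP/measurable_funTS; case/integrableP : integrable_dh.
- by case/integrableP : integrable_dh.
- apply: aeW => x _; apply: cvg_near_cst; near=> n.
  rewrite /= patchE mem_set// /I /= in_itv/= -ler_norml.
  apply: le_trans (ltW (truncnS_gt `|x|)) _; rewrite ler_nat ltnS.
  by near: n; exact: nbhs_infty_ge.
- exact: (integrable_abse integrable_dh).
- apply: aeW => x n _ /=; rewrite patchE; case: ifP => // _.
  by rewrite (_ : point = 0 :> R)// lee_fin normr0 normr_ge0.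
move=> h1.
have h2 : [sequence (\int[mu]_x (EFin \o (dh \_ (I n))) x)%E]_n @ \oo --> 0%E.
  have -> : [sequence (\int[mu]_x (EFin \o (dh \_ (I n))) x)%E]_n =
    (fun n => (h n.+1%:R - h (- n.+1%:R))%:E).
    apply/funext => n; rewrite -integral_dh_itv [RHS]integral_mkcond.
    by apply: eq_integral => x _; rewrite /= restrict_EFin.
  apply: cvg_EFin; first exact: nearW.
  have hn (u : nat -> R) : (forall n, p (u n) = p n.+1%:R) -> h (u n) @[n --> \oo] --> 0.
    move=> pu; apply: norm_cvg0.
    apply: (@squeeze_cvgr _ _ _ _ (fun=> 0) (fun n => p n.+1%:R)).
    - apply: nearW => n; rewrite normr_ge0/= /h normrM pu (ger0_norm (normal_pdf_ge0 _ _ _)).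
      by rewrite ler_piMl ?normal_pdf_ge0// sin_max.
    - exact: cvg_cst.
    - exact: cvg_pdf_nat.
  rewrite -[X in _ --> X](subr0 0); apply: cvgB; apply: hn => // n.
  by rewrite !normal_pdf0E// sqrrN.
exact: (cvg_unique _ h1 h2).
Unshelve. all: end_near.
Qed.

(** Gaussian integration by parts, the exact counterpart of the approximate identity [stein_le]. *)
Lemma gaussian_stein : \int[mu]_x xsinp x = s ^+ 2 * lam * \int[mu]_x cosp x.
Proof.
have : \int[mu]_x dh x = 0 by rewrite /Rintegral integral_dh.
rewrite /dh RintegralB//; last 2 first.
- rewrite (_ : _ \o _ = fun x => (lam%:E * (cosp x)%:E)%E)//.
  by apply: integrableZl.
- rewrite (_ : _ \o _ = fun x => ((s ^- 2)%:E * (xsinp x)%:E)%E)//.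
  by apply: integrableZl.
rewrite !RintegralZl// => /eqP; rewrite subr_eq0 => /eqP.
move=> e; rewrite -mulrA e mulrA divff ?mul1r//.
by rewrite expf_neq0// gt_eqF.
Qed.

End gaussian_charfun.

Section normal_charfun.
Context {R : realType}.
Variable s : R.
Hypothesis s_gt0 : 0 < s.
Local Notation mu := (@lebesgue_measure R).
Local Notation p := (normal_pdf 0 s).
Variable th : R.

Let psi (l : R) := \int[mu]_x (cos (l * x + th) * p x).

(** Differentiation under the integral, dominated by |x| p(x), gives minus the integral of x sin (l
    x + th) p(x), which [gaussian_stein] expresses through [psi]. *)
Let is_derive_psi (l : R) : is_derive l (1 : R) psi (- (s ^+ 2 * l) * psi l).
Proof.
pose f (l x : R) := cos (l * x + th) * p x.
have d1f (y x : R) : is_derive y (1 : R) (f ^~ x) (- (x * sin (y * x + th) * p x)).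
  by rewrite /f; apply: is_derive_eq; rewrite /GRing.scale/=; ring.
have intf y : mu.-integrable setT (EFin \o f y).
  apply: (@integrable_bounded_pdf _ s (fun x => cos (y * x + th)) 1).
    exact: measurable_cos_affine.
  by move=> x; exact: cos_max.
have intG : mu.-integrable setT (EFin \o (fun x => `|x| * p x)).
  apply: (@integrable_mul_pdf _ _ s_gt0 (fun x => `|x|)) => //.
  by move=> x; rewrite normr_id.
have Il : `]l - 1, l + 1[%classic l by rewrite /= in_itv/=; lra.
have derf y x : derivable (f ^~ x) y 1 by have [] := d1f y x.
have G_ub y x : `|partial1of2 f y x| <= `|x| * p x.
  rewrite partial1of2E; have := d1f y x => ?; rewrite derive_val.
  rewrite normrN normrM (ger0_norm (normal_pdf_ge0 _ _ _)) ler_wpM2r ?normal_pdf_ge0//.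
  by rewrite normrM ler_piMr// sin_max.
have G_ge0 (x : R) : 0 <= `|x| * p x by rewrite mulr_ge0// normal_pdf_ge0.
apply: DeriveDef.
  exact: (@derivable_under_integral _ _ _ mu f setT measurableT l (l - 1) (l + 1) Il
    (fun y _ => intf y) (fun y x _ _ => derf y x) _ G_ge0 intG (fun y x _ _ => G_ub y x)).
rewrite -derive1E (@differentiation_under_integral _ _ _ mu f setT measurableT l (l - 1) (l + 1) Il
    (fun y _ => intf y) (fun y x _ _ => derf y x) _ G_ge0 intG (fun y x _ _ => G_ub y x)).
rewrite mulNr -(gaussian_stein s_gt0 l th).
rewrite -mulN1r -RintegralZl//; last first.
  apply: (@integrable_mul_pdf _ _ s_gt0 (fun x => x * sin (l * x + th))).
    by apply: measurable_funM => //; exact: measurable_sin_affine.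
  by move=> x; rewrite normrM ler_piMr// sin_max.
apply: eq_Rintegral => x _.
by rewrite partial1of2E; have := d1f l x => ?; rewrite derive_val mulN1r.
Qed.

Lemma pdf_charfun (l : R) :
  \int[mu]_x (cos (l * x + th) * p x) = expR (- (s ^+ 2 * l ^+ 2 / 2)) * cos th.
Proof.
pose g l := expR (s ^+ 2 * l ^+ 2 / 2) * psi l.
have dg (y : R) : is_derive y (1 : R) g 0.
  have := is_derive_psi y => ?.
  rewrite /g; apply: is_derive_eq; rewrite /GRing.scale/= !mulr0 add0r.
  by field.
have gl := is_derive_0_is_cst l 0 dg.
have psi0 : psi 0 = cos th.
  rewrite /psi; under eq_Rintegral do rewrite mul0r add0r.
  rewrite RintegralZl//; last exact: integrable_normal_pdf.
  by rewrite /Rintegral integral_normal_pdf/= mulr1.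
rewrite -[LHS]/(psi l).
have -> : psi l = expR (- (s ^+ 2 * l ^+ 2 / 2)) * g l.
  by rewrite /g mulrA -expRD addNr expR0 mul1r.
by rewrite gl /g expr0n/= mulr0 mul0r expR0 mul1r psi0.
Qed.

(** Change of variables through the Radon-Nikodym derivative of [normal_prob], which agrees almost
    everywhere with [normal_pdf] because both have the same integral over every measurable set. *)
Lemma integral_normal_prob (f : R -> R) : measurable_fun setT f ->
  (exists M : R, forall x, `|f x| <= M) ->
  \int[normal_prob 0 s]_x f x = \int[mu]_x (f x * p x).
Proof.
move=> mf [M fM]; rewrite /Rintegral; congr fine.
have iP : (normal_prob 0 s).-integrable setT (fun x : measurableTypeR R => (f x)%:E).
  apply: measurable_bounded_integrable => //.
    by rewrite -ge0_fin_numE// fin_num_measure.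
  exists M; split; first exact: num_real.
  by move=> y My x _; exact: le_trans (fM x) (ltW My).
have dom := @normal_prob_dominates R 0 s.
rewrite -(Radon_Nikodym_change_of_variables dom)//=.
apply: ae_eq_integral => //.
- apply: emeasurable_funM; first exact/measurable_EFinP.
  by apply: (measurable_int mu); exact: Radon_Nikodym_integrable.
- by apply/measurable_EFinP/measurable_funM => //; exact: measurable_normal_pdf.
rewrite (_ : (fun x => (f x * p x)%:E) = (fun x => ((f x)%:E * (p x)%:E)%E)); last by [].
apply: ae_eqe_mul2l => /=.
rewrite Radon_NikodymE//=.
case: cid => /= h [h1 h2 h3].
apply: integral_ae_eq => //=.
- by apply/measurable_EFinP; exact: measurable_normal_pdf.
- by move=> E _ mE; rewrite -h3.
Qed.

Lemma normal_prob_charfun (l : R) :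
  \int[normal_prob 0 s]_x cos (l * x + th) = expR (- (s ^+ 2 * l ^+ 2 / 2)) * cos th.
Proof.
rewrite integral_normal_prob ?pdf_charfun//; first exact: measurable_cos_affine.
by exists 1 => x; exact: cos_max.
Qed.

End normal_charfun.

(** * From characteristic functions to distribution functions *)

Section bounded_expectation.
Context d {T : measurableType d} {R : realType}.
Variable P : probability T R.
Implicit Types (f g : T -> R).

(** Such functions are integrable for every probability, so linearity and monotonicity of the
    integral carry no other side condition. *)
Definition bmf f := measurable_fun setT f /\ exists M : R, forall x, `|f x| <= M.

Lemma bmf_integrable f : bmf f -> P.-integrable setT (EFin \o f).
Proof.
move=> [mf [M fM]]; apply: measurable_bounded_integrable => //.
  by rewrite -ge0_fin_numE// fin_num_measure.
exists M; split; first exact: num_real.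
by move=> y My x _; exact: le_trans (fM x) (ltW My).
Qed.

Lemma bmf_cst c : bmf (fun=> c).
Proof. by split => //; exists `|c| => x. Qed.

Lemma bmfD f g : bmf f -> bmf g -> bmf (fun x => f x + g x).
Proof.
move=> [mf [M fM]] [mg [N gN]]; split; first exact: measurable_funD.
by exists (M + N) => x; rewrite (le_trans (ler_normD _ _))// lerD.
Qed.

Lemma bmfM f g : bmf f -> bmf g -> bmf (fun x => f x * g x).
Proof.
move=> [mf [M fM]] [mg [N gN]]; split; first exact: measurable_funM.
by exists (M * N) => x; rewrite normrM ler_pM.
Qed.

Lemma bmfZ c f : bmf f -> bmf (fun x => c * f x).
Proof. by move=> bf; apply: bmfM => //; exact: bmf_cst. Qed.

Lemma bmf_sum (I : Type) (s : seq I) (f : I -> T -> R) :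
  (forall i, bmf (f i)) -> bmf (fun x => \sum_(i <- s) f i x).
Proof.
move=> bf; elim: s => [|i s IH].
  by under eq_fun do rewrite big_nil; exact: bmf_cst.
by under eq_fun do rewrite big_cons; exact: bmfD.
Qed.

Lemma bmf_indic (A : set T) : measurable A -> bmf (\1_A : T -> R).
Proof.
by move=> mA; split => //; exists 1 => x; rewrite indicE normr_nat; case: (_ \in _).
Qed.

Lemma bmf_cos (X : T -> R) : measurable_fun setT X -> bmf (fun x => cos (X x)).
Proof.
move=> mX; split; last by exists 1 => x; exact: cos_max.
apply: measurableT_comp => //.
by apply: continuous_measurable_fun; exact: continuous_cos.
Qed.

Lemma Rint_cst c : \int[P]_x c = c.
Proof.
rewrite Rintegral_cst//= [X in fine X](_ : _ = 1%E) ?mulr1//; exact: probability_setT.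
Qed.

Lemma RintD f g : bmf f -> bmf g -> \int[P]_x (f x + g x) = \int[P]_x f x + \int[P]_x g x.
Proof. by move=> bf bg; rewrite RintegralD//; exact: bmf_integrable. Qed.

Lemma RintZ c f : bmf f -> \int[P]_x (c * f x) = c * \int[P]_x f x.
Proof. by move=> bf; rewrite RintegralZl//; exact: bmf_integrable. Qed.

Lemma Rint_sum (I : Type) (s : seq I) (f : I -> T -> R) : (forall i, bmf (f i)) ->
  \int[P]_x (\sum_(i <- s) f i x) = \sum_(i <- s) \int[P]_x f i x.
Proof.
move=> bf; elim: s => [|i s IH].
  under eq_Rintegral do rewrite big_nil.
  by rewrite Rint_cst big_nil.
under eq_Rintegral do rewrite big_cons.
by rewrite big_cons RintD ?IH//; exact: bmf_sum.
Qed.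

Lemma le_Rint f g : bmf f -> bmf g -> (forall x, f x <= g x) -> \int[P]_x f x <= \int[P]_x g x.
Proof. by move=> bf bg fg; apply: le_Rintegral => //; exact: bmf_integrable. Qed.

Lemma Rint_indic (A : set T) : measurable A -> \int[P]_x \1_A x = fine (P A).
Proof. by move=> mA; rewrite /Rintegral integral_indic// setIT. Qed.

Definition pr (A : set T) : R := fine (P A).

Lemma prE (A : set T) : measurable A -> P A = (pr A)%:E.
Proof. by move=> mA; rewrite fineK// fin_num_measure. Qed.

Lemma pr_ge0 (A : set T) : 0 <= pr A.
Proof. by rewrite fine_ge0. Qed.

Lemma le_pr (A B : set T) : measurable A -> measurable B -> A `<=` B -> pr A <= pr B.
Proof. by move=> mA mB AB; rewrite -lee_fin -!prE// le_measure ?inE. Qed.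

Lemma pr_le1 (A : set T) : measurable A -> pr A <= 1.
Proof. by move=> mA; rewrite -lee_fin -prE// probability_le1. Qed.

Lemma pr_setU_le (A B : set T) : measurable A -> measurable B -> pr (A `|` B) <= pr A + pr B.
Proof.
move=> mA mB; rewrite -lee_fin EFinD -!prE//; last exact: measurableU.
exact: measureU2.
Qed.

Lemma pr_setU (A B : set T) : measurable A -> measurable B -> A `&` B = set0 ->
  pr (A `|` B) = pr A + pr B.
Proof.
move=> mA mB AB; apply: EFin_inj; rewrite EFinD -!prE//; last exact: measurableU.
by rewrite measureU//; apply/eqP.
Qed.

Lemma prC (A : set T) : measurable A -> pr (~` A) = 1 - pr A.
Proof.
move=> mA; apply: EFin_inj; rewrite EFinB -!prE//; last exact: measurableC.
exact: probability_setC.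
Qed.

Lemma pr_bigcup_le (I : finType) (A : I -> set T) (Q : pred I) :
  (forall i, measurable (A i)) ->
  pr [set x | exists2 i, Q i & A i x] <= \sum_(i | Q i) pr (A i).
Proof.
move=> mA.
have -> : [set x | exists2 i, Q i & A i x] = \big[setU/set0]_(i <- [seq i <- index_enum I | Q i]) A i.
  apply/seteqP; split => x.
    move=> [i Qi Aix]; rewrite -bigcup_seq; exists i => //.
    by rewrite /= mem_filter Qi mem_index_enum.
  rewrite -bigcup_seq => -[i /=]; rewrite mem_filter => /andP[Qi _] Aix.
  by exists i.
rewrite -[leRHS]big_filter; elim: [seq _ <- _ | _] => [|i s IH].
  by rewrite !big_nil /pr measure0.
rewrite !big_cons (le_trans (pr_setU_le _ _))// ?lerD2l//.
by apply: bigsetU_measurable.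
Qed.

Lemma pr_abs_gt_small (X : T -> R) (e : R) : measurable_fun setT X -> 0 < e ->
  exists2 M : R, 0 < M & pr [set x | M < `|X x|] <= e.
Proof.
move=> mX e0.
pose A n := [set x | n.+1%:R < `|X x|].
have mA n : measurable (A n).
  have -> : A n = (fun x => `|X x|) @^-1` `]n.+1%:R, +oo[%classic.
    by apply/seteqP; split => x; rewrite /A /= in_itv/= andbT.
  rewrite -[X in measurable X]setTI.
  by apply: (measurableT_comp (f := fun z : R => `|z|)).
have : P \o A @ \oo --> P (\bigcap_n A n).
  apply: nonincreasing_cvg_mu => //.
  - by rewrite -ge0_fin_numE// fin_num_measure.
  - exact: bigcap_measurable.
  - move=> n k nk; apply/subsetPset => x /=; apply: le_lt_trans.
    by rewrite ler_nat.
have -> : \bigcap_n A n = set0.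
  apply/seteqP; split => // x /(_ (Num.truncn `|X x|) I) /= h.
  by have := truncnS_gt `|X x|; rewrite ltNge (ltW h).
rewrite measure0 => /fine_cvg /= h.
have [N _ hN] : \forall n \near \oo, pr (A n) < e by apply: (cvgr_lt _ h).
exists N.+1%:R; first by rewrite ltr0n.
by apply: ltW; apply: (hN N) => /=.
Qed.

(** The open intervals shrink to the empty set, so that an atom of X at y is harmless. *)
Lemma pr_left_nbhs_small (X : T -> R) (y e : R) : measurable_fun setT X -> 0 < e ->
  exists2 eta : R, 0 < eta & pr [set x | y - eta < X x < y] <= e.
Proof.
move=> mX e0.
pose A n := [set x | y - n.+1%:R^-1 < X x < y].
have mA n : measurable (A n).
  have -> : A n = X @^-1` `]y - n.+1%:R^-1, y[%classic.
    by apply/seteqP; split => x; rewrite /A /= in_itv/=.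
  rewrite -[X in measurable X]setTI; exact: mX.
have : P \o A @ \oo --> P (\bigcap_n A n).
  apply: nonincreasing_cvg_mu => //.
  - by rewrite -ge0_fin_numE// fin_num_measure.
  - exact: bigcap_measurable.
  - move=> n k nk; apply/subsetPset => x /= /andP[h1 h2]; rewrite /A /= h2 andbT.
    by apply: le_lt_trans h1; rewrite lerD2l lerN2 lef_pV2 ?posrE ?ltr0n// ler_nat.
have -> : \bigcap_n A n = set0.
  apply/seteqP; split => // x h.
  have /andP[_ h1] := h 0%N I.
  have yX : 0 < (y - X x)^-1 by rewrite invr_gt0 subr_gt0.
  have /andP[h2 _] := h (Num.truncn (y - X x)^-1) I.
  have := truncnS_gt (y - X x)^-1.
  rewrite -[X in _ < X]invrK ltf_pV2 ?posrE ?invr_gt0 ?ltr0n ?subr_gt0//.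
  by rewrite ltrBrDl -ltrBrDr => h3; have := lt_trans h2 h3; rewrite ltxx.
rewrite measure0 => /fine_cvg /= h.
have [N _ hN] : \forall n \near \oo, pr (A n) < e by apply: (cvgr_lt _ h).
exists N.+1%:R^-1; first by rewrite invr_gt0 ltr0n.
by apply: ltW; apply: (hN N) => /=.
Qed.

End bounded_expectation.

(** * Equal characteristic functions give equal quadrant probabilities *)

Section quadrant.
Context {R : realType}.

Lemma trigpoly_bmf d (T : measurableType d) (X : T -> R) (f : R -> R) :
  measurable_fun setT X -> trigpoly f -> bmf (f \o X).
Proof.
move=> mX [s fs].
rewrite (_ : f \o X = fun x => \sum_(t <- s) t.1.1 * cos (t.1.2 * X x + t.2)); last first.
  by apply/funext => x /=; rewrite fs.
apply: bmf_sum => t; apply: bmfZ; apply: bmf_cos.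
by apply: measurable_funD => //; apply: measurable_funM.
Qed.

Lemma pr_Rint d (T : measurableType d) (P : probability T R) (A : set T) :
  measurable A -> pr P A = \int[P]_x \1_A x.
Proof. by move=> mA; rewrite Rint_indic. Qed.

Section comparison.
Context d1 (T1 : measurableType d1) (P1 : probability T1 R)
        d2 (T2 : measurableType d2) (P2 : probability T2 R).
Variables (X1 Y1 : T1 -> R) (X2 Y2 : T2 -> R).
Hypotheses (mX1 : measurable_fun setT X1) (mY1 : measurable_fun setT Y1).
Hypotheses (mX2 : measurable_fun setT X2) (mY2 : measurable_fun setT Y2).
Hypothesis same_charfun : forall a b th : R,
  \int[P1]_x cos (a * X1 x + b * Y1 x + th) = \int[P2]_x cos (a * X2 x + b * Y2 x + th).

(** A product of cosines in X and in Y is half a sum of cosines of linear combinations of X and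
    Y. *)
Let same_trigpoly (f g : R -> R) : trigpoly f -> trigpoly g ->
  \int[P1]_x (f (X1 x) * g (Y1 x)) = \int[P2]_x (f (X2 x) * g (Y2 x)).
Proof.
move=> [s fs] [u gu].
pose F (X Y : R) := \sum_(t <- s) \sum_(v <- u) (t.1.1 * v.1.1 / 2) *
  (cos (t.1.2 * X + v.1.2 * Y + (t.2 + v.2)) + cos (t.1.2 * X + (- v.1.2) * Y + (t.2 - v.2))).
have FE X Y : f X * g Y = F X Y.
  rewrite fs gu mulr_suml; apply: eq_bigr => t _; rewrite mulr_sumr; apply: eq_bigr => v _.
  have -> : t.1.2 * X + v.1.2 * Y + (t.2 + v.2) = (t.1.2 * X + t.2) + (v.1.2 * Y + v.2) by ring.
  have -> : t.1.2 * X + - v.1.2 * Y + (t.2 - v.2) = (t.1.2 * X + t.2) - (v.1.2 * Y + v.2) by ring.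
  move: (t.1.2 * X + t.2) (v.1.2 * Y + v.2) => A B.
  by rewrite cosD cosB; field.
have key d (T : measurableType d) (P : probability T R) (X Y : T -> R) :
  measurable_fun setT X -> measurable_fun setT Y ->
  \int[P]_x (f (X x) * g (Y x)) = \sum_(t <- s) \sum_(v <- u) (t.1.1 * v.1.1 / 2) *
  (\int[P]_x cos (t.1.2 * X x + v.1.2 * Y x + (t.2 + v.2)) +
   \int[P]_x cos (t.1.2 * X x + (- v.1.2) * Y x + (t.2 - v.2))).
  move=> mX mY.
  have bc a b c : bmf (fun x => cos (a * X x + b * Y x + c)).
    by apply: bmf_cos; apply: measurable_funD => //; apply: measurable_funD; apply: measurable_funM.
  under eq_Rintegral do rewrite FE /F.
  rewrite Rint_sum; last by move=> t; apply: bmf_sum => v; apply: bmfZ; apply: bmfD.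
  apply: eq_bigr => t _; rewrite Rint_sum; last by move=> v; apply: bmfZ; apply: bmfD.
  by apply: eq_bigr => v _; rewrite RintZ ?RintD//; apply: bmfD.
rewrite !key//; apply: eq_bigr => t _; apply: eq_bigr => v _.
by rewrite !same_charfun.
Qed.

Let Q1 x y := [set w | x <= X1 w /\ y <= Y1 w].
Let Q2 x y := [set w | x <= X2 w /\ y <= Y2 w].

Lemma measurable_quadrant d (T : measurableType d) (X Y : T -> R) (x y : R) :
  measurable_fun setT X -> measurable_fun setT Y -> measurable [set w | x <= X w /\ y <= Y w].
Proof.
move=> mX mY.
have -> : [set w | x <= X w /\ y <= Y w] = X @^-1` `[x, +oo[ `&` Y @^-1` `[y, +oo[.
  by apply/seteqP; split => w /=; rewrite !in_itv/= !andbT.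
apply: measurableI; rewrite -[X in measurable X]setTI; [exact: mX|exact: mY].
Qed.

(** Both quadrants are compared with the product of two trigonometric steps, whose expectations
    agree. The steps rise just left of x and y, where the second pair has little mass. One
    inequality suffices, as the hypotheses are symmetric. *)
Lemma quadrant_le x y : pr P1 (Q1 x y) <= pr P2 (Q2 x y).
Proof.
apply/ler_addgt0Pr => e e0.
(* The errors add up to 9 e': four in [h1] and five in [h2]. *)
pose e' := e / 10.
have e'0 : 0 < e' by rewrite divr_gt0.
have [M1 _ hM1] := pr_abs_gt_small P1 mX1 e'0.
have [M2 _ hM2] := pr_abs_gt_small P1 mY1 e'0.
have [M3 _ hM3] := pr_abs_gt_small P2 mX2 e'0.
have [M4 _ hM4] := pr_abs_gt_small P2 mY2 e'0.
have [eta1 eta10 heta1] := pr_left_nbhs_small P2 x mX2 e'0.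
have [eta2 eta20 heta2] := pr_left_nbhs_small P2 y mY2 e'0.
pose M := Num.max (Num.max M1 M2) (Num.max M3 M4).
have [p [pT p01 pl pr_]] := trigpoly_step (x - eta1) M eta10 e'0.
have [p' [p'T p'01 p'l p'r]] := trigpoly_step (y - eta2) M eta20 e'0.
pose q z := 1 - p z; pose q' z := 1 - p' z.
have qT : trigpoly q.
  rewrite /q (_ : (fun _ => _) = fun z => 1 + (-1) * p z); last by apply/funext => z; ring.
  by apply: trigpolyD; [exact: trigpoly_cst|apply: trigpolyM => //; exact: trigpoly_cst].
have q'T : trigpoly q'.
  rewrite /q' (_ : (fun _ => _) = fun z => 1 + (-1) * p' z); last by apply/funext => z; ring.
  by apply: trigpolyD; [exact: trigpoly_cst|apply: trigpolyM => //; exact: trigpoly_cst].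
have mabs d (T : measurableType d) (X : T -> R) M' : measurable_fun setT X ->
    measurable [set w | M' < `|X w|].
  move=> mX; have -> : [set w | M' < `|X w|] = (fun w => `|X w|) @^-1` `]M', +oo[%classic.
    by apply/seteqP; split => w /=; rewrite in_itv/= andbT.
  rewrite -[X in measurable X]setTI.
  by apply: (measurableT_comp (f := fun z : R => `|z|)).
have mN d (T : measurableType d) (X : T -> R) u v : measurable_fun setT X ->
    measurable [set w | u < X w < v].
  move=> mX; have -> : [set w | u < X w < v] = X @^-1` `]u, v[%classic.
    by apply/seteqP; split => w /=; rewrite in_itv/=.
  by rewrite -[X in measurable X]setTI; exact: mX.
have tail d (T : measurableType d) (P : probability T R) (X : T -> R) M' :
    measurable_fun setT X -> M' <= M -> measurable [set w | M' < `|X w|] ->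
    pr P [set w | M' < `|X w|] <= e' -> pr P [set w | M < `|X w|] <= e'.
  move=> mX MM mM; apply: le_trans; apply: le_pr => //; first exact: mabs.
  by move=> w /=; exact: le_lt_trans.
have t1 : pr P1 [set w | M < `|X1 w|] <= e'.
  by apply: tail hM1 => //; [rewrite !le_max lexx|exact: mabs].
have t2 : pr P1 [set w | M < `|Y1 w|] <= e'.
  by apply: tail hM2 => //; [rewrite !le_max lexx orbT|exact: mabs].
have t3 : pr P2 [set w | M < `|X2 w|] <= e'.
  by apply: tail hM3 => //; [rewrite !le_max lexx orbT|exact: mabs].
have t4 : pr P2 [set w | M < `|Y2 w|] <= e'.
  by apply: tail hM4 => //; [rewrite !le_max lexx !orbT|exact: mabs].
have bqq d (T : measurableType d) (X Y : T -> R) : measurable_fun setT X ->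
    measurable_fun setT Y -> bmf (fun w => q (X w) * q' (Y w)).
  by move=> mX mY; apply: bmfM; apply: (trigpoly_bmf (f := fun=> _)).
have h1 : pr P1 (Q1 x y) <= \int[P1]_w (q (X1 w) * q' (Y1 w)) + 2 * e' + e' + e'.
  apply: (@le_trans _ _ (\int[P1]_w (q (X1 w) * q' (Y1 w)) + (2 * e' +
     (pr P1 [set w | M < `|X1 w|] + pr P1 [set w | M < `|Y1 w|])))); last by lra.
  have mQ := measurable_quadrant x y mX1 mY1.
  have m1 := mabs _ _ _ M mX1; have m2 := mabs _ _ _ M mY1.
  have b1 := bmf_indic (R := R) m1; have b2 := bmf_indic (R := R) m2.
  have b12 := bmfD b1 b2; have bc := @bmf_cst _ T1 R (2 * e'); have bc12 := bmfD bc b12.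
  have bq := bqq _ _ _ _ mX1 mY1.
  rewrite !pr_Rint// -[2 * e'](Rint_cst P1) -!RintD//.
    apply: le_Rint; [exact: bmf_indic|exact: bmfD|].
    move=> w; rewrite !indicE.
    have /andP[q0 q1] := p01 (X1 w); have /andP[q'0 q'1] := p'01 (Y1 w).
    have bnd (b : bool) : 0 <= (b%:R : R) <= 1 by case: b => /=; lra.
    have := bnd (w \in [set w | M < `|X1 w|]); have := bnd (w \in [set w | M < `|Y1 w|]).
    have qq0 : 0 <= q (X1 w) * q' (Y1 w) by rewrite mulr_ge0 ?subr_ge0.
    case: (boolP (w \in Q1 x y)) => [|_]; last first.
      by rewrite /=; lra.
    rewrite inE => -[/= xX yY].
    case: (boolP (w \in [set w | M < `|X1 w|])) => [_|].
      by rewrite /=; lra.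
    rewrite notin_setE /= => /negP; rewrite -leNgt => XM.
    case: (boolP (w \in [set w | M < `|Y1 w|])) => [_|].
      by rewrite /=; lra.
    rewrite notin_setE /= => /negP; rewrite -leNgt => YM.
    move=> _ _; have := pr_ (X1 w) XM; have := p'r (Y1 w) YM; rewrite !subrK => /(_ yY) h2 /(_ xX) h3.
    rewrite /q /q' /=; nra.
have h2 : \int[P2]_w (q (X2 w) * q' (Y2 w)) <= pr P2 (Q2 x y) + e' + e' + e' + e' + e'.
  apply: (@le_trans _ _ (pr P2 (Q2 x y) + (e' +
     ((pr P2 [set w | M < `|X2 w|] + pr P2 [set w | M < `|Y2 w|]) +
     (pr P2 [set w | x - eta1 < X2 w < x] + pr P2 [set w | y - eta2 < Y2 w < y]))))); last by lra.
  have mQ := measurable_quadrant x y mX2 mY2.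
  have m1 := mabs _ _ _ M mX2; have m2 := mabs _ _ _ M mY2.
  have m3 := mN _ _ _ (x - eta1) x mX2; have m4 := mN _ _ _ (y - eta2) y mY2.
  have b0 := bmf_indic (R := R) mQ; have bc := @bmf_cst _ T2 R e'.
  have b1 := bmf_indic (R := R) m1; have b2 := bmf_indic (R := R) m2.
  have b3 := bmf_indic (R := R) m3; have b4 := bmf_indic (R := R) m4.
  have b12 := bmfD b1 b2; have b34 := bmfD b3 b4; have b1234 := bmfD b12 b34.
  have bc1234 := bmfD bc b1234.
  rewrite !pr_Rint// -[e' in leRHS](Rint_cst P2) -!RintD//.
  apply: le_Rint; [exact: bqq|exact: bmfD|].
  move=> w; rewrite !indicE.
  have /andP[q0 q1] := p01 (X2 w); have /andP[q'0 q'1] := p'01 (Y2 w).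
  have qq1 : q (X2 w) * q' (Y2 w) <= 1 by rewrite /q /q' mulr_ile1//; lra.
  have bnd (b : bool) : 0 <= (b%:R : R) <= 1 by case: b => /=; lra.
  have := bnd (w \in [set w | M < `|X2 w|]); have := bnd (w \in [set w | M < `|Y2 w|]).
  have := bnd (w \in [set w | x - eta1 < X2 w < x]); have := bnd (w \in [set w | y - eta2 < Y2 w < y]).
  case: (boolP (w \in Q2 x y)) => [_|]; first by rewrite /=; lra.
  rewrite notin_setE /= => nQ.
  case: (boolP (w \in [set w | M < `|X2 w|])) => [_|]; first by rewrite /=; lra.
  rewrite notin_setE /= => /negP; rewrite -leNgt => XM.
  case: (boolP (w \in [set w | M < `|Y2 w|])) => [_|]; first by rewrite /=; lra.
  rewrite notin_setE /= => /negP; rewrite -leNgt => YM.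
  case: (boolP (w \in [set w | x - eta1 < X2 w < x])) => [_|]; first by rewrite /=; lra.
  rewrite notin_setE /= => /negP nN1.
  case: (boolP (w \in [set w | y - eta2 < Y2 w < y])) => [_|]; first by rewrite /=; lra.
  rewrite notin_setE /= => /negP nN2 _ _ _ _.
  have [xX|Xx] := leP x (X2 w).
    have Yy : Y2 w < y by rewrite ltNge; apply/negP => yY; apply: nQ.
    move: nN2; rewrite Yy andbT -leNgt => /(p'l _ YM) hp'.
    by rewrite /q /q' /=; nra.
  move: nN1; rewrite Xx andbT -leNgt => /(pl _ XM) hp.
  by rewrite /q /q' /=; nra.
have := same_trigpoly qT q'T.
by rewrite /e' in h1 h2 *; lra.
Qed.
End comparison.
End quadrant.

Lemma quadrant_eq {R : realType} d1 (T1 : measurableType d1) (P1 : probability T1 R)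
    d2 (T2 : measurableType d2) (P2 : probability T2 R)
    (X1 Y1 : T1 -> R) (X2 Y2 : T2 -> R) (x y : R) :
  measurable_fun setT X1 -> measurable_fun setT Y1 ->
  measurable_fun setT X2 -> measurable_fun setT Y2 ->
  (forall a b th : R, \int[P1]_w cos (a * X1 w + b * Y1 w + th) =
                      \int[P2]_w cos (a * X2 w + b * Y2 w + th)) ->
  pr P1 [set w | x <= X1 w /\ y <= Y1 w] = pr P2 [set w | x <= X2 w /\ y <= Y2 w].
Proof.
move=> mX1 mY1 mX2 mY2 h; apply/le_anti/andP; split; first exact: quadrant_le.
by apply: quadrant_le => // a b th; rewrite h.
Qed.

Lemma half_line_eq {R : realType} d1 (T1 : measurableType d1) (P1 : probability T1 R)
    d2 (T2 : measurableType d2) (P2 : probability T2 R)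
    (X1 : T1 -> R) (X2 : T2 -> R) (x : R) :
  measurable_fun setT X1 -> measurable_fun setT X2 ->
  (forall a th : R, \int[P1]_w cos (a * X1 w + th) = \int[P2]_w cos (a * X2 w + th)) ->
  pr P1 [set w | x <= X1 w] = pr P2 [set w | x <= X2 w].
Proof.
move=> mX1 mX2 h.
have aux T (X : T -> R) : [set w | x <= X w] = [set w | x <= X w /\ 0 <= (cst 0 : T -> R) w].
  by apply/seteqP; split => w /=; [|case].
rewrite !aux; apply: quadrant_eq => // a b th.
under eq_Rintegral do rewrite /= mulr0 addr0.
by rewrite h; apply: eq_Rintegral => w _; rewrite /= mulr0 addr0.
Qed.

(** * From convergence of characteristic functions to distribution functions *)

Section weak_convergence.
Context {R : realType}.
Variables (T : nat -> finType) (mu : forall m, T m -> R) (W : forall m, T m -> R).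
Hypothesis mu_ge0 : forall m (x : T m), 0 <= mu x.
Hypothesis mu_sum : forall m, \sum_(x : T m) mu x = 1.
Variable V : R.
Hypothesis W2 : \forall m \near \oo, Ex (@mu m) (fun x => W x ^+ 2) <= V.
Context d (T' : measurableType d) (Q : probability T' R) (Z : T' -> R).
Hypothesis mZ : measurable_fun setT Z.
Hypothesis charfun_cvg : forall lam th : R,
  Ex (@mu m) (fun x => cos (lam * W x + th)) @[m --> \oo] --> \int[Q]_w cos (lam * Z w + th).

Let trigpoly_cvg (p : R -> R) : trigpoly p ->
  Ex (@mu m) (fun x => p (W x)) @[m --> \oo] --> \int[Q]_w p (Z w).
Proof.
move=> [s ps].
have -> : \int[Q]_w p (Z w) = \sum_(t <- s) t.1.1 * \int[Q]_w cos (t.1.2 * Z w + t.2).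
  under eq_Rintegral do rewrite ps.
  have bc a b : bmf (fun x => cos (a * Z x + b)).
    by apply: bmf_cos; apply: measurable_funD => //; apply: measurable_funM.
  rewrite Rint_sum; last by move=> t; exact: bmfZ.
  by apply: eq_bigr => t _; rewrite RintZ.
have -> : (fun m => Ex (@mu m) (fun x => p (W x))) =
  (fun m => \sum_(t <- s) t.1.1 * Ex (@mu m) (fun x => cos (t.1.2 * W x + t.2))).
  apply/funext => m.
  under [RHS]eq_bigr do rewrite -ExZ.
  under eq_Ex do rewrite ps.
  rewrite /Ex exchange_big; apply: eq_bigr => x _ /=.
  by rewrite mulr_sumr.
elim: s {ps} => [|t s IH].
  by under eq_fun do rewrite big_nil; rewrite big_nil; exact: cvg_cst.
under eq_fun do rewrite big_cons.
rewrite big_cons; apply: cvgD => //.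
by apply: cvgMr.
Qed.

(** A trigonometric step falling between y and y' is sandwiched by the two half-line indicators.
    With two thresholds the limit law may have atoms; its continuity is used only at the very
    end. *)
Lemma cdf_cvg (y y' e : R) : y < y' -> 0 < e ->
  (\forall m \near \oo, Ex (@mu m) (fun x => (W x <= y)%R%:R) <= pr Q [set w | Z w <= y'] + e) /\
  (\forall m \near \oo, pr Q [set w | Z w <= y] - e <= Ex (@mu m) (fun x => (W x <= y')%R%:R)).
Proof.
move=> yy' e0.
pose e' := e / 10.
have e'0 : 0 < e' by rewrite divr_gt0.
have [M1 _ hM1] := pr_abs_gt_small Q mZ e'0.
(* This makes |V| <= e' M^2, so Chebyshev's inequality bounds the tails of all W with large m by
   e'. *)
pose M := Num.max M1 (1 + `|V| / e').
have eta0 : 0 < y' - y by rewrite subr_gt0.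
have [p [pT p01 pl pr_]] := trigpoly_step y M eta0 e'0.
have mabs M' : measurable [set w | M' < `|Z w|].
  have -> : [set w | M' < `|Z w|] = (fun w => `|Z w|) @^-1` `]M', +oo[%classic.
    by apply/seteqP; split => w /=; rewrite in_itv/= andbT.
  rewrite -[X in measurable X]setTI.
  by apply: (measurableT_comp (f := fun z : R => `|z|)).
have mle y1 : measurable [set w | Z w <= y1].
  have -> : [set w | Z w <= y1] = Z @^-1` `]-oo, y1]%classic.
    by apply/seteqP; split => w /=; rewrite in_itv/=.
  by rewrite -[X in measurable X]setTI; exact: mZ.
have tZ : pr Q [set w | M < `|Z w|] <= e'.
  apply: le_trans hM1; apply: le_pr => //.
  by move=> w /=; apply: le_lt_trans; rewrite le_max lexx.
have tW : \forall m \near \oo, Ex (@mu m) (fun x => (M < `|W x|)%R%:R) <= e'.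
  near=> m.
  have M2 : `|V| <= e' * M ^+ 2.
    have h1 : 1 + `|V| / e' <= M by rewrite le_max lexx orbT.
    have h2 : 0 <= `|V| / e' by rewrite divr_ge0// ltW.
    rewrite mulrC -ler_pdivrMr// (le_trans (_ : _ <= M))//; first by lra.
    by rewrite expr2 ler_peMl; lra.
  have M0 : 0 < M by rewrite lt_max; apply/orP; right; rewrite ltr_pwDl// divr_ge0// ltW.
  rewrite -(ler_pM2l (exprn_gt0 2 M0)) -ExZ.
  apply: (@le_trans _ _ (Ex (@mu m) (fun x => W x ^+ 2))).
    apply: le_Ex => // x; case: ltP => h; last by rewrite mulr0 sqr_ge0.
    rewrite mulr1 -[leRHS]real_normK ?num_real// lerXn2r ?nnegrE ?(ltW M0)//.
    exact: ltW.
  rewrite [leRHS]mulrC (le_trans _ M2)// (le_trans _ (ler_norm V))//.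
  by near: m; exact: W2.
have bi A : measurable A -> bmf (\1_A : T' -> R) by exact: bmf_indic.
have bp : bmf (fun w => p (Z w)) by apply: (trigpoly_bmf (f := p)).
have bc c : bmf (fun _ : T' => c : R) by exact: bmf_cst.
have := trigpoly_cvg pT.
set I := \int[Q]_w p (Z w) => hcvg.
have hI1 : I <= pr Q [set w | Z w <= y'] + 2 * e'.
  apply: (@le_trans _ _ (pr Q [set w | Z w <= y'] + (e' + pr Q [set w | M < `|Z w|]))); last by lra.
  have b1 := bi _ (mle y'); have b2 := bi _ (mabs M); have b3 := bmfD (bc e') b2.
  rewrite !pr_Rint// -[e' in leRHS](Rint_cst Q) -!RintD//.
  apply: le_Rint => //; first exact: bmfD.
  move=> w; rewrite !indicE; have /andP[p0 p1] := p01 (Z w).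
  have bnd (b : bool) : 0 <= (b%:R : R) <= 1 by case: b => /=; lra.
  have := bnd (w \in [set w | M < `|Z w|]).
  case: (boolP (w \in [set w | Z w <= y'])) => [_|]; first by rewrite /=; lra.
  rewrite notin_setE /= => /negP; rewrite -ltNge => yZ.
  case: (boolP (w \in [set w | M < `|Z w|])) => [_|]; first by rewrite /=; lra.
  rewrite notin_setE /= => /negP; rewrite -leNgt => ZM _.
  by have := pr_ (Z w) ZM; rewrite subrKC (ltW yZ) => /(_ isT); lra.
have hI2 : pr Q [set w | Z w <= y] <= I + 2 * e'.
  apply: (@le_trans _ _ (I + (e' + pr Q [set w | M < `|Z w|]))); last by lra.
  have b1 := bi _ (mle y); have b2 := bi _ (mabs M); have b3 := bmfD (bc e') b2.
  rewrite !pr_Rint// -[e' in leRHS](Rint_cst Q) -!RintD//.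
  apply: le_Rint => //; first exact: bmfD.
  move=> w; rewrite !indicE; have /andP[p0 p1] := p01 (Z w).
  have bnd (b : bool) : 0 <= (b%:R : R) <= 1 by case: b => /=; lra.
  have := bnd (w \in [set w | M < `|Z w|]).
  case: (boolP (w \in [set w | Z w <= y])) => [|_]; last by rewrite /=; lra.
  rewrite inE /= => Zy.
  case: (boolP (w \in [set w | M < `|Z w|])) => [_|]; first by rewrite /=; lra.
  rewrite notin_setE /= => /negP; rewrite -leNgt => ZM _.
  by have := pl (Z w) ZM Zy; lra.
have hdist : \forall m \near \oo, `|I - Ex (@mu m) (fun x => p (W x))| < e'.
  by move/cvgrPdist_lt : hcvg => /(_ e' e'0).
have hE1 m : Ex (@mu m) (fun x => (W x <= y)%R%:R) <=
  Ex (@mu m) (fun x => p (W x)) + (e' + Ex (@mu m) (fun x => (M < `|W x|)%R%:R)).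
  rewrite -[e'](Ex_cst (mu_sum m)) -!ExD; apply: le_Ex => // x.
  have /andP[p0 p1] := p01 (W x).
  case: (leP (W x) y) => Wy; last by case: (ltP M `|W x|) => /=; lra.
  case: (ltP M `|W x|) => /= WM; first by lra.
  by have := pl (W x) WM Wy; lra.
have hE2 m : Ex (@mu m) (fun x => p (W x)) <=
  Ex (@mu m) (fun x => (W x <= y')%R%:R) + (e' + Ex (@mu m) (fun x => (M < `|W x|)%R%:R)).
  rewrite -[e' in leRHS](Ex_cst (mu_sum m)) -!ExD; apply: le_Ex => // x.
  have /andP[p0 p1] := p01 (W x).
  case: (leP (W x) y') => Wy; first by case: (ltP M `|W x|) => /=; lra.
  case: (ltP M `|W x|) => /= WM; first by lra.
  by have := pr_ (W x) WM; rewrite subrKC (ltW Wy) => /(_ isT); lra.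
split; near=> m.
  have t : Ex (@mu m) (fun x => (M < `|W x|)%R%:R) <= e' by near: m.
  have : `|I - Ex (@mu m) (fun x => p (W x))| < e' by near: m.
  rewrite ltr_norml; have := hE1 m; rewrite /e' in t hI1 *; lra.
have t : Ex (@mu m) (fun x => (M < `|W x|)%R%:R) <= e' by near: m.
have : `|I - Ex (@mu m) (fun x => p (W x))| < e' by near: m.
rewrite ltr_norml; have := hE2 m; rewrite /e' in t hI2 *; lra.
Unshelve. all: end_near.
Qed.

End weak_convergence.

(** * Centered normal laws, including the point mass *)

Section normal_law_facts.
Context {R : realType}.

Lemma measurable_affine (a th : R) : measurable_fun setT (fun x : measurableTypeR R => a * x + th).
Proof. by apply: measurable_funD => //; apply: measurable_funM. Qed.

(** The same formula for the characteristic function covers the point mass, so that later arguments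
    need not separate v = 0. *)
Lemma normal_law_probability (v : R) : 0 <= v ->
  exists Q : probability (measurableTypeR R) R,
    (forall A, Q A = normal_law 0 v A) /\
    forall lam th, \int[Q]_x cos (lam * x + th) = expR (- (v * lam ^+ 2 / 2)) * cos th.
Proof.
rewrite /normal_law le_eqVlt => /predU1P[<-|v0].
  exists (\d_(0 : measurableTypeR R) : probability (measurableTypeR R) R); split.
    by rewrite eqxx.
  move=> lam th; rewrite /Rintegral integral_dirac//=; last first.
    apply/measurable_EFinP; apply: (bmf_cos (measurable_affine lam th)).1.
  by rewrite indicE in_setT mul1r mulr0 add0r !mul0r oppr0 expR0 mul1r.
exists (normal_prob 0 (Num.sqrt v)); split; first by rewrite gt_eqF.
move=> lam th; rewrite normal_prob_charfun ?sqrtr_gt0// sqr_sqrtr//.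
exact: ltW.
Qed.

Lemma Rint_distribution d (T : measurableType d) (P : probability T R) (Y : {RV P >-> R}) (f : R -> R) :
  bmf f -> \int[P]_w f (Y w) = \int[distribution P Y]_x f x.
Proof.
move=> bf; have [mf [M fM]] := bf.
have bfY : bmf (f \o Y).
  split; first exact: measurableT_comp.
  by exists M => x; exact: fM.
rewrite /Rintegral integral_distribution//.
- exact/measurable_EFinP.
- exact: bmf_integrable.
Qed.

(* [R] and [measurableTypeR R] have the same measurable sets but different
   displays, hence the second sample space. *)
Lemma Rint_same_law d (T : measurableType d) (P : probability T R)
    d' (T' : measurableType d') (Q : probability T' R) (Y : T -> R) (Z : T' -> R) (f : R -> R) :
  measurable_fun setT Y -> measurable_fun setT Z ->
  (forall A, measurable A -> P (Y @^-1` A) = Q (Z @^-1` A)) ->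
  bmf f -> \int[P]_w f (Y w) = \int[Q]_x f (Z x).
Proof.
move=> mY mZ PQ bf.
pose Y' : {RV P >-> R} := mfun_Sub (mem_set mY : Y \in mfun).
pose Z' : {RV Q >-> R} := mfun_Sub (mem_set mZ : Z \in mfun).
rewrite (@Rint_distribution _ _ P Y')// (@Rint_distribution _ _ Q Z')//.
by congr fine; apply: eq_measure_integral => A mA _; exact: PQ.
Qed.

Lemma measurable_idR : measurable_fun setT (idfun : measurableTypeR R -> R).
Proof. by move=> _ A mA; rewrite setTI. Qed.

Lemma Rint_normal_law d (T : measurableType d) (P : probability T R) (Y : T -> R) (v lam th : R) :
  measurable_fun setT Y -> 0 <= v ->
  (forall A, measurable A -> P (Y @^-1` A) = normal_law 0 v A) ->
  \int[P]_w cos (lam * Y w + th) = expR (- (v * lam ^+ 2 / 2)) * cos th.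
Proof.
move=> mY v0 PY; have [Q [QE Qc]] := normal_law_probability v0.
rewrite -Qc.
apply: (@Rint_same_law _ _ P _ _ Q Y (idfun : measurableTypeR R -> R) (fun x => cos (lam * x + th))) => //.
- exact: measurable_idR.
- by move=> A mA; rewrite [LHS](PY A mA) -QE.
- by apply: bmf_cos; apply: measurable_funD => //; apply: measurable_funM.
Qed.

End normal_law_facts.

(** * The standard normal tail function *)

Section barPhi_facts.
Context {R : realType}.
Local Notation N := (normal_prob 0 1 : probability (measurableTypeR R) R).
Implicit Types x y t : R.

Lemma PhiE x : Phi x = pr N `]-oo, x]%classic. Proof. by []. Qed.

Lemma barPhiB x y : x <= y -> barPhi x - barPhi y = pr N `]x, y]%classic.
Proof.
move=> xy; rewrite /barPhi !PhiE.
have -> : `]-oo, y]%classic = `]-oo, x]%classic `|` `]x, y]%classic :> set R.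
  by rewrite -itv_bndbnd_setU// bnd_simp.
rewrite (@pr_setU _ _ _ N); [by ring|exact: measurable_itv|exact: measurable_itv|].
apply/seteqP; split => // z [/=]; rewrite !in_itv/= => zx /andP[xz _].
by move: (lt_le_trans xz zx); rewrite ltxx.
Qed.

(** On the interval the density lies between its value at |x| + |y| and its peak. The upper bound
    makes [barPhi] Lipschitz, the lower one makes it strictly decreasing. *)
Let normal_prob_itv x y (A := `]x, y]%classic : set R) : x <= y ->
  (normal_prob 0 1 A <= (normal_peak 1 * (y - x))%:E)%E /\
  ((normal_pdf 0 1 (`|x| + `|y|) * (y - x))%:E <= normal_prob 0 1 A)%E.
Proof.
move=> xy; have mA : measurable A by exact: measurable_itv.
have lA : (lebesgue_measure A = (y - x)%:E)%E.
  rewrite lebesgue_measure_itv/= lte_fin; case: ltP => // yx.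
  by rewrite (le_anti (x := x) (y := y)) ?subrr// xy yx.
have mp : measurable_fun A (fun z => (normal_pdf 0 (1 : R) z)%:E).
  by apply/measurable_EFinP/measurable_funTS; exact: measurable_normal_pdf.
split.
  rewrite EFinM -lA -(integral_cst lebesgue_measure mA); apply: ge0_le_integral => //.
  - by move=> z _; rewrite lee_fin normal_pdf_ge0.
  - by move=> z _; rewrite lee_fin normal_pdf_ub// oner_neq0.
rewrite EFinM -lA -(integral_cst lebesgue_measure mA); apply: ge0_le_integral => //.
- by move=> z _; rewrite lee_fin normal_pdf_ge0.
- move=> z; rewrite /A /= in_itv/= => /andP[xz zy].
  rewrite lee_fin !normal_pdf0E// ler_wpM2l ?normal_peak_ge0// ler_expR.
  rewrite ler_wpM2r ?invr_ge0 ?mulr_ge0 ?sqr_ge0// lerN2 -real_normK ?num_real//.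
  rewrite lerXn2r ?nnegrE ?addr_ge0// ler_norml.
  have := ler_norm y; have := ler_norm (- x); rewrite normrN.
  have := normr_ge0 x; have := normr_ge0 y; lra.
Qed.

Lemma barPhi_lip x y : `|barPhi x - barPhi y| <= normal_peak 1 * `|x - y|.
Proof.
wlog xy : x y / x <= y.
  move=> H; case: (leP x y) => [/H//|/ltW/H].
  by rewrite distrC (distrC y).
rewrite barPhiB// ger0_norm ?pr_ge0// distrC ger0_norm ?subr_ge0//.
by have [h _] := normal_prob_itv xy; rewrite -lee_fin -prE.
Qed.

Lemma barPhi_lt x y : x < y -> barPhi y < barPhi x.
Proof.
move=> xy; rewrite -subr_gt0 barPhiB ?ltW//.
have [_ h] := normal_prob_itv (ltW xy).
rewrite -lte_fin -prE//; apply: lt_le_trans h.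
rewrite lte_fin mulr_gt0 ?subr_gt0// normal_pdf0E// mulr_gt0 ?expR_gt0//.
by rewrite normal_peak_gt0// oner_neq0.
Qed.

Lemma barPhi_le x y : (barPhi y <= barPhi x) = (x <= y).
Proof.
apply/idP/idP => [|xy]; last by move: xy; rewrite le_eqVlt => /predU1P[->//|/barPhi_lt/ltW].
by apply: contraTT; rewrite -!ltNge; exact: barPhi_lt.
Qed.

Lemma barPhi_continuous : continuous (barPhi : R -> R).
Proof.
move=> x; apply/cvgrPdist_le => e e0.
have p0 : 0 < normal_peak (1 : R) by rewrite normal_peak_gt0// oner_neq0.
near=> y; rewrite (le_trans (barPhi_lip _ _))// mulrC -ler_pdivlMr//.
near: y; move/cvgrPdist_le : (@cvg_id _ (nbhs x)); apply.
by rewrite divr_gt0.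
Unshelve. all: end_near.
Qed.

Let barPhi01 x : 0 <= barPhi x <= 1.
Proof.
rewrite /barPhi /Phi subr_ge0 lerBlDr lerDl fine_ge0// andbT.
exact: (@pr_le1 _ _ _ N).
Qed.

Lemma barPhi_gt0 x : 0 < barPhi x.
Proof.
have x1 : x < x + 1 by rewrite ltrDl.
apply: le_lt_trans (barPhi_lt x1).
by have /andP[] := barPhi01 (x + 1).
Qed.

Lemma barPhi_lt1 x : barPhi x < 1.
Proof.
have x1 : x - 1 < x by rewrite gtrBl.
apply: lt_le_trans (barPhi_lt x1) _.
by have /andP[] := barPhi01 (x - 1).
Qed.

Lemma barPhi_surj t : 0 < t < 1 -> exists x, barPhi x = t.
Proof.
move=> /andP[t0 t1].
have e0 : 0 < Num.min t (1 - t) by rewrite lt_min t0 subr_gt0.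
have [M M0 hM] := pr_abs_gt_small N measurable_idR e0.
have mM : measurable [set x : measurableTypeR R | M < `|x|].
  have -> : [set w : measurableTypeR R | M < `|w|] = (fun w => `|w|) @^-1` `]M, +oo[%classic.
    by apply/seteqP; split => w /=; rewrite in_itv/= andbT.
  rewrite -[X in measurable X]setTI.
  by apply: (measurableT_comp (f := fun z : R => `|z|) _ measurable_idR).
have h1 : barPhi M <= t.
  have -> : barPhi M = pr N `]M, +oo[%classic.
    rewrite /barPhi /Phi -[fine _]/(pr N `]-oo, M]%classic) -prC; last exact: measurable_itv.
    by rewrite setCitvl.
  apply: (@le_trans _ _ (Num.min t (1 - t))); last by rewrite ge_min lexx.
  apply: le_trans hM; apply: le_pr => // x /=; rewrite in_itv/= andbT => Mx.
  by rewrite (lt_le_trans Mx)// ler_norm.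
(* The shift by 1 turns x <= - M - 1 into the strict inequality M < |x|. *)
have h2 : t <= barPhi (- M - 1).
  rewrite /barPhi lerBrDr addrC -lerBrDr.
  apply: (@le_trans _ _ (Num.min t (1 - t))); last by rewrite ge_min lexx orbT.
  apply: le_trans hM; apply: (@le_pr _ _ _ N) => // x /=; rewrite in_itv/= => xM.
  by rewrite ltr_normr; apply/orP; right; lra.
have MM : - M - 1 <= M by lra.
have [||c _ hc] := IVT MM (f := barPhi) (v := t).
- by apply: continuous_subspaceT; exact: barPhi_continuous.
- by rewrite minC min_l ?(le_trans h1 h2)// maxC max_r ?(le_trans h1 h2)// h1 h2.
- by exists c.
Qed.

Lemma barPhi_inv_barPhi x : barPhi_inv (barPhi x) = x%:E.
Proof.
rewrite /barPhi_inv; apply/le_anti/andP; split.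
  by apply: ereal_inf_lbound; exists x => //=.
by apply: le_ereal_inf_tmp => _ [y /= yx <-]; rewrite lee_fin -barPhi_le.
Qed.

Lemma ebarPhi01 (x : \bar R) : 0 <= ebarPhi x <= 1.
Proof. by case: x => [x||] /=; rewrite ?barPhi01// ?lexx ler01. Qed.

Lemma barPhi_gtE x : barPhi x = pr N `]x, +oo[%classic.
Proof.
rewrite /barPhi PhiE -(prC N); last exact: measurable_itv.
by rewrite setCitvl.
Qed.

(** The half-line is closed here and open in [barPhi_gtE]; the Lipschitz bound excludes an atom at
    x. *)
Lemma barPhi_geE x : barPhi x = pr N [set z | x <= z].
Proof.
have p0 : 0 < normal_peak (1 : R) by rewrite normal_peak_gt0// oner_neq0.
have -> : [set z | x <= z] = `[x, +oo[%classic.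
  by apply/seteqP; split => z /=; rewrite in_itv/= andbT.
apply/le_anti/andP; split.
  rewrite barPhi_gtE; apply: (@le_pr _ _ _ N) => // z /=; rewrite !in_itv/= !andbT.
  exact: ltW.
apply/ler_addgt0Pr => e e0.
apply: (@le_trans _ _ (barPhi (x - e / normal_peak 1))).
  rewrite barPhi_gtE; apply: (@le_pr _ _ _ N) => // z /=; rewrite !in_itv/= !andbT.
  by apply: lt_le_trans; rewrite gtrBl divr_gt0.
rewrite -lerBlDl (le_trans (ler_norm _))// (le_trans (barPhi_lip _ _))//.
rewrite addrAC subrr sub0r normrN ger0_norm ?divr_ge0 ?(ltW e0) ?(ltW p0)//.
by rewrite mulrC divfK// gt_eqF.
Qed.

End barPhi_facts.

(** * Half-lines and quadrants of Gaussian vectors *)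

Section gaussian_vectors.
Context {R : realType}.
Local Notation N := (normal_prob 0 1 : probability (measurableTypeR R) R).

Lemma normal_law_ge d (T : measurableType d) (P : probability T R) (Y : T -> R) (v x : R) :
  measurable_fun setT Y -> 0 < v ->
  (forall A, measurable A -> P (Y @^-1` A) = normal_law 0 v A) ->
  pr P [set w | x <= Y w] = barPhi (x / Num.sqrt v).
Proof.
move=> mY v0 PY.
have s0 : 0 < Num.sqrt v by rewrite sqrtr_gt0.
have mZ : measurable_fun setT (fun z : measurableTypeR R => Num.sqrt v * idfun z).
  by apply: measurable_funM => //; exact: measurable_idR.
rewrite barPhi_geE (half_line_eq (P2 := N) x mY mZ).
  by congr pr; apply/seteqP; split => z /=; rewrite ler_pdivrMr// mulrC.
move=> a th; rewrite (Rint_normal_law _ _ mY (ltW v0) PY).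
under eq_Rintegral do rewrite mulrA.
rewrite normal_prob_charfun// exprMn sqr_sqrtr ?(ltW v0)// expr1n mul1r.
by rewrite [v * _]mulrC.
Qed.

(** Translates the limit of W_m(tau) at the threshold c y into the limit of the number of false
    rejections at y. *)
Lemma normal_law_scale (c v y : R) : 0 < c -> 0 <= v ->
  normal_law 0 (c ^- 2 * v) `]-oo, y]%classic = normal_law 0 v `]-oo, c * y]%classic.
Proof.
move=> c0 v0.
have cv0 : 0 <= c ^- 2 * v by rewrite mulr_ge0// invr_ge0 sqr_ge0.
have [Q1 [Q1E Q1c]] := normal_law_probability cv0.
have [Q2 [Q2E Q2c]] := normal_law_probability v0.
rewrite -Q1E -Q2E (prE Q1); last exact: measurable_itv.
rewrite (prE Q2); last exact: measurable_itv.
congr EFin.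
have m1 : measurable_fun setT (fun z : measurableTypeR R => - 1 * idfun z : R).
  by apply: measurable_funM => //; exact: measurable_idR.
have m2 : measurable_fun setT (fun z : measurableTypeR R => - c^-1 * idfun z : R).
  by apply: measurable_funM => //; exact: measurable_idR.
have := half_line_eq (P1 := Q1) (P2 := Q2) (- y) m1 m2.
have -> : [set w : measurableTypeR R | - y <= -1 * idfun w] = `]-oo, y]%classic.
  by apply/seteqP; split => z /=; rewrite in_itv/= mulN1r lerN2.
have -> : [set w : measurableTypeR R | - y <= - c^-1 * idfun w] = `]-oo, c * y]%classic.
  by apply/seteqP; split => z /=; rewrite in_itv/= mulNr lerN2 [c^-1 * _]mulrC ler_pdivrMr// [y * c]mulrC.
apply => a th.
under eq_Rintegral do rewrite mulrA.
under [RHS]eq_Rintegral do rewrite mulrA.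
rewrite Q1c Q2c; congr (expR _ * _).
by field; rewrite gt_eqF.
Qed.

Lemma product_charfun (a b th : R) :
  \int[(N \x N)%E]_u cos (a * u.1 + b * u.2 + th) = expR (- ((a ^+ 2 + b ^+ 2) / 2)) * cos th.
Proof.
have mfst : measurable_fun setT (fun u : measurableTypeR R * measurableTypeR R => u.1 : R).
  exact: (measurableT_comp measurable_idR measurable_fst).
have msnd : measurable_fun setT (fun u : measurableTypeR R * measurableTypeR R => u.2 : R).
  exact: (measurableT_comp measurable_idR measurable_snd).
have bf : bmf (fun u : measurableTypeR R * measurableTypeR R => cos (a * u.1 + b * u.2 + th) : R).
  by apply: bmf_cos; apply: measurable_funD => //; apply: measurable_funD; apply: measurable_funM.
rewrite /Rintegral -integral12_prod_meas1/=; last exact: (bmf_integrable (N \x N)%E bf).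
have h x : (\int[N]_y (cos (a * x + b * y + th))%:E)%E =
   (expR (- (b ^+ 2 / 2)) * cos (a * x + th))%:E.
  have bx : bmf (fun y : measurableTypeR R => cos (b * y + (a * x + th)) : R).
    apply: bmf_cos; apply: measurable_funD => //; apply: measurable_funM => //.
  have := @normal_prob_charfun R 1 ltr01 (a * x + th) b.
  rewrite expr1n mul1r => <-; rewrite /Rintegral fineK.
    by apply: eq_integral => y _; congr (cos _)%:E; ring.
  by apply: integrable_fin_num => //; exact: (bmf_integrable N bx).
transitivity (\int[N]_x (expR (- (b ^+ 2 / 2)) * cos (a * x + th))).
  by congr fine; apply: eq_integral => x _; exact: h.
have ba : bmf (fun y : measurableTypeR R => cos (a * y + th) : R).
  by apply: bmf_cos; apply: measurable_funD => //; apply: measurable_funM.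
rewrite RintZ//.
rewrite normal_prob_charfun// mulrA -expRD; congr (expR _ * _).
by field.
Qed.

(** The normalized pair and the realization on R * R behind [rho_tilde] have the same characteristic
    function, since the laws of all linear combinations are prescribed. *)
Lemma bivariate_normal_quadrant d (T : measurableType d) (P : probability T R)
    (X Y : T -> R) (v1 v2 cxy x y : R) (rho := cxy / Num.sqrt (v1 * v2)) :
  measurable_fun setT X -> measurable_fun setT Y -> 0 < v1 -> 0 < v2 ->
  (forall a b, 0 <= a ^+ 2 * v1 + 2 * (a * b * cxy) + b ^+ 2 * v2) ->
  (forall a b A, measurable A -> P [set w | A (a * X w + b * Y w)] =
     normal_law 0 (a ^+ 2 * v1 + 2 * (a * b * cxy) + b ^+ 2 * v2) A) ->
  pr P [set w | x * Num.sqrt v1 <= X w /\ y * Num.sqrt v2 <= Y w] =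
  rho_tilde (barPhi x) (barPhi y) rho + barPhi x * barPhi y.
Proof.
move=> mX mY v10 v20 pos law.
have s1 : 0 < Num.sqrt v1 by rewrite sqrtr_gt0.
have s2 : 0 < Num.sqrt v2 by rewrite sqrtr_gt0.
have e1 : Num.sqrt v1 ^+ 2 = v1 by rewrite sqr_sqrtr// ltW.
have e2 : Num.sqrt v2 ^+ 2 = v2 by rewrite sqr_sqrtr// ltW.
have rhoE : cxy = rho * (Num.sqrt v1 * Num.sqrt v2).
  by rewrite /rho sqrtrM ?(ltW v10)// divfK// mulf_neq0 ?gt_eqF.
move: rho rhoE => {}rho.
move: (Num.sqrt v1) (Num.sqrt v2) s1 s2 e1 e2 => u1 u2 s1 s2 e1 e2 rhoE.
(* This is the variance of X / u1 - rho Y / u2. *)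
have rho1 : 0 <= 1 - rho ^+ 2.
  have := pos u1^-1 (- rho / u2).
  rewrite rhoE -e1 -e2.
  rewrite (_ : _ + _ = 1 - rho ^+ 2)//; field.
  by rewrite !gt_eqF.
rewrite /rho_tilde !barPhi_inv_barPhi subrK.
have mfst : measurable_fun setT (fun u : measurableTypeR R * measurableTypeR R => u.1 : R).
  exact: (measurableT_comp measurable_idR measurable_fst).
have msnd : measurable_fun setT (fun u : measurableTypeR R * measurableTypeR R => u.2 : R).
  exact: (measurableT_comp measurable_idR measurable_snd).
pose Z (u : measurableTypeR R * measurableTypeR R) : R := rho * u.1 + Num.sqrt (1 - rho ^+ 2) * u.2.
have mZ : measurable_fun setT Z by apply: measurable_funD; apply: measurable_funM.
have mX1 : measurable_fun setT (fun w => u1^-1 * X w) by apply: measurable_funM.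
have mY1 : measurable_fun setT (fun w => u2^-1 * Y w) by apply: measurable_funM.
have := quadrant_eq (P1 := P) (P2 := (N \x N)%E) x y mX1 mY1 mfst mZ.
have -> : [set w | x <= u1^-1 * X w /\ y <= u2^-1 * Y w] =
  [set w | x * u1 <= X w /\ y * u2 <= Y w].
  by apply/seteqP; split => w /=; rewrite ![_^-1 * _]mulrC !ler_pdivlMr.
apply => a b th.
have -> : \int[P]_w cos (a * (u1^-1 * X w) + b * (u2^-1 * Y w) + th) =
  expR (- ((a ^+ 2 + 2 * (a * b * rho) + b ^+ 2) / 2)) * cos th.
  pose a' := a / u1; pose b' := b / u2.
  have mab : measurable_fun setT (fun w => a' * X w + b' * Y w) by apply: measurable_funD; apply: measurable_funM.
  have := Rint_normal_law 1 th mab (pos a' b') (law a' b').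
  have -> : a' ^+ 2 * v1 + 2 * (a' * b' * cxy) + b' ^+ 2 * v2 = a ^+ 2 + 2 * (a * b * rho) + b ^+ 2.
    by rewrite rhoE /a' /b' -e1 -e2; field; rewrite !gt_eqF.
  rewrite expr1n mulr1 => <-; apply: eq_Rintegral => w _; congr cos.
  by rewrite /a' /b'; ring.
transitivity (\int[(N \x N)%E]_u cos ((a + b * rho) * u.1 + (b * Num.sqrt (1 - rho ^+ 2)) * u.2 + th)).
  rewrite product_charfun exprMn sqr_sqrtr//; congr (expR _ * _).
  by field.
by apply: eq_Rintegral => u _; congr cos; rewrite /Z; ring.
Qed.

End gaussian_vectors.

(** * The Benjamini-Hochberg procedure *)

Section benjamini_hochberg_facts.
Context {R : realType}.

Lemma nth_sorted_le (s : seq R) (t : R) i : sorted <=%R s -> (i < size s)%N ->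
  (nth 0 s i <= t) = (i < count (fun x : R => (x <= t)%R) s)%N.
Proof.
elim: s i => [//|x s IH] i /= xs.
have ss : sorted <=%R s := path_sorted xs.
have [xt|tx] := leP x t; first by case: i => [|i] /= h; rewrite ?xt// IH.
have all_gt y : y \in x :: s -> t < y.
  rewrite inE => /predU1P[->//|ys].
  by apply: (lt_le_trans tx); have /allP := order_path_min le_trans xs; apply.
have -> : count (fun y : R => (y <= t)%R) s = 0%N.
  rewrite -[LHS]/(count _ s); apply/eqP; rewrite -leqn0 leqNgt -has_count; apply/hasPn => y ys.
  by rewrite -ltNge all_gt// inE ys orbT.
move=> h; rewrite add0n ltn0; apply/negbTE; rewrite -ltNge.
have /all_gt : nth 0 (x :: s) i \in x :: s by exact: mem_nth.
by case: i h.
Qed.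

Variables (m : nat) (q : R) (p : 'I_m -> R) (h : 'I_m -> bool).
Hypothesis m_gt0 : (0 < m)%N.
Hypothesis q_gt0 : 0 < q.

Definition pcount (t : R) : nat := #|[pred i | p i <= t]|.

Lemma pcount_le t : (pcount t <= m)%N.
Proof. by rewrite -[leqRHS](card_ord m) max_card. Qed.

Lemma le_pcount s t : s <= t -> (pcount s <= pcount t)%N.
Proof.
by move=> st; rewrite /pcount; apply/subset_leq_card/fintype.subsetP => i; rewrite !inE => /le_trans; apply.
Qed.

Lemma order_stat_le j t : (0 < j <= m)%N -> (order_stat p j <= t) = (j <= pcount t)%N.
Proof.
case: j => [//|j] /= jm.
rewrite /order_stat /= nth_sorted_le.
- rewrite (permP (permEl (perm_sort _ _))) count_map -size_filter /pcount cardE.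
  by rewrite /enum_mem -filter_predI /= -!enumT /enum_mem; congr (_ < size _)%N; apply: eq_filter => i /=; rewrite andbT.
- exact: sort_le_sorted.
- by rewrite size_sort size_map size_enum_ord.
Qed.

Let BH j := order_stat p j <= j%:R * q / m%:R.

Let threshold_ge0 (j : nat) : 0 <= j%:R * q / m%:R.
Proof. by rewrite divr_ge0// mulr_ge0// ltW. Qed.

Lemma bh_R_le : (bh_R q p <= m)%N.
Proof. by apply/bigmax_leqP => j _; rewrite -ltnS. Qed.

Lemma bh_R_rejects : (bh_R q p <= pcount ((bh_R q p)%:R * q / m%:R))%N.
Proof.
have [j jB jE] : {j : 'I_m.+1 | BH j & bh_R q p = j}.
  apply: (@eq_bigmax_cond _ (fun j : 'I_m.+1 => BH j) (fun j => j : nat)).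
  by apply/card_gt0P; exists ord0; rewrite unfold_in /BH /order_stat/=.
rewrite jE; case: (posnP j) => [->//|j0].
by rewrite -order_stat_le// j0/= -ltnS.
Qed.

Lemma bh_R_max j : (j <= m)%N -> (j <= pcount (j%:R * q / m%:R))%N -> (j <= bh_R q p)%N.
Proof.
move=> jm hj; case: (posnP j) => [->//|j0].
have jm' : (j < m.+1)%N by [].
rewrite -[j]/(Ordinal jm' : nat) /bh_R.
by apply: (leq_bigmax_cond (F := fun j : 'I_m.+1 => j : nat)); rewrite /= order_stat_le ?j0.
Qed.

(** The count j at t satisfies t <= j q / m, so j is itself admissible in the definition of R. *)
Lemma bh_R_ge t : t * m%:R / q <= (pcount t)%:R -> (pcount t <= bh_R q p)%N.
Proof.
move=> ht; apply: bh_R_max; first exact: pcount_le.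
apply: le_pcount.
by rewrite ler_pdivlMr ?ltr0n// -ler_pdivrMr.
Qed.

(** A p-value strictly above the order statistic P_(R) but at most R q / m would give more than R
    p-values below R q / m, against the maximality of R. For R = 0 both thresholds are 0. *)
Lemma bh_tau_le i : (p i <= bh_tau q p) = (p i <= (bh_R q p)%:R * q / m%:R).
Proof.
have hR := bh_R_rejects; have hm := bh_R_le.
rewrite /bh_tau; case: (posnP (bh_R q p)) => [r0|r0].
  by rewrite r0 /order_stat/= !mul0r.
have tau_le : order_stat p (bh_R q p) <= (bh_R q p)%:R * q / m%:R.
  by rewrite order_stat_le// r0.
apply/idP/idP => [/le_trans|pi]; first by apply.
rewrite leNgt; apply/negP => tp.
have lt1 : (pcount (order_stat p (bh_R q p)) < pcount ((bh_R q p)%:R * q / m%:R))%N.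
  rewrite /pcount; apply/proper_card/fintype.properP; split.
    by apply/fintype.subsetP => j; rewrite !inE => /le_trans; apply.
  by exists i; rewrite !inE// -ltNge.
have rt : (bh_R q p <= pcount (order_stat p (bh_R q p)))%N by rewrite -order_stat_le ?r0.
have : ((pcount ((bh_R q p)%:R * q / m%:R)) <= bh_R q p)%N.
  apply: bh_R_ge.
  by rewrite divfK ?pnatr_eq0 -?lt0n// mulfK ?gt_eqF// ler_nat.
by rewrite leqNgt (leq_ltn_trans rt lt1).
Qed.

(** At t = R q / m the premise of [bh_R_ge] reads R <= pcount t, so the count cannot exceed R, even
    when p-values are tied. *)
Lemma pcount_bh_tau : pcount (bh_tau q p) = bh_R q p.
Proof.
have -> : pcount (bh_tau q p) = pcount ((bh_R q p)%:R * q / m%:R).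
  by apply: eq_card => i; rewrite !inE bh_tau_le.
apply/eqP; rewrite eqn_leq bh_R_rejects andbT.
apply: bh_R_ge.
by rewrite divfK ?pnatr_eq0 -?lt0n// mulfK ?gt_eqF// ler_nat bh_R_rejects.
Qed.

Lemma bh_V_R : (bh_V q p h + #|[pred i | (p i <= bh_tau q p)%R && h i]| = bh_R q p)%N.
Proof.
rewrite -pcount_bh_tau /pcount -[RHS](cardID [pred i | h i]) addnC; congr (_ + _)%N.
  by apply: eq_card => i; rewrite !inE andbC.
Qed.

Lemma bh_V_bounds : (bh_V q p h <= bh_R q p <= bh_V q p h + #|[pred i | h i]|)%N.
Proof.
rewrite -bh_V_R leq_addr leq_add2l subset_leq_card//.
by apply/fintype.subsetP => i; rewrite !inE => /andP[].
Qed.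

End benjamini_hochberg_facts.

(** * The factor model *)

Section event_vector.
Context {R : realType} d {Omega : measurableType d} {I : finType}.
Variable b : I -> Omega -> bool.

(** The passage from the sample space to a finite one: integrals of functions of [evec] are finite
    sums against [evec_law]. *)
Definition evec (w : Omega) : {ffun I -> bool} := [ffun i => b i w].

Hypothesis mb : forall i, measurable [set w | b i w].

Lemma measurable_evec (Q : pred {ffun I -> bool}) : measurable [set w | Q (evec w)].
Proof.
have -> : [set w | Q (evec w)] = \big[setU/set0]_(x <- [seq x <- index_enum {ffun I -> bool} | Q x])
    \big[setI/setT]_(i <- index_enum I) (if x i then [set w | b i w] else ~` [set w | b i w]).
  rewrite -bigcup_seq; apply/seteqP; split => w /=.
    move=> Qw; exists (evec w); first by rewrite /= mem_filter Qw mem_index_enum.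
    rewrite -bigcap_seq => i _; rewrite /evec ffunE.
    by case: ifP => //= /negbT/negP.
  move=> [x /=]; rewrite mem_filter => /andP[Qx _]; rewrite -bigcap_seq => h.
  have -> // : evec w = x.
  apply/ffunP => i; rewrite ffunE; have := h i (mem_index_enum i).
  by case: (x i) => //= /negP/negbTE.
apply: bigsetU_measurable => x _; apply: bigsetI_measurable => i _.
by case: ifP => _ //; exact: measurableC.
Qed.

Variable P : probability Omega R.

Definition evec_law (x : {ffun I -> bool}) : R := pr P [set w | evec w == x].

Lemma bmf_evec (f : {ffun I -> bool} -> R) : bmf (fun w => f (evec w)).
Proof.
have -> : (fun w => f (evec w)) = fun w => \sum_x f x * \1_[set w | evec w == x] w.
  apply/funext => w; rewrite (bigD1 (evec w))//= indicE mem_set/= ?eqxx// mulr1.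
  rewrite big1 ?addr0// => x xw; rewrite indicE memNset ?mulr0//= => /eqP e.
  by rewrite e eqxx in xw.
apply: bmf_sum => x; apply: bmfZ; apply: bmf_indic.
exact: (measurable_evec (pred1 x)).
Qed.

Lemma Rint_Ex (f : {ffun I -> bool} -> R) : \int[P]_w f (evec w) = Ex evec_law f.
Proof.
have fE w : f (evec w) = \sum_x f x * \1_[set w | evec w == x] w.
  rewrite (bigD1 (evec w))//= indicE mem_set/= ?eqxx// mulr1.
  rewrite big1 ?addr0// => x xw; rewrite indicE memNset ?mulr0//= => /eqP e.
  by rewrite e eqxx in xw.
have bi x : bmf (\1_[set w | evec w == x] : Omega -> R).
  by apply: bmf_indic; exact: (measurable_evec (pred1 x)).
under eq_Rintegral do rewrite fE.
rewrite Rint_sum; last by move=> x; exact: bmfZ.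
rewrite /Ex; apply: eq_bigr => x _; rewrite (RintZ _ _ (bi x)) mulrC; congr (_ * _).
by rewrite Rint_indic//; exact: (measurable_evec (pred1 x)).
Qed.

Lemma pr_evec (Q : pred {ffun I -> bool}) : pr P [set w | Q (evec w)] = Ex evec_law (fun x => (Q x)%:R).
Proof.
rewrite pr_Rint; last exact: measurable_evec.
rewrite -Rint_Ex; apply: eq_Rintegral => w _; rewrite indicE.
by case: (boolP (Q (evec w))) => h; [rewrite mem_set|rewrite memNset//; exact/negP].
Qed.

Lemma evec_law_ge0 x : 0 <= evec_law x. Proof. exact: pr_ge0. Qed.

Lemma evec_law_sum : \sum_x evec_law x = 1.
Proof.
have := Rint_Ex (fun=> 1); rewrite Rint_cst => ->.
by apply: eq_bigr => x _; rewrite mulr1.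
Qed.

End event_vector.

(** [b'] sets the coordinates outside [D] to false, which does not affect [Q]. The claim is then
    [measurable_evec] on the sample space equipped with the generated sigma-algebra. *)
Lemma sigma_rv_evec d {Omega : measurableType d} d' {T' : measurableType d'} {I : finType}
    (X : I -> Omega -> T') (b : I -> Omega -> bool) (D : pred I) (Q : pred {ffun I -> bool}) :
  (forall i, exists2 A, measurable A & [set w | b i w] = X i @^-1` A) ->
  (forall x y : {ffun I -> bool}, (forall i, D i -> x i = y i) -> Q x = Q y) ->
  sigma_rv [set i | D i] X [set w | Q (evec b w)].
Proof.
move=> bX QD; rewrite /sigma_rv; set G := (X in <<s X >>).
pose b' i (w : g_sigma_algebraType G) := D i && b i w.
have -> : [set w | Q (evec b w)] = [set w : g_sigma_algebraType G | Q (evec b' w)].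
  apply/seteqP; split => w /=; rewrite (QD (evec b w) (evec b' w))// => i Di; rewrite !ffunE /b' Di//.
apply: (@measurable_evec _ (g_sigma_algebraType G)) => i.
have [Di|nDi] := boolP (D i); last first.
  rewrite (_ : [set w | b' i w] = set0)//.
  by apply/seteqP; split => // w /=; rewrite /b' (negbTE nDi).
have [A mA bA] := bX i.
rewrite (_ : [set w | b' i w] = X i @^-1` A); last by rewrite -bA /b' Di.
by apply: sub_gen_smallest; exists i, A.
Qed.

(** * Mixing coefficients of the factor model *)

Section factor_model_mixing.
Context {R : realType} {k : nat} d {Omega : measurableType d} {P : probability Omega R}.
Variable M : @factor_model R k d Omega P.

Let alpha_set l := [set y : R | exists m n A0 A1,
    [/\ (0 < m)%N, (0 < n)%N, sigma_past M m n A0, sigma_future M m (n + l) A1 &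
        y = `|fine (P (A0 `&` A1)) - fine (P A0) * fine (P A1)|]].

Lemma measurable_xi m (i : 'I_m) : measurable_fun setT (xi M i).
Proof. exact: measurable_fun_pair. Qed.

Lemma sigma_xi_measurable m (D : set 'I_m) (A : set Omega) : sigma_rv D (xi M (m := m)) A -> measurable A.
Proof.
apply: (smallest_sub (sigma_algebra_measurable _)) => _ [i [B [_ mB ->]]].
rewrite -[X in measurable X]setTI; exact: measurable_xi.
Qed.

Lemma alpha_ubound l : ubound (alpha_set l) 1.
Proof.
move=> _ [m [n [A0 [A1 [m0 n0 /sigma_xi_measurable mA0 /sigma_xi_measurable mA1 ->]]]]].
rewrite -!/(pr P _).
have := pr_le1 P mA0; have := pr_le1 P mA1; have := pr_le1 P (measurableI _ _ mA0 mA1).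
have := pr_ge0 P A0; have := pr_ge0 P A1; have := pr_ge0 P (A0 `&` A1).
rewrite ler_norml; nra.
Qed.

Let sigma0 m (D : set 'I_m) : sigma_rv D (xi M (m := m)) set0.
Proof.
by have [] := smallest_sigma_algebra setT [set B | exists i A, [/\ D i, measurable A & B = xi M i @^-1` A]].
Qed.

Let alpha_set0 l : alpha_set l 0.
Proof.
exists 1%N, 1%N, set0, set0; split => //; try exact: sigma0.
by rewrite setI0 measure0 mul0r subrr normr0.
Qed.

Lemma alpha_ub l y : alpha_set l y -> y <= alpha M l.
Proof. by move=> h; apply: ub_le_sup => //; exists 1; exact: alpha_ubound. Qed.

Lemma alpha_ge0 l : 0 <= alpha M l.
Proof. exact/alpha_ub/alpha_set0. Qed.

Lemma alpha_le1 l : alpha M l <= 1.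
Proof.
apply: sup_le_ub; last exact: alpha_ubound.
by exists 0; exact: alpha_set0.
Qed.

Lemma alpha_noninc l l' : (l <= l')%N -> alpha M l' <= alpha M l.
Proof.
move=> ll; apply: sup_le_ub; first by exists 0; exact: alpha_set0.
move=> y [m [n [A0 [A1 [m0 n0 s0 s1 ->]]]]]; apply: alpha_ub; exists m, n, A0, A1; split => //.
move: s1; apply: (smallest_sub (smallest_sigma_algebra _ _)).
move=> _ [i [A [/= Di mA ->]]]; apply: sub_gen_smallest; exists i, A; split => //=.
by apply: leq_trans Di; rewrite leq_add2l.
Qed.

(* As Q >= 4 is even and alpha <= 1, the summand l^(Q-2) alpha^(g/(Q+g))
   dominates l^2 alpha, which is all that the limit theorem needs. *)
Lemma alpha_sum (Q : nat) (g : R) : ~~ odd Q -> (2 < Q)%N -> 0 < g ->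
  (\sum_(1 <= l <oo) (l%:R ^+ (Q - 2) * alpha M l `^ (g / (Q%:R + g)))%:E < +oo)%E ->
  exists K, forall n, \sum_(1 <= l < n) l%:R ^+ 2 * alpha M l <= K.
Proof.
move=> oQ Q2 g0 sumlt.
have Q4 : (4 <= Q)%N by case: Q oQ Q2 {sumlt} => [|[|[|[|Q]]]].
pose u l : \bar R := (l%:R ^+ (Q - 2) * alpha M l `^ (g / (Q%:R + g)))%:E.
have u0 l : (0 <= u l)%E by rewrite lee_fin mulr_ge0 ?exprn_ge0 ?powR_ge0.
exists (fine (\sum_(1 <= l <oo) u l)%E) => n.
rewrite -lee_fin fineK; last by rewrite ge0_fin_numE// nneseries_ge0.
have [n1|n1] := leqP n 1; first by rewrite big_geq// nneseries_ge0.
apply: le_trans (nneseries_lim_ge n _); last by move=> *; exact: u0.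
rewrite sumEFin lee_fin big_nat_cond [leRHS]big_nat_cond; apply: ler_sum => l /andP[/andP[l1 _] _].
have Qg : 0 < Q%:R + g by rewrite ltr_wpDl.
rewrite ler_pM ?exprn_ge0 ?alpha_ge0//.
  by rewrite ler_weXn2l ?ler1n//; lia.
have := alpha_ge0 l; rewrite le_eqVlt => /predU1P[<-|al0]; first exact: powR_ge0.
rewrite -[leLHS]powRr1 ?alpha_ge0// ger_powR ?al0 ?alpha_le1//.
by rewrite ler_pdivrMr// mul1r lerDr.
Qed.

Lemma model_mixing_array m (b : 'I_m -> Omega -> bool) :
  (forall i, exists2 A, measurable A & [set x | b i x] = xi M i @^-1` A) ->
  mixing_array (evec_law b P) (alpha M).
Proof.
move=> bX n l A B n0 dA dB.
have mb i : measurable [set x | b i x].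
  have [C mC ->] := bX i; rewrite -[X in measurable X]setTI; exact: measurable_xi.
(* [alpha] ranges over m > 0; for m = 0 there is only one vector and the covariance is 0. *)
case: (posnP m) => [m0|m0].
  have cst (f : pred {ffun 'I_m -> bool}) : depends_on (fun i => i.+1 <= n)%N f.
    by move=> x y _; congr f; apply/ffunP => i; exfalso; have := ltn_ord i; lia.
  have x0 : {ffun 'I_m -> bool} := [ffun=> false].
  rewrite (@eq_Cov _ _ _ _ (fun=> (A x0)%:R) _ (fun x => (B x)%:R))//; last first.
    by move=> x; congr (nat_of_bool (A _))%:R; apply/ffunP => i; exfalso; have := ltn_ord i; lia.
  by rewrite Cov_cstl ?normr0 ?alpha_ge0//; exact: evec_law_sum.
apply: alpha_ub.
exists m, n, [set x | A (evec b x)], [set x | B (evec b x)]; split => //.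
- exact: sigma_rv_evec.
- exact: sigma_rv_evec.
rewrite -!/(pr P _) /Cov !pr_evec//.
rewrite (_ : [set x | A (evec b x)] `&` [set x | B (evec b x)] = [set x | (predI A B) (evec b x)]); last first.
  by apply/seteqP; split => x /=; [move=> [-> ->]|move/andP].
rewrite pr_evec//; congr `|_ - _|; apply: eq_Ex => x /=.
by case: (A x); case: (B x); rewrite /= ?mulr0 ?mulr1.
Qed.

End factor_model_mixing.

(** * Events of the model and their independence *)

Section factor_model_probabilities.
Context {R : realType} {k : nat} d {Omega : measurableType d} {P : probability Omega R}.
Variables (M : @factor_model R k d Omega P) (muA : R) (w : 'rV[R]_k).

Definition null_le m (t : R) (i : 'I_m) (x : Omega) : bool :=
  ~~ nonnull M i x && (pvalue M muA w i x <= t).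

Definition null_itv m (s t : R) (i : 'I_m) (x : Omega) : bool :=
  ~~ nonnull M i x && (s < pvalue M muA w i x <= t).

(** The p-value as a function of [xi], so that events on p-values have the form required by the
    sigma-algebras in [alpha]. *)
Let pv m (i : 'I_m) (u : R * bool) : R :=
  barPhi (muA * u.2%:R + dotv (loading M i) w + u.1).

Let measurable_pv m (i : 'I_m) : measurable_fun setT (pv i).
Proof.
apply: measurableT_comp; first by apply: continuous_measurable_fun; exact: barPhi_continuous.
apply: measurable_funD => //; apply: measurable_funD => //.
apply: measurable_funM => //.
by apply: (measurableT_comp (f := fun b : bool => b%:R : R)).
Qed.

Let measurable_null : measurable [set u : R * bool | ~~ u.2].
Proof.
have -> : [set u : R * bool | ~~ u.2] = snd @^-1` [set false].
  by apply/seteqP; split => -[a []] /=.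
by rewrite -[X in measurable X]setTI; exact: measurable_snd.
Qed.

Lemma null_le_xi m t (i : 'I_m) :
  exists2 A, measurable A & [set x | null_le t i x] = xi M i @^-1` A.
Proof.
exists ([set u | ~~ u.2] `&` pv i @^-1` `]-oo, t]).
  by apply: measurableI => //; rewrite -[X in measurable X]setTI; exact: measurable_pv.
by apply/seteqP; split => x /=; rewrite in_itv/= => /andP.
Qed.

Lemma null_itv_xi m s t (i : 'I_m) :
  exists2 A, measurable A & [set x | null_itv s t i x] = xi M i @^-1` A.
Proof.
exists ([set u | ~~ u.2] `&` pv i @^-1` `]s, t]).
  by apply: measurableI => //; rewrite -[X in measurable X]setTI; exact: measurable_pv.
by apply/seteqP; split => x /=; rewrite in_itv/= => /andP.
Qed.

Lemma pvalue_le_xi m t (i : 'I_m) :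
  exists2 A, measurable A & [set x | pvalue M muA w i x <= t] = xi M i @^-1` A.
Proof.
exists (pv i @^-1` `]-oo, t]); first by rewrite -[X in measurable X]setTI; exact: measurable_pv.
by apply/seteqP; split => x /=; rewrite in_itv/=.
Qed.

Lemma xi_measurable m (i : 'I_m) (b : Omega -> bool) :
  (exists2 A, measurable A & [set x | b x] = xi M i @^-1` A) -> measurable [set x | b x].
Proof. by move=> [A mA ->]; rewrite -[X in measurable X]setTI; exact: measurable_xi. Qed.

Lemma measurable_nonnull m (i : 'I_m) : measurable [set x | nonnull M i x].
Proof.
by rewrite -[X in measurable X]setTI; apply: (measurable_funP (nonnull M i) measurableT [set true]).
Qed.

Lemma pr_nonnull m (i : 'I_m) : pr P [set x | nonnull M i x] = pi1 M m.
Proof.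
have /andP[p0 p1] : 0 < pi1 M m < 1 by apply: pi1_itv; exact: leq_ltn_trans (ltn_ord i).
have := @nonnull_bernoulli _ _ _ _ _ M m i [set true].
rewrite bernoulli_probE ?(ltW p0) ?(ltW p1)// !diracE mem_set//= memNset//= mule1 mule0 adde0.
move=> h; apply: EFin_inj; rewrite -h /pr fineK//.
by rewrite fin_num_measure//; exact: measurable_nonnull.
Qed.

Lemma pr_null m (i : 'I_m) : pr P [set x | ~~ nonnull M i x] = pi_ M false m.
Proof.
rewrite /pi_ -(pr_nonnull i) -prC; last exact: measurable_nonnull.
by congr pr; apply/seteqP; split => x /= /negP.
Qed.

Lemma pr_null2 m (i j : 'I_m) : i != j ->
  pr P [set x | ~~ nonnull M i x /\ ~~ nonnull M j x] = pi_ M false m ^+ 2.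
Proof.
move=> ij.
pose A (u : 'I_m) : set bool := if (u == i) || (u == j) then [set false] else setT.
have mA u : measurable (A u) by [].
have := @nonnull_indep _ _ _ _ _ M m A mA.
have -> : \bigcap_u (nonnull M u @^-1` A u) = [set x | ~~ nonnull M i x /\ ~~ nonnull M j x].
  apply/seteqP; split => x /=.
    by move=> h; have := h i I; have := h j I; rewrite /A !eqxx orbT /= => -> ->.
  move=> [/negbTE hi /negbTE hj] u _; rewrite /A /=; case: ifP => // /orP[]/eqP -> //=.
rewrite (bigD1 i)//= (bigD1 j)/=; last by rewrite eq_sym.
rewrite big1 ?mule1; last first.
  by move=> u /andP[/negbTE ui /negbTE uj]; rewrite /A ui uj /= preimage_setT probability_setT.
rewrite /A !eqxx orbT /= => h.
rewrite /pr h -[1 - _]/(pi_ M false m) -!(pr_null i).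
have e u : nonnull M u @^-1` [set false] = [set x | ~~ nonnull M u x].
  by apply/seteqP; split => x /=; [move=> ->|move/negbTE].
have mn u : measurable [set x | ~~ nonnull M u x].
  by rewrite -e -[X in measurable X]setTI; apply: measurable_funP.
rewrite !e fineM ?fin_num_measure// expr2 -!/(pr P _).
by rewrite (pr_null i) (pr_null j).
Qed.

Lemma indep_null_noise m (A B : set Omega) :
  sigma_rv setT (@nonnull _ _ _ _ _ M m) A -> sigma_rv setT (@noise _ _ _ _ _ M m) B ->
  pr P (A `&` B) = pr P A * pr P B.
Proof.
move=> sA sB.
have sT : sigma_rv setT (Defs.factor M) setT.
  exact: (@measurableT _ (g_sigma_algebraType
    [set B | exists i A, [/\ setT i, measurable A & B = Defs.factor M i @^-1` A]])).
have := @model_indep _ _ _ _ _ M m A B setT sA sB sT.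
rewrite setIT probability_setT mule1 => h.
have mA : measurable A.
  move: sA; apply: (smallest_sub (sigma_algebra_measurable _)) => _ [i [C [_ mC ->]]].
  by rewrite -[X in measurable X]setTI; exact: measurable_funP.
have mB : measurable B.
  move: sB; apply: (smallest_sub (sigma_algebra_measurable _)) => _ [i [C [_ mC ->]]].
  by rewrite -[X in measurable X]setTI; exact: measurable_funP.
by rewrite /pr h fineM ?fin_num_measure.
Qed.

End factor_model_probabilities.

(** * Probabilities that one or two nulls fall below a level *)

Section null_rejection_probabilities.
Context {R : realType} {k : nat} d {Omega : measurableType d} {P : probability Omega R}.
Variables (M : @factor_model R k d Omega P) (muA : R) (w : 'rV[R]_k).

Lemma sum_two_deltas {S : pzRingType} m (i j : 'I_m) (a b : S) (f : 'I_m -> S) :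
  \sum_u (a * (u == i)%:R + b * (u == j)%:R) * f u = a * f i + b * f j.
Proof.
under eq_bigr do rewrite mulrDl.
rewrite big_split/=; congr (_ + _).
  by rewrite (bigD1 i)//= eqxx mulr1 big1 ?addr0// => u /negbTE ->; rewrite mulr0 mul0r.
by rewrite (bigD1 j)//= eqxx mulr1 big1 ?addr0// => u /negbTE ->; rewrite mulr0 mul0r.
Qed.

(** The case i = j is included; with a = 1 and b = 0 it gives the law of a single noise variable. *)
Lemma noise_pair_law m (i j : 'I_m) (a b : R)
    (v := a ^+ 2 * Sigma M m i i + 2 * (a * b * Sigma M m i j) + b ^+ 2 * Sigma M m j j) :
  0 <= v /\ forall A, measurable A ->
    P [set x | A (a * noise M i x + b * noise M j x)] = normal_law 0 v A.
Proof.
have [sym pos law] := noise_gaussian M m.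
pose c : 'rV[R]_m := \row_u (a * (u == i)%:R + b * (u == j)%:R).
have vE : (c *m Sigma M m *m c^T) 0 0 = v.
  rewrite mxE; under eq_bigr => u _ do rewrite !mxE mulrC.
  rewrite sum_two_deltas.
  under eq_bigr => u _ do rewrite mxE.
  rewrite sum_two_deltas.
  under eq_bigr => u _ do rewrite mxE.
  rewrite sum_two_deltas /v.
  have -> : Sigma M m j i = Sigma M m i j by rewrite -[in LHS]sym mxE.
  by ring.
split; first by rewrite -vE.
move=> A mA; rewrite -vE -law//; congr (P _); apply/seteqP; split => x /=.
  under eq_bigr => u _ do rewrite mxE.
  by rewrite sum_two_deltas.
under eq_bigr => u _ do rewrite mxE.
by rewrite sum_two_deltas.
Qed.

Let dot m (i : 'I_m) : R := muA * false%:R + dotv (loading M i) w.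

Lemma gam_barPhi m (i : 'I_m) (z : R) :
  gam M muA w false i (barPhi z) = barPhi ((z - dot i) / Num.sqrt (Sigma M m i i)).
Proof.
rewrite /gam barPhi_inv_barPhi/=.
have -> // : 1 - sqnorm2 (loading M i) = Sigma M m i i.
by rewrite -(unit_variance M i) addrC addKr.
Qed.

Let null_leE m (i : 'I_m) z : [set x | null_le M muA w (barPhi z) i x] =
  [set x | ~~ nonnull M i x] `&` [set x | z - dot i <= noise M i x].
Proof.
apply/seteqP; split => x /=; rewrite /null_le /pvalue barPhi_le /dot lerBlDl.
  by move=> /andP[n]; rewrite (negbTE n).
by move=> [n]; rewrite n (negbTE n).
Qed.

Let sigma_noise m (i : 'I_m) (z : R) : sigma_rv setT (@noise _ _ _ _ _ M m) [set x | z <= noise M i x].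
Proof.
apply: sub_gen_smallest; exists i, `[z, +oo[%classic; split => //.
by apply/seteqP; split => x /=; rewrite in_itv/= andbT.
Qed.

Let sigma_null m (i : 'I_m) : sigma_rv setT (@nonnull _ _ _ _ _ M m) [set x | ~~ nonnull M i x].
Proof.
apply: sub_gen_smallest; exists i, [set false]; split => //.
by apply/seteqP; split => x /=; [move/negbTE|move=> ->].
Qed.

(** Gives [gam] its probabilistic meaning. Averaged over i, it says that [Fm] is the mean of [Fhat],
    so [Wm] is a centred sum of indicators. *)
Lemma pr_null_le m (i : 'I_m) z :
  pr P [set x | null_le M muA w (barPhi z) i x] = pi_ M false m * gam M muA w false i (barPhi z).
Proof.
rewrite null_leE (indep_null_noise (sigma_null i) (sigma_noise i _)) pr_null; congr (_ * _).
rewrite gam_barPhi.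
have [_ law] := noise_pair_law i i 1 0.
apply: (@normal_law_ge _ _ _ P (noise M i) _ _ (measurable_funPT _) (Sigma_gt0 M i)).
move=> A mA; have := law A mA.
rewrite expr1n mul1r mulr0 mul0r mulr0 addr0 expr0n/= mul0r addr0 => <-.
by congr (P _); apply/seteqP; split => x /=; rewrite mul1r mul0r addr0.
Qed.

Lemma pr_null_le2 m (i j : 'I_m) z : i != j ->
  pr P [set x | null_le M muA w (barPhi z) i x /\ null_le M muA w (barPhi z) j x] =
  pi_ M false m ^+ 2 * (rho_tilde (gam M muA w false i (barPhi z)) (gam M muA w false j (barPhi z)) (Gam M i j)
   + gam M muA w false i (barPhi z) * gam M muA w false j (barPhi z)).
Proof.
move=> ij.
have -> : [set x | null_le M muA w (barPhi z) i x /\ null_le M muA w (barPhi z) j x] =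
  [set x | ~~ nonnull M i x /\ ~~ nonnull M j x] `&`
  [set x | z - dot i <= noise M i x /\ z - dot j <= noise M j x].
  have hi := null_leE i z; have hj := null_leE j z.
  apply/seteqP; split => x /=.
    move=> [h1 h2].
    have [? ?] : ([set x | ~~ nonnull M i x] `&` [set x | z - dot i <= noise M i x]) x by rewrite -hi.
    by have [? ?] : ([set x | ~~ nonnull M j x] `&` [set x | z - dot j <= noise M j x]) x by rewrite -hj.
  move=> [[h1 h2] [h3 h4]]; split.
    by have : [set x | null_le M muA w (barPhi z) i x] x by rewrite hi.
  by have : [set x | null_le M muA w (barPhi z) j x] x by rewrite hj.
rewrite (@indep_null_noise _ _ _ _ _ M m); last 2 first.
- have -> : [set x | ~~ nonnull M i x /\ ~~ nonnull M j x] =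
    [set x | ~~ nonnull M i x] `&` [set x | ~~ nonnull M j x] by [].
  exact: (@measurableI _ (g_sigma_algebraType _) _ _ (sigma_null i) (sigma_null j)).
- have -> : [set x | z - dot i <= noise M i x /\ z - dot j <= noise M j x] =
    [set x | z - dot i <= noise M i x] `&` [set x | z - dot j <= noise M j x] by [].
  exact: (@measurableI _ (g_sigma_algebraType _) _ _ (sigma_noise i _) (sigma_noise j _)).
rewrite pr_null2//; congr (_ * _).
rewrite !gam_barPhi.
have vi := Sigma_gt0 M i; have vj := Sigma_gt0 M j.
rewrite -(@bivariate_normal_quadrant _ _ _ P (noise M i) (noise M j) (Sigma M m i i) (Sigma M m j j) (Sigma M m i j))//.
- by rewrite !divfK ?gt_eqF ?sqrtr_gt0.
- by move=> a b; have [] := noise_pair_law i j a b.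
- by move=> a b A mA; have [_ ->] := noise_pair_law i j a b.
Qed.

End null_rejection_probabilities.

(** * The empirical process of the nulls as a centred sum *)

Section empirical_process.
Context {R : realType} {k : nat} d {Omega : measurableType d} {P : probability Omega R}.
Variables (M : @factor_model R k d Omega P) (muA : R) (w : 'rV[R]_k).
Local Notation F_ m t := (Fm M muA w m false t).
Local Notation W m t := (Wm M muA w m false t).
Local Notation gam_ := (gam M muA w false).

Let nulls m z := fun i : 'I_m => null_le M muA w (barPhi z) i.

Let m_null_le m (t : R) (i : 'I_m) : measurable [set x | null_le M muA w t i x].
Proof. by apply: (xi_measurable (i := i)); exact: null_le_xi. Qed.

Lemma prob1_evec m (b : 'I_m -> Omega -> bool) i : (forall i, measurable [set x | b i x]) ->
  prob1 (evec_law b P) i = pr P [set x | b i x].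
Proof.
move=> mb; rewrite /prob1 -(pr_evec mb P (fun x => x i)).
by congr pr; apply/seteqP; split => x /=; rewrite ffunE.
Qed.

Lemma csum_evec m (b : 'I_m -> Omega -> bool) x : (forall i, measurable [set x | b i x]) ->
  csum (evec_law b P) (evec b x) = \sum_i ((b i x)%:R - pr P [set x | b i x]).
Proof. by move=> mb; apply: eq_bigr => i _; rewrite /cind prob1_evec// ffunE. Qed.

Lemma Wm_sum m z x : (0 < m)%N -> W m (barPhi z) x =
  (\sum_(i < m) ((null_le M muA w (barPhi z) i x)%:R - pr P [set x | null_le M muA w (barPhi z) i x]))
  / Num.sqrt m%:R.
Proof.
move=> m0; have mR : 0 < m%:R :> R by rewrite ltr0n.
rewrite /Wm /Fhat /Fm.
have -> : \sum_(i < m) ((null_le M muA w (barPhi z) i x)%:R - pr P [set x | null_le M muA w (barPhi z) i x]) =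
  \sum_(i < m) ((nonnull M i x == false)%:R * (pvalue M muA w i x <= barPhi z)%R%:R)
  - pi_ M false m * \sum_(i < m) gam_ i (barPhi z).
  rewrite mulr_sumr -sumrB; apply: eq_bigr => i _; rewrite pr_null_le; congr (_ - _).
  by rewrite /null_le eqbF_neg -natrM mulnb.
have sq : Num.sqrt (m%:R : R) * Num.sqrt m%:R = m%:R by rewrite -expr2 sqr_sqrtr// ltW.
have s0 : Num.sqrt (m%:R : R) != 0 by rewrite gt_eqF// sqrtr_gt0.
by move: (Num.sqrt m%:R) s0 sq => s s0 <-; field; exact: s0.
Qed.

Lemma WmE m z x : (0 < m)%N ->
  W m (barPhi z) x = csum (evec_law (nulls z) P) (evec (nulls (m := m) z) x) / Num.sqrt m%:R.
Proof.
move=> m0; rewrite Wm_sum//; congr (_ / _).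
by rewrite csum_evec// => i; exact: m_null_le.
Qed.

Lemma measurable_Wm m z : (0 < m)%N -> measurable_fun setT (W m (barPhi z)).
Proof.
move=> m0; have mn i : measurable [set x | nulls (m := m) z i x] by exact: m_null_le.
have [h _] := bmf_evec mn (fun u => csum (evec_law (nulls (m := m) z) P) u / Num.sqrt m%:R).
by apply: eq_measurable_fun h => x _; rewrite WmE.
Qed.

Lemma Ex_csum m (mu : {ffun 'I_m -> bool} -> R) : \sum_x mu x = 1 -> Ex mu (csum mu) = 0.
Proof. by move=> mu1; rewrite /csum Ex_sum big1// => i _; rewrite -/(cind mu i) Ex_cind. Qed.

Lemma cm_csum m z : (0 < m)%N ->
  cm M muA w m false false (barPhi z) (barPhi z) =
  Ex (evec_law (nulls (m := m) z) P) (fun u => csum (evec_law (nulls z) P) u ^+ 2) / m%:R.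
Proof.
move=> m0; have mR : 0 < m%:R :> R by rewrite ltr0n.
have mn i : measurable [set x | nulls (m := m) z i x] by exact: m_null_le.
have mu1 := evec_law_sum mn P.
rewrite /cm covariance.unlock.
have -> : fine ('E_P[(W m (barPhi z))]) = 0.
  rewrite expectation.unlock -[fine _]/(\int[P]_x W m (barPhi z) x).
  under eq_Rintegral do rewrite WmE//.
  rewrite (Rint_Ex mn P (fun u => csum (evec_law (nulls z) P) u / Num.sqrt m%:R))//.
  under eq_Ex do rewrite mulrC.
  by rewrite ExZ Ex_csum ?mulr0.
rewrite expectation.unlock -[fine _]/(\int[P]_x (((W m (barPhi z) \- cst 0) * (W m (barPhi z) \- cst 0)) x)).
under eq_Rintegral do rewrite /= /GRing.mul /= !subr0 !WmE//.
rewrite -[RHS]mulrC -ExZ.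
rewrite -(Rint_Ex mn P (fun u => m%:R^-1 * csum (evec_law (nulls z) P) u ^+ 2))//.
apply: eq_Rintegral => x _.
rewrite -[_ / _]/(_ * _).
set c := csum _ _.
transitivity (c ^+ 2 / (Num.sqrt m%:R ^+ 2)).
  by rewrite -expr_div_n expr2.
by rewrite sqr_sqrtr ?(ltW mR)// mulrC.
Qed.

End empirical_process.

Lemma chebyshev_evec {R : realType} d {Omega : measurableType d} (P : probability Omega R)
    m (b : 'I_m -> Omega -> bool) (V u : R) :
  (forall i, measurable [set x | b i x]) -> (0 < m)%N -> 0 < u ->
  Ex (evec_law b P) (fun x => csum (evec_law b P) x ^+ 2) <= m%:R * V ->
  pr P [set x | u <= `|csum (evec_law b P) (evec b x) / Num.sqrt m%:R|] <= V / u ^+ 2.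
Proof.
move=> mb m0 u0 hV; have mR : 0 < m%:R :> R by rewrite ltr0n.
have s0 : 0 < Num.sqrt (m%:R : R) by rewrite sqrtr_gt0.
rewrite (pr_evec mb P (fun x => u <= `|csum (evec_law b P) x / Num.sqrt m%:R|)).
rewrite ler_pdivlMr ?exprn_gt0// mulrC -ExZ -(ler_pM2l mR); apply: le_trans hV.
rewrite -ExZ; apply: le_Ex => [x|x]; first exact: evec_law_ge0.
case: (leP u `|_|) => h; last by rewrite !mulr0 sqr_ge0.
rewrite mulr1 -[csum _ x ^+ 2]real_normK ?num_real//.
have -> : m%:R = Num.sqrt m%:R ^+ 2 :> R by rewrite sqr_sqrtr// ltW.
rewrite -exprMn lerXn2r ?nnegrE ?mulr_ge0 ?(ltW s0) ?(ltW u0)//.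
by rewrite mulrC -ler_pdivlMr// (le_trans h)// normrM [`|_^-1|]gtr0_norm ?invr_gt0.
Qed.

Section central_limit.
Context {R : realType} {k : nat} d {Omega : measurableType d} {P : probability Omega R}.
Variables (M : @factor_model R k d Omega P) (muA : R) (w : 'rV[R]_k).
Local Notation F_ m t := (Fm M muA w m false t).
Local Notation W m t := (Wm M muA w m false t).
Local Notation gam_ := (gam M muA w false).
Local Notation cm_ m z := (cm M muA w m false false (barPhi z) (barPhi z)).

Let nulls m z := fun i : 'I_m => null_le M muA w (barPhi z) i.

Let m_nulls m (z : R) (i : 'I_m) : measurable [set x | nulls z i x].
Proof. by apply: (xi_measurable (i := i)); exact: null_le_xi. Qed.

(** The diagonal of the double sum yields the first two terms, the pairs i != j the third. Each term
    is a sequence whose limit the theorem assumes to exist. *)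
Lemma cm_formula m z : (0 < m)%N -> cm_ m z = F_ m (barPhi z) -
  pi_ M false m * pi_ M false m / m%:R * \sum_(i < m) gam_ i (barPhi z) * gam_ i (barPhi z) +
  pi_ M false m * pi_ M false m / m%:R * \sum_(i < m) \sum_(j < m | j != i)
    rho_tilde (gam_ i (barPhi z)) (gam_ j (barPhi z)) (Gam M i j).
Proof.
move=> m0; rewrite cm_csum// Ex_csum2.
set p0 := pi_ M false m.
have mu1 := evec_law_sum (m_nulls z (m := m)) P.
have pE i : prob1 (evec_law (nulls (m := m) z) P) i = p0 * gam_ i (barPhi z).
  by rewrite prob1_evec// pr_null_le.
have -> : \sum_(i < m) \sum_(j < m) Ex (evec_law (nulls z) P)
    (fun x => cind (evec_law (nulls z) P) i x * cind (evec_law (nulls z) P) j x) =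
  \sum_(i < m) (p0 * gam_ i (barPhi z) - p0 ^+ 2 * (gam_ i (barPhi z) * gam_ i (barPhi z)) +
    \sum_(j < m | j != i) p0 ^+ 2 * rho_tilde (gam_ i (barPhi z)) (gam_ j (barPhi z)) (Gam M i j)).
  apply: eq_bigr => i _; rewrite (bigD1 i)//=; congr (_ + _).
    rewrite Ex_cind2// /Cov -/(prob1 _ i) pE.
    have -> : Ex (evec_law (nulls (m := m) z) P) (fun x => (x i)%:R * (x i)%:R) = p0 * gam_ i (barPhi z).
      by rewrite -pE /prob1; apply: eq_Ex => x; case: (x i); rewrite /= ?mulr0 ?mulr1.
    by ring.
  apply: eq_bigr => j ji; rewrite Ex_cind2// /Cov -/(prob1 _ i) -/(prob1 _ j) !pE.
  have -> : Ex (evec_law (nulls (m := m) z) P) (fun x => (x i)%:R * (x j)%:R) =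
    pr P [set x | nulls z i x /\ nulls z j x].
    transitivity (Ex (evec_law (nulls (m := m) z) P) (fun x => (x i && x j)%:R)).
      by apply: eq_Ex => x; case: (x i); case: (x j); rewrite /= ?mulr0 ?mulr1.
    rewrite -(pr_evec (m_nulls z (m := m)) P (fun x => x i && x j)).
    congr pr; apply/seteqP; split => x /=; rewrite !ffunE; first by move/andP.
    by move=> [-> ->].
  rewrite pr_null_le2; last by rewrite eq_sym.
  by rewrite -/p0; ring.
rewrite big_split sumrB /= -!mulr_sumr.
under [in LHS]eq_bigr do rewrite -mulr_sumr.
by rewrite -mulr_sumr /Fm -/p0; ring.
Qed.

Variable K : R.
Hypothesis al_sum : forall n, \sum_(1 <= l < n) l%:R ^+ 2 * alpha M l <= K.

Let mix_nulls m z : mixing_array (evec_law (nulls (m := m) z) P) (alpha M).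
Proof. by apply: model_mixing_array => i; exact: null_le_xi. Qed.

Let Ex_csum_nulls m z : Ex (evec_law (nulls (m := m) z) P) (fun x => csum (evec_law (nulls z) P) x ^+ 2) <= m%:R * (2 + 2 * K).
Proof.
apply: (Ex_csum2_le_lin _ _ _ al_sum (mix_nulls z)) => //.
- exact: evec_law_ge0.
- exact: evec_law_sum.
- exact: alpha_ge0.
Qed.

Lemma Wm_tail m z u : (0 < m)%N -> 0 < u ->
  pr P [set x | u <= `|W m (barPhi z) x|] <= (2 + 2 * K) / u ^+ 2.
Proof.
move=> m0 u0; have := chebyshev_evec (m_nulls z (m := m)) m0 u0 (Ex_csum_nulls _ _).
rewrite (_ : [set x | u <= `|csum _ _ / _|] = [set x | u <= `|W m (barPhi z) x|])//.
by apply/seteqP; split => x /=; rewrite WmE.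
Qed.

(** The increment is again a normalized centred sum, for the indicators of nulls with a p-value
    between the two levels; these events are rare when the levels are close, and [Ex_csum2_le]
    exploits it. *)
Lemma Wm_increment m z1 z2 u L : (0 < m)%N -> 0 < u -> (0 < L)%N -> z2 <= z1 ->
  pr P [set x | u <= `|W m (barPhi z2) x - W m (barPhi z1) x|] <=
  ((2 * L)%:R * (F_ m (barPhi z2) - F_ m (barPhi z1)) + 2 * K / L%:R ^+ 2) / u ^+ 2.
Proof.
move=> m0 u0 L0 z12; have mR : 0 < m%:R :> R by rewrite ltr0n.
have t12 : barPhi z1 <= barPhi z2 by rewrite barPhi_le.
pose b (i : 'I_m) := null_itv M muA w (barPhi z1) (barPhi z2) i.
have bxi i : exists2 A, measurable A & [set x | b i x] = xi M i @^-1` A by exact: null_itv_xi.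
have mb i : measurable [set x | b i x] by apply: (xi_measurable (i := i)).
have bE i x : (b i x)%:R = (nulls z2 i x)%:R - (nulls z1 i x)%:R :> R.
  rewrite /b /null_itv /nulls /null_le; case: (~~ _) => /=; last by rewrite subrr.
  have [h|h] := leP (pvalue M muA w i x) (barPhi z1).
    by rewrite (le_trans h t12)/= subrr.
  by rewrite subr0.
have prb i : pr P [set x | b i x] = pr P [set x | nulls z2 i x] - pr P [set x | nulls z1 i x].
  apply/eqP; rewrite eq_sym subr_eq addrC -pr_setU//.
    apply/eqP; congr pr; apply/seteqP; split => x /=.
      move=> h; have [n1|n1] := boolP (nulls z1 i x); [by left|right].
      by have := bE i x; rewrite h (negbTE n1) subr0; case: (b i x) => // /eqP; rewrite eq_sym oner_eq0.
    by move=> [|]; rewrite /b /nulls /null_le /null_itv => /andP[->]; [move/le_trans; apply|move/andP=> []].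
  apply/seteqP; split => // x [/= h1 h2].
  by move: h1 h2; rewrite /b /nulls /null_le /null_itv => /andP[_ h1] /andP[_ /andP[]]; rewrite ltNge h1.
have diffE x : W m (barPhi z2) x - W m (barPhi z1) x = csum (evec_law b P) (evec b x) / Num.sqrt m%:R.
  rewrite !Wm_sum// -mulrBl (csum_evec x mb); congr (_ / _).
  rewrite -sumrB; apply: eq_bigr => i _.
  by rewrite bE prb; ring.
have hV : Ex (evec_law b P) (fun x => csum (evec_law b P) x ^+ 2) <=
    m%:R * ((2 * L)%:R * (F_ m (barPhi z2) - F_ m (barPhi z1)) + 2 * K / L%:R ^+ 2).
  apply: le_trans (Ex_csum2_le (evec_law_ge0 b P) (evec_law_sum mb P) (alpha_ge0 M) al_sum (model_mixing_array bxi) L0) _.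
  rewrite mulrDr lerD2r mulrCA le_eqVlt; apply/orP; left; apply/eqP; congr (_ * _).
  rewrite /Fm -mulrBr -sumrB mulrA mulrCA divff ?mulr1 ?gt_eqF// mulr_sumr.
  by apply: eq_bigr => i _; rewrite prob1_evec// prb !pr_null_le mulrBr.
have := chebyshev_evec mb m0 u0 hV.
rewrite (_ : [set x | u <= `|csum _ _ / _|] = [set x | u <= `|W m (barPhi z2) x - W m (barPhi z1) x|])//.
by apply/seteqP; split => x /=; rewrite diffE.
Qed.

End central_limit.

(** * Central limit theorem for the empirical process at one point *)

Section central_limit_theorem.
Context {R : realType} {k : nat} d {Omega : measurableType d} {P : probability Omega R}.
Variables (M : @factor_model R k d Omega P) (muA : R) (w : 'rV[R]_k).
Local Notation W m t := (Wm M muA w m false t).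
Local Notation cm_ m z := (cm M muA w m false false (barPhi z) (barPhi z)).
Variable K : R.
Hypothesis al_sum : forall n, \sum_(1 <= l < n) l%:R ^+ 2 * alpha M l <= K.
Variables (z v : R).
Hypothesis cm_cvg : cm_ m z @[m --> \oo] --> v.

Let b m (i : 'I_m) : Omega -> bool := null_le M muA w (barPhi z) i.
Let mu m := evec_law (b (m := m)) P.
Let V m (u : {ffun 'I_m -> bool}) : R := csum (mu (m := m)) u / Num.sqrt m%:R.

Let mb m (i : 'I_m) : measurable [set x | b i x].
Proof. by apply: (xi_measurable (i := i)); exact: null_le_xi. Qed.

Let mu_ge0 m (u : {ffun 'I_m -> bool}) : 0 <= mu u.
Proof. exact: evec_law_ge0. Qed.

Let mu_sum m : \sum_(u : {ffun 'I_m -> bool}) mu u = 1.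
Proof. exact: evec_law_sum. Qed.

Let mix m : mixing_array (mu (m := m)) (alpha M).
Proof. by apply: model_mixing_array => i; exact: null_le_xi. Qed.

Let ExV2 m : (0 < m)%N -> Ex (mu (m := m)) (fun u => V u ^+ 2) = cm_ m z.
Proof.
move=> m0; rewrite cm_csum// [RHS]mulrC -ExZ; apply: eq_Ex => u.
by rewrite /V expr_div_n sqr_sqrtr ?ler0n// mulrC.
Qed.

Let ExV2_le m : (0 < m)%N -> Ex (mu (m := m)) (fun u => V u ^+ 2) <= 2 + 2 * K.
Proof.
move=> m0; rewrite ExV2// cm_csum// ler_pdivrMr ?ltr0n// mulrC.
exact: (Ex_csum2_le_lin (@mu_ge0 m) (mu_sum m) (alpha_ge0 M) al_sum (@mix m)).
Qed.

Lemma cm_lim_ge0 : 0 <= v.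
Proof.
rewrite -(cvg_lim _ cm_cvg)//; apply: limr_ge; first by apply/cvg_ex; exists v.
near=> m.
have m0 : (0 < m)%N by near: m; exact: nbhs_infty_gt.
by rewrite -ExV2//; apply: Ex_ge0 => // u; exact: sqr_ge0.
Unshelve. all: end_near.
Qed.

Let charfun_cvg_ge0 (lam th : R) : 0 <= lam ->
  Ex (mu (m := m)) (fun u => cos (lam * V u + th)) @[m --> \oo] --> expR (- (v * lam ^+ 2 / 2)) * cos th.
Proof.
move=> lam0.
have h1 : expR (- (cm_ m z * lam ^+ 2 / 2)) * cos th @[m --> \oo] --> expR (- (v * lam ^+ 2 / 2)) * cos th.
  apply: cvgMl; apply: (cvg_comp _ expR); last exact: continuous_expR.
  by apply: cvgN; apply: cvgMl; apply: cvgMl.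
rewrite -[X in _ --> X]add0r.
have -> : (fun m => Ex (mu (m := m)) (fun u => cos (lam * V u + th))) =
  (fun m => (Ex (mu (m := m)) (fun u => cos (lam * V u + th)) - expR (- (cm_ m z * lam ^+ 2 / 2)) * cos th)
     + expR (- (cm_ m z * lam ^+ 2 / 2)) * cos th).
  by apply/funext => m; rewrite subrK.
apply: cvgD h1.
apply/cvgr0Pnorm_le => e e0.
(* Bounds the factor in [charfun_le] uniformly in m, since the variance [cm] is at most 2 + 2 K;
   adding 1 keeps [C] positive when lam = 0. *)
pose C := lam * expR ((2 + 2 * K) * lam ^+ 2 / 2) + 1.
have C0 : 0 < C by rewrite ltr_wpDl// mulr_ge0// expR_ge0.
have [N hN] := stein_error_small lam (alpha_ge0 M) (alpha_noninc M) al_sum (divr_gt0 e0 C0).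
near=> m.
have m0 : (0 < m)%N by near: m; exact: nbhs_infty_gt.
have [L L0 hL] : exists2 L, (0 < L)%N & stein_error (alpha M) K L (Num.sqrt m%:R) lam (m := m) <= e / C.
  by apply: hN; near: m; exact: nbhs_infty_ge.
have r0 : 0 < Num.sqrt (m%:R : R) by rewrite sqrtr_gt0 ltr0n.
have r2 : Num.sqrt (m%:R : R) ^+ 2 = m%:R by rewrite sqr_sqrtr.
have := charfun_le (@mu_ge0 m) (mu_sum m) (alpha_ge0 M) al_sum (@mix m) L0 r0 r2 th lam0.
rewrite (ExV2 m0) => h; apply: le_trans h _.
apply: (@le_trans _ _ (C * (e / C))); last by rewrite mulrC divfK// gt_eqF.
have se0 : 0 <= stein_error (alpha M) K L (Num.sqrt m%:R) lam (m := m).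
  apply: le_trans (stein_le (@mu_ge0 m) (mu_sum m) (alpha_ge0 M) al_sum (@mix m) L0 r0 r2 lam th).
  exact: normr_ge0.
apply: ler_pM => //; first by rewrite mulr_ge0// expR_ge0.
rewrite /C (le_trans _ (_ : lam * expR ((2 + 2 * K) * lam ^+ 2 / 2) <= _))//; last by rewrite lerDl.
rewrite ler_wpM2l// ler_expR ler_wpM2r// ler_wpM2r ?sqr_ge0//.
by rewrite -ExV2// ExV2_le.
Unshelve. all: end_near.
Qed.

Lemma Wm_charfun_cvg (lam th : R) :
  Ex (mu (m := m)) (fun u => cos (lam * V u + th)) @[m --> \oo] --> expR (- (v * lam ^+ 2 / 2)) * cos th.
Proof.
have [lam0|lam0] := leP 0 lam; first exact: charfun_cvg_ge0.
have h : 0 <= - lam by rewrite oppr_ge0 ltW.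
have := @charfun_cvg_ge0 (- lam) (- th) h.
rewrite cosN sqrrN; rewrite (_ : (fun m => _) = (fun m => Ex (mu (m := m)) (fun u => cos (lam * V u + th)))) //.
apply/funext => m; apply: eq_Ex => u; rewrite -cosN; congr cos; ring.
Qed.

Lemma Wm_cdf (y y' e : R) : y < y' -> 0 < e ->
  (\forall m \near \oo, pr P [set x | W m (barPhi z) x <= y] <= fine (normal_law 0 v `]-oo, y']%classic) + e) /\
  (\forall m \near \oo, fine (normal_law 0 v `]-oo, y]%classic) - e <= pr P [set x | W m (barPhi z) x <= y']).
Proof.
move=> yy' e0.
have [Q [QE Qc]] := normal_law_probability cm_lim_ge0.
have W2 : \forall m \near \oo, Ex (mu (m := m)) (fun u => V u ^+ 2) <= 2 + 2 * K.
  by near=> m; apply: ExV2_le; near: m; exact: nbhs_infty_gt.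
have cc lam th : Ex (mu (m := m)) (fun u => cos (lam * V u + th)) @[m --> \oo] -->
    \int[Q]_x cos (lam * idfun x + th).
  by rewrite Qc; exact: Wm_charfun_cvg.
have [h1 h2] := cdf_cvg mu_ge0 mu_sum W2 measurable_idR cc yy' e0.
have prE' m y1 : (0 < m)%N -> pr P [set x | W m (barPhi z) x <= y1] =
    Ex (mu (m := m)) (fun u => (V u <= y1)%R%:R).
  move=> m0; rewrite -(pr_evec (@mb m) P (fun u => V u <= y1)).
  by congr pr; apply/seteqP; split => x /=; rewrite WmE.
have QE' y1 : pr Q [set x : measurableTypeR R | idfun x <= y1] = fine (normal_law 0 v `]-oo, y1]%classic).
  by rewrite -QE; congr (fine (Q _)); apply/seteqP; split => x /=; rewrite in_itv.
split.
  near=> m; rewrite prE'; last by near: m; exact: nbhs_infty_gt.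
  by rewrite -QE'; near: m; exact: h1.
near=> m; rewrite prE'; last by near: m; exact: nbhs_infty_gt.
by rewrite -QE'; near: m; exact: h2.
Unshelve. all: end_near.
Qed.

End central_limit_theorem.

(** * Rejections near the Simes point *)

Section bh_in_the_model.
Context {R : realType} {k : nat} d {Omega : measurableType d} {P : probability Omega R}.
Variables (M : @factor_model R k d Omega P) (q muA : R) (w : 'rV[R]_k).
Hypothesis q_gt0 : 0 < q.
Local Notation W m t := (Wm M muA w m false t).
Local Notation F_ m t := (Fm M muA w m false t).

Definition rejections m x : nat := bh_R q (fun i : 'I_m => pvalue M muA w i x).
Definition nonnulls m x : nat := #|[pred i : 'I_m | nonnull M i x]|.
Local Notation V m x := (false_rejections M q muA w m x).

Lemma false_rejections_bounds m x : (0 < m)%N ->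
  (V m x <= rejections m x <= V m x + nonnulls m x)%N.
Proof.
by move=> m0; exact: (bh_V_bounds (fun i => pvalue M muA w i x) (fun i => nonnull M i x) m0 q_gt0).
Qed.

Let Fhat_W m t x : (0 < m)%N -> m%:R * Fhat M muA w m false t x = m%:R * F_ m t + Num.sqrt m%:R * W m t x.
Proof.
move=> m0; have mR : 0 < m%:R :> R by rewrite ltr0n.
by rewrite /Wm mulrA -expr2 sqr_sqrtr ?(ltW mR)//; ring.
Qed.

Let Fhat_card m t x : (0 < m)%N ->
  m%:R * Fhat M muA w m false t x = #|[pred i : 'I_m | ~~ nonnull M i x && (pvalue M muA w i x <= t)]|%:R.
Proof.
move=> m0; rewrite /Fhat mulrA divff ?pnatr_eq0 -?lt0n// mul1r.
rewrite -sum1_card natr_sum [RHS]big_mkcond/=; apply: eq_bigr => i _.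
by rewrite inE -natrM mulnb eqbF_neg; case: (~~ _ && _).
Qed.

Lemma pcount_bounds m t x : (0 < m)%N ->
  m%:R * F_ m t + Num.sqrt m%:R * W m t x <= (pcount (fun i : 'I_m => pvalue M muA w i x) t)%:R
  <= m%:R * F_ m t + Num.sqrt m%:R * W m t x + (nonnulls m x)%:R.
Proof.
move=> m0; rewrite -Fhat_W// Fhat_card// -natrD !ler_nat; apply/andP; split.
  by apply: subset_leq_card; apply/fintype.subsetP => i; rewrite !inE => /andP[].
rewrite /pcount -(cardID [pred i | nonnull M i x]) addnC leq_add//.
by apply: subset_leq_card; apply/fintype.subsetP => i; rewrite !inE => /andP[].
Qed.

Lemma rejections_ge m t x : (0 < m)%N ->
  t * m%:R / q <= m%:R * F_ m t + Num.sqrt m%:R * W m t x -> t * m%:R / q <= (rejections m x)%:R.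
Proof.
move=> m0 h; have /andP[h1 _] := pcount_bounds t x m0.
have h2 := le_trans h h1; apply: (le_trans h2); rewrite ler_nat.
exact: (bh_R_ge m0 q_gt0).
Qed.

Lemma rejections_le m t x : (0 < m)%N -> (rejections m x)%:R * q / m%:R <= t ->
  (rejections m x)%:R <= m%:R * F_ m t + Num.sqrt m%:R * W m t x + (nonnulls m x)%:R.
Proof.
move=> m0 h; have /andP[_ h1] := pcount_bounds t x m0.
apply: le_trans h1; rewrite ler_nat.
apply: leq_trans (le_pcount _ h); exact: (bh_R_rejects _ q_gt0).
Qed.

Lemma rejections_le_m m x : (rejections m x <= m)%N.
Proof. exact: bh_R_le. Qed.

(** R and V are determined by the comparisons of the p-values with the m + 1 levels j q / m and by
    the nonnull indicators, that is by a finite event vector. *)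
Lemma measurable_rejections m (Q : nat -> nat -> bool) : (0 < m)%N ->
  measurable [set x | Q (V m x) (rejections m x)].
Proof.
move=> m0.
pose I := ('I_m * 'I_m.+1 + 'I_m)%type.
pose b (u : I) (x : Omega) : bool := match u with
  | inl (i, j) => pvalue M muA w i x <= j%:R * q / m%:R
  | inr i => nonnull M i x end.
have mb u : measurable [set x | b u x].
  case: u => [[i j]|i] /=; last exact: measurable_nonnull.
  by apply: (xi_measurable (i := i)); exact: pvalue_le_xi.
pose Rf (u : {ffun I -> bool}) : nat := \max_(j < m.+1 | (j <= #|[pred i | u (inl (i, j))]|)%N) j.
pose Vf (u : {ffun I -> bool}) : nat := #|[pred i | u (inl (i, inord (Rf u))) && ~~ u (inr i)]|.
have RE x : rejections m x = Rf (evec b x).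
  rewrite /rejections /bh_R /Rf; apply: eq_bigl => j.
  have -> : #|[pred i | evec b x (inl (i, j))]| = pcount (fun i : 'I_m => pvalue M muA w i x) (j%:R * q / m%:R).
    by apply: eq_card => i; rewrite !inE ffunE.
  case: (posnP j) => [j0|j0]; last by rewrite order_stat_le// j0 -ltnS/=.
  by rewrite j0 /order_stat/= !mul0r lexx.
have VE x : V m x = Vf (evec b x).
  rewrite /false_rejections /bh_V /Vf -RE; apply: eq_card => i; rewrite !inE !ffunE/=.
  by rewrite (bh_tau_le _ m0 q_gt0)// inordK// ltnS rejections_le_m.
rewrite (_ : [set x | _] = [set x | (fun u => Q (Vf u) (Rf u)) (evec b x)]).
  exact: (measurable_evec mb (fun u => Q (Vf u) (Rf u))).
by apply/seteqP; split => x /=; rewrite VE RE.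
Qed.

Lemma measurable_nonnulls m (c : R) : measurable [set x | c <= (nonnulls m x)%:R].
Proof.
pose b (i : 'I_m) x := nonnull M i x : bool.
have mb i : measurable [set x | b i x] by exact: measurable_nonnull.
rewrite (_ : [set x | _] = [set x | (fun u : {ffun 'I_m -> bool} => c <= #|[pred i | u i]|%:R) (evec b x)]).
  exact: (measurable_evec mb (fun u : {ffun 'I_m -> bool} => c <= #|[pred i | u i]|%:R)).
have e x : nonnulls m x = #|[pred i | evec b x i]| by apply: eq_card => i; rewrite !inE ffunE.
by apply/seteqP; split => x /=; rewrite e.
Qed.

Lemma pr_nonnulls_le m (c : R) : 0 < c ->
  pr P [set x | c <= (nonnulls m x)%:R] <= m%:R * pi1 M m / c.
Proof.
move=> c0; rewrite ler_pdivlMr// mulrC.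
pose b (i : 'I_m) x := nonnull M i x : bool.
have mb i : measurable [set x | b i x] by exact: measurable_nonnull.
have e x : (nonnulls m x)%:R = \sum_(i < m) (evec b x i)%:R :> R.
  rewrite -natr_sum /nonnulls -sum1_card big_mkcond/=; congr (_%:R); apply: eq_bigr => i _.
  by rewrite ffunE /b; case: ifP; rewrite inE => ->.
rewrite (_ : [set x | _] = [set x | (fun u : {ffun 'I_m -> bool} => c <= \sum_(i < m) (u i)%:R) (evec b x)]); last first.
  by apply/seteqP; split => x /=; rewrite e.
rewrite (pr_evec mb P (fun u : {ffun 'I_m -> bool} => c <= \sum_(i < m) (u i)%:R)) -ExZ.
apply: (@le_trans _ _ (Ex (evec_law b P) (fun u => \sum_(i < m) (u i)%:R))).
  apply: le_Ex => [u|u]; first exact: evec_law_ge0.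
  by case: (boolP (c <= _)) => h /=; rewrite ?mulr1n ?mulr0n ?mulr1// mulr0 sumr_ge0.
rewrite Ex_sum -sum_cst_ord ler_sum// => i _.
by rewrite -/(prob1 (evec_law b P) i) prob1_evec// pr_nonnull.
Qed.

End bh_in_the_model.

(** * Regularity of the limiting distribution functions *)

Section limiting_distribution_functions.
Context {R : realType} {k : nat} d {Omega : measurableType d} {P : probability Omega R}.
Variables (M : @factor_model R k d Omega P) (muA : R) (w : 'rV[R]_k).

Lemma sqrt_pi1_small : pi1 M =o_\oo (fun m : nat => (Num.sqrt (m%:R : R))^-1) ->
  forall e, 0 < e -> \forall m \near \oo, Num.sqrt m%:R * pi1 M m <= e.
Proof.
move=> h e e0; move: h => /eqoP /(_ _ e0) h.
near=> m.
have m0 : (0 < m)%N by near: m; exact: nbhs_infty_gt.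
have s0 : 0 < Num.sqrt (m%:R : R) by rewrite sqrtr_gt0 ltr0n.
have : `|pi1 M m| <= e * `|(Num.sqrt (m%:R : R))^-1| by near: m; exact: h.
rewrite [`|_^-1|]ger0_norm ?invr_ge0 ?(ltW s0)// ler_pdivlMr// mulrC.
by apply: le_trans; rewrite ler_pM2l// ler_norm.
Unshelve. all: end_near.
Qed.

Lemma gam01 r m (i : 'I_m) t : 0 <= gam M muA w r i t <= 1.
Proof. exact: ebarPhi01. Qed.

Let mean_gam01 r m t : 0 <= m%:R^-1 * \sum_(i < m) gam M muA w r i t <= 1.
Proof.
case: (posnP m) => [->|m0]; first by rewrite invr0 mul0r lexx ler01.
rewrite mulr_ge0 ?invr_ge0//=; last by apply: sumr_ge0 => i _; have /andP[] := gam01 r i t.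
rewrite mulrC ler_pdivrMr ?ltr0n// mul1r -[leRHS]mulr1 -sum_cst_ord.
by apply: ler_sum => i _; have /andP[] := gam01 r i t.
Qed.

Lemma Fm01 m r t : (0 < m)%N -> 0 <= Fm M muA w m r t <= pi_ M r m.
Proof.
move=> m0; have /andP[p0 p1] := pi1_itv M m0.
have pr0 : 0 <= pi_ M r m by case: r; rewrite /= ?subr_ge0 ltW.
have /andP[h0 h1] := mean_gam01 r m t.
by rewrite /Fm -mulrA mulr_ge0//= ler_piMr.
Qed.

Lemma F_true0 : (forall e, 0 < e -> \forall m \near \oo, Num.sqrt m%:R * pi1 M m <= e) ->
  F M muA w true = fun=> 0.
Proof.
move=> h; apply/funext => t; apply/cvg_lim => //.
apply/cvgr0Pnorm_le => e e0; near=> m.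
have m0 : (0 < m)%N by near: m; exact: nbhs_infty_gt.
have s1 : 1 <= Num.sqrt (m%:R : R) by rewrite -[leLHS]sqrtr1 ler_wsqrtr// ler1n.
have /andP[F0 F1] := Fm01 true t m0.
have /andP[p0 _] := pi1_itv M m0.
rewrite ger0_norm// (le_trans F1)//= (@le_trans _ _ (Num.sqrt m%:R * pi1 M m))//.
  by rewrite ler_peMl// ltW.
by near: m; exact: h.
Unshelve. all: end_near.
Qed.

Hypothesis F_cvg : forall t, 0 <= t <= 1 -> cvgn (fun m => Fm M muA w m false t).
Hypothesis loading_sup :
  (ereal_sup [set y | exists m (i : 'I_m), y = (sqnorm2 (loading M i))%:E] < 1%:E)%E.

Lemma F_cvg_to t : 0 <= t <= 1 -> Fm M muA w m false t @[m --> \oo] --> F M muA w false t.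
Proof. by move=> /F_cvg. Qed.

Let Sigma_lb : exists2 s : R, 0 < s & forall m (i : 'I_m), s <= Num.sqrt (Sigma M m i i).
Proof.
move: loading_sup; set S := ereal_sup _ => h.
have ub m (i : 'I_m) : ((sqnorm2 (loading M i))%:E <= S)%E by apply: ereal_sup_ubound; exists m, i.
have [s s1 Ss] : exists2 s, s < 1 & (S <= s%:E)%E.
  by move: h; case: S {ub} => [s||] h; [exists s|move: h|exists 0]; rewrite ?leNye ?lte_fin ?lexx ?ltr01 //; rewrite ltNge leey in h.
exists (Num.sqrt (1 - s)); first by rewrite sqrtr_gt0 subr_gt0.
move=> m i; rewrite ler_wsqrtr//; have := le_trans (ub m i) Ss; rewrite lee_fin => h2.
by have := unit_variance M i; lra.
Qed.

(** The noise variances are bounded away from 0, so in the variable z all F_m share a Lipschitz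
    constant, which the limit inherits. The resulting continuity serves the compactness argument in
    [crossing_gap]. *)
Lemma F_lip : exists2 C : R, 0 <= C & forall z z',
  `|F M muA w false (barPhi z) - F M muA w false (barPhi z')| <= C * `|z - z'|.
Proof.
have [s s0 hs] := Sigma_lb.
have b01 (y : R) : 0 <= barPhi y <= 1 by rewrite !ltW ?barPhi_gt0 ?barPhi_lt1.
exists (normal_peak 1 / s); first by rewrite divr_ge0// ?normal_peak_ge0// ltW.
move=> z z'.
have h : `|Fm M muA w m false (barPhi z) - Fm M muA w m false (barPhi z')| @[m --> \oo] -->
  `|F M muA w false (barPhi z) - F M muA w false (barPhi z')|.
  by apply: cvg_norm; apply: cvgB; exact: F_cvg_to.
rewrite -(cvg_lim _ h)//; apply: limr_le; first by apply/cvg_ex; eexists; exact: h.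
near=> m; have m0 : (0 < m)%N by near: m; exact: nbhs_infty_gt.
have mR : 0 < m%:R :> R by rewrite ltr0n.
have /andP[p0 p1] := pi1_itv M m0.
rewrite /Fm -mulrBr -sumrB normrM.
have -> : `|pi_ M false m / m%:R| = pi_ M false m / m%:R.
  by rewrite ger0_norm// divr_ge0//= subr_ge0 ltW.
apply: (@le_trans _ _ (m%:R^-1 * \sum_(i < m) (normal_peak 1 / s * `|z - z'|))).
  apply: ler_pM => //; first by rewrite divr_ge0//= subr_ge0 ltW.
    by rewrite ler_pdivrMr// mulVf ?gt_eqF//= gerBl ltW.
  apply: (le_trans (ler_norm_sum _ _ _)); apply: ler_sum => i _.
  rewrite !gam_barPhi (le_trans (barPhi_lip _ _))// -mulrA ler_wpM2l ?normal_peak_ge0//.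
  rewrite -mulrBl (_ : z - _ - _ = z - z'); last by ring.
  have si : 0 < Num.sqrt (Sigma M m i i) by rewrite sqrtr_gt0 Sigma_gt0.
  rewrite normrM mulrC ler_wpM2r// ger0_norm ?invr_ge0 ?(ltW si)//.
  by rewrite lef_pV2 ?posrE.
by rewrite sum_cst_ord mulrA mulVf ?mul1r// gt_eqF.
Unshelve. all: end_near.
Qed.

Lemma F_barPhi_continuous : continuous (fun z => F M muA w false (barPhi z)).
Proof.
have [C C0 hC] := F_lip.
have C1 : 0 < C + 1 by rewrite ltr_wpDl.
move=> z; apply/cvgrPdist_le => e e0.
near=> z'; apply: (le_trans (hC z z')).
apply: (@le_trans _ _ ((C + 1) * `|z - z'|)); first by rewrite ler_wpM2r// lerDl.
rewrite -ler_pdivlMl// mulrC; near: z'.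
by apply: (@cvgr_dist_le _ _ _ (nbhs z) _ (fun x => x) z); rewrite ?divr_gt0//; exact: cvg_id.
Unshelve. all: end_near.
Qed.

End limiting_distribution_functions.

(** * The last crossing of the line t / q *)

Section crossing_point.
Context {R : realType}.
Variables (f : R -> R) (q tau b : R).
Hypothesis q_gt0 : 0 < q.
Hypothesis f_tau : f tau = tau / q.

Lemma derive_expansion x e : derivable f x 1 -> 0 < e ->
  exists2 dl : R, 0 < dl & forall t, `|t - x| < dl -> `|f t - f x - derive1 f x * (t - x)| <= e * `|t - x|.
Proof.
move=> fx e0.
have : h^-1 *: (f (h + x) - f x) @[h --> 0^'] --> derive1 f x.
  move: fx; rewrite /derivable/= => fx; rewrite /derive1.
  rewrite (_ : (fun h : R => _ *: _) = (fun h => h^-1 *: (f (h *: 1 + x) - f x))) //.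
  by apply/funext => h; rewrite [h *: 1]mulr1.
move=> /cvgrPdist_le /(_ _ e0); rewrite /dnbhs/= => -[dl dl0 h].
exists dl => // t tx.
have [->|tneq] := eqVneq t x; first by rewrite !subrr mulr0 subr0 normr0 mulr0.
have t0 : t - x != 0 by rewrite subr_eq0.
have := h (t - x); rewrite /ball_/= sub0r normrN => /(_ tx t0).
rewrite subrK => h1.
have -> : f t - f x - derive1 f x * (t - x) = - (derive1 f x - (t - x)^-1 * (f t - f x)) * (t - x) by field.
by rewrite normrM normrN ler_wpM2r.
Qed.

Lemma simes_lt t : tau = sup [set s | 0 < s < 1 /\ s / q <= f s] -> 0 <= tau -> tau < t < 1 -> f t < t / q.
Proof.
move=> tauE tau0 /andP[tt t1]; rewrite ltNge; apply/negP => h.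
have : t <= tau.
  rewrite tauE; apply: ub_le_sup; first by exists 1 => s /= [/andP[_ /ltW]].
  by split => //; rewrite (le_lt_trans tau0)/=.
by rewrite leNgt tt.
Qed.

Hypothesis tau_itv : 0 < tau < b.
Hypothesis b_lt1 : b < 1.
Hypothesis f_lt : forall t, tau < t < 1 -> f t < t / q.
Hypothesis f_derivable : derivable f tau 1.
Hypothesis f_neq : 1 - q * derive1 f tau != 0.

(** If q f'(tau) exceeded 1, then f would lie above the line just to the right of tau, against
    [f_lt]; equality is excluded by [f_neq]. *)
Lemma crossing_slope_gt0 : 0 < 1 - q * derive1 f tau.
Proof.
rewrite lt_neqAle eq_sym f_neq/= leNgt; apply/negP => h.
have qV : q^-1 > 0 by rewrite invr_gt0.
have e0 : 0 < (derive1 f tau - q^-1) / 2.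
  rewrite divr_gt0// subr_gt0 -(ltr_pM2l q_gt0) mulfV ?gt_eqF//; lra.
have [dl dl0 hd] := derive_expansion f_derivable e0.
have /andP[t0 tb] := tau_itv.
pose t := tau + Num.min (dl / 2) (b - tau).
have m0 : 0 < Num.min (dl / 2) (b - tau) by rewrite lt_min divr_gt0// subr_gt0.
have tt : tau < t by rewrite ltrDl.
have t1 : t < 1.
  apply: le_lt_trans b_lt1; rewrite /t -lerBrDl ge_min lexx orbT//.
have tE : t - tau = `|t - tau| by rewrite gtr0_norm// subr_gt0.
have tl : `|t - tau| < dl.
  rewrite -tE /t addrAC subrr add0r (@le_lt_trans _ _ (dl / 2))// ?ge_min ?lexx//.
  by rewrite ltr_pdivrMr// ltr_pMr// ltr1n.
have := hd t tl; rewrite -tE f_tau ler_norml => /andP[h1 _].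
have := f_lt; move=> /(_ t); rewrite tt t1 => /(_ isT).
have d0 : 0 < t - tau by rewrite subr_gt0.
have := mulr_gt0 e0 d0.
lra.
Qed.

Hypothesis f_cont : continuous (f \o barPhi).

(** Near tau the derivative gives half of the limiting slope. Further away t / q - f t is positive
    and, in the variable z, continuous on a compact interval; its minimum divided by b - tau is a
    valid slope, as t - tau <= b - tau. *)
Lemma crossing_gap : exists2 c : R, 0 < c & forall t, tau <= t <= b -> c * (t - tau) <= t / q - f t.
Proof.
have c0 := crossing_slope_gt0; have b1 := b_lt1.
have /andP[tau0 tau_b] := tau_itv.
pose e := (1 - q * derive1 f tau) / (2 * q).
have e0 : 0 < e by rewrite divr_gt0// mulr_gt0.
have [dl dl0 hd] := derive_expansion f_derivable e0.
have near_tau t : tau <= t -> t - tau < dl -> e * (t - tau) <= t / q - f t.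
  move=> tt td; have tE : `|t - tau| = t - tau by rewrite ger0_norm// subr_ge0.
  have := hd t; rewrite tE => /(_ td); rewrite ler_norml f_tau => /andP[_].
  have -> : derive1 f tau = q^-1 - 2 * e by rewrite /e; field; rewrite gt_eqF.
  lra.
have [bd|bd] := ltP (b - tau) dl.
  by exists e => // t /andP[t1 t2]; apply: near_tau => //; lra.
pose s := tau + dl / 2.
have s01 : 0 < s < 1 by rewrite /s; apply/andP; split; lra.
have b01 : 0 < b < 1 by rewrite b_lt1 (lt_trans tau0).
have [zs zsE] := barPhi_surj s01.
have [zb zbE] := barPhi_surj b01.
have zbs : zb <= zs by rewrite -barPhi_le zsE zbE /s; lra.
pose g z := barPhi z / q - f (barPhi z).
have gc : {within `[zb, zs], continuous g}.
  apply: continuous_subspaceT => z; apply: cvgB; last exact: f_cont.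
  by apply: cvgMl; exact: barPhi_continuous.
have [z0 z0i hz0] := EVT_min zbs gc.
have itvE z : z \in `[zb, zs] -> s <= barPhi z <= b.
  by rewrite in_itv/= => /andP[h1 h2]; rewrite -zsE -zbE !barPhi_le h1 h2.
have g0 : 0 < g z0.
  have /andP[h1 h2] := itvE _ z0i; rewrite subr_gt0; apply: f_lt.
  by apply/andP; split; [move: h1; rewrite /s; lra|exact: le_lt_trans b_lt1].
have bt : 0 < b - tau by rewrite subr_gt0.
exists (Num.min e (g z0 / (b - tau))); first by rewrite lt_min e0 divr_gt0.
move=> t /andP[t1 t2]; have tt : 0 <= t - tau by rewrite subr_ge0.
have [td|td] := ltP (t - tau) dl.
  by apply: le_trans (near_tau t t1 td); rewrite ler_wpM2r// ge_min lexx.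
have t01 : 0 < t < 1 by apply/andP; split; [lra|exact: le_lt_trans b_lt1].
have [z zE] := barPhi_surj t01.
have zi : z \in `[zb, zs].
  by rewrite in_itv/= -(barPhi_le zb z) -(barPhi_le z zs) zE zsE zbE t2/= /s; lra.
have := hz0 z zi; rewrite {2}/g zE; apply: le_trans.
apply: (@le_trans _ _ (g z0 / (b - tau) * (t - tau))).
  by rewrite ler_wpM2r// ge_min lexx orbT.
by rewrite -mulrA ler_piMr ?(ltW g0)// mulrC ler_pdivrMr// mul1r lerB.
Qed.

End crossing_point.

Lemma sqrt_nat_ge {R : realType} (B : R) : \forall m \near \oo, B <= Num.sqrt (m%:R : R).
Proof.
near=> m.
have h : B ^+ 2 <= m%:R by near: m; exact: nbhs_infty_ger.
by rewrite (le_trans (ler_norm B))// -sqrtr_sqr ler_wsqrtr.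
Unshelve. all: end_near.
Qed.

Lemma sqrt_nat_inv_le {R : realType} (e : R) : 0 < e -> \forall m \near \oo, (Num.sqrt (m%:R : R))^-1 <= e.
Proof.
move=> e0; near=> m.
have h : e^-1 <= Num.sqrt (m%:R : R) by near: m; exact: sqrt_nat_ge.
rewrite -[e]invrK lef_pV2 ?posrE ?invr_gt0//.
by apply: lt_le_trans h; rewrite invr_gt0.
Unshelve. all: end_near.
Qed.

(** * Tails and local increments of the empirical process *)

Section processes.
Context {R : realType} {k : nat} d {Omega : measurableType d} {P : probability Omega R}.
Variables (M : @factor_model R k d Omega P) (muA : R) (w : 'rV[R]_k).
Local Notation W m t := (Wm M muA w m false t).
Local Notation F_ m t := (Fm M muA w m false t).
Local Notation F0 := (F M muA w false).
Local Notation r m := (Num.sqrt (m%:R : R)).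
Variable K : R.
Hypothesis al_sum : forall n, \sum_(1 <= l < n) l%:R ^+ 2 * alpha M l <= K.
Hypothesis sqrt_pi1 : forall e, 0 < e -> \forall m \near \oo, r m * pi1 M m <= e.

Lemma measurable_fun_Wm m t : (0 < m)%N -> 0 < t < 1 -> measurable_fun setT (W m t).
Proof. by move=> m0 /barPhi_surj[z <-]; exact: measurable_Wm. Qed.

Lemma measurable_set_ge (X : Omega -> R) y : measurable_fun setT X -> measurable [set x | y <= X x].
Proof.
move=> mX; rewrite -[X in measurable X]setTI (_ : [set x | _] = X @^-1` `[y, +oo[%classic); first exact: mX.
by apply/seteqP; split => x /=; rewrite in_itv/= andbT.
Qed.

Lemma measurable_set_le (X : Omega -> R) y : measurable_fun setT X -> measurable [set x | X x <= y].
Proof.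
move=> mX; rewrite -[X in measurable X]setTI (_ : [set x | _] = X @^-1` `]-oo, y]%classic); first exact: mX.
by apply/seteqP; split => x /=; rewrite in_itv.
Qed.

Lemma measurable_Wm_increment m s t u : (0 < m)%N -> 0 < s < 1 -> 0 < t < 1 ->
  measurable [set x | u <= `|W m s x - W m t x|].
Proof.
move=> m0 hs ht; apply: measurable_set_ge.
by apply: (measurableT_comp (f := fun z : R => `|z|)) => //; apply: measurable_funB; exact: measurable_fun_Wm.
Qed.

Lemma pr_nonnulls_small eta e : 0 < eta -> 0 < e ->
  \forall m \near \oo, pr P [set x | eta * r m <= (nonnulls M m x)%:R] <= e.
Proof.
move=> eta0 e0; near=> m.
have m0 : (0 < m)%N by near: m; exact: nbhs_infty_gt.
have s0 : 0 < r m by rewrite sqrtr_gt0 ltr0n.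
have h : r m * pi1 M m <= eta * e by near: m; apply: sqrt_pi1; exact: mulr_gt0.
have := pr_nonnulls_le M m (mulr_gt0 eta0 s0); move=> /le_trans; apply.
rewrite ler_pdivrMr ?mulr_gt0//.
have {1}-> : m%:R = r m * r m :> R by rewrite -expr2 sqr_sqrtr.
by rewrite -mulrA [leRHS](_ : _ = r m * (eta * e)); [rewrite ler_pM2l|ring].
Unshelve. all: end_near.
Qed.

Lemma W_tail_ge m t u : (0 < m)%N -> 0 < t < 1 -> 0 < u ->
  pr P [set x | u <= `|W m t x|] <= (2 + 2 * K) / u ^+ 2.
Proof. by move=> m0 /barPhi_surj[z <-] u0; exact: Wm_tail. Qed.

Lemma W_increment_le m s t u L : (0 < m)%N -> 0 < s < 1 -> 0 < t < 1 -> 0 < u -> (0 < L)%N ->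
  pr P [set x | u <= `|W m s x - W m t x|] <=
  ((2 * L)%:R * `|F_ m s - F_ m t| + 2 * K / L%:R ^+ 2) / u ^+ 2.
Proof.
move=> m0 hs ht u0 L0.
wlog st : s t hs ht / t <= s => [hwlog|].
  have [|st] := leP t s; first exact: hwlog.
  rewrite distrC (_ : [set x | _] = [set x | u <= `|W m t x - W m s x|]).
    by apply: hwlog => //; exact: ltW.
  by apply/seteqP; split => x /=; rewrite distrC.
move: hs ht st => /barPhi_surj[zs <-] /barPhi_surj[zt <-]; rewrite barPhi_le => st.
apply: (le_trans (Wm_increment muA w al_sum m0 u0 L0 st)).
rewrite ler_pM2r ?invr_gt0 ?exprn_gt0// lerD2r ler_wpM2l//.
exact: ler_norm.
Qed.

Variables (a b tau : R).
Hypothesis a_gt0 : 0 < a.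
Hypothesis b_lt1 : b < 1.
Hypothesis tau_itv : a < tau < b.
Hypothesis F0_derivable : derivable F0 tau 1.
Hypothesis F_unif : forall e, 0 < e -> \forall m \near \oo,
  forall t, a <= t <= b -> `|r m * (F_ m t - F0 t)| <= e.

Lemma near_tau y : \forall m \near \oo, a < tau + y / r m < b.
Proof.
have y1 : 0 < `|y| + 1 by rewrite ltr_wpDl.
have /andP[h1 h2] := tau_itv.
have e0 : 0 < Num.min (tau - a) (b - tau) / (`|y| + 1).
  by rewrite divr_gt0// lt_min !subr_gt0 h1.
near=> m.
have h : (r m)^-1 <= Num.min (tau - a) (b - tau) / (`|y| + 1).
  by near: m; exact: sqrt_nat_inv_le.
have s0 : 0 < (r m)^-1.
  by rewrite invr_gt0 sqrtr_gt0 ltr0n; near: m; exact: nbhs_infty_gt.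
move: h; rewrite ler_pdivlMr// le_min => /andP[h3 h4].
have h5 : `|y / r m| = `|y| * (r m)^-1 by rewrite normrM [`|_^-1|]gtr0_norm.
have := ler_norm (y / r m); have := ler_norm (- (y / r m)); rewrite normrN h5.
by move=> h6 h7; apply/andP; split; nra.
Unshelve. all: end_near.
Qed.

Lemma F0_near_tau y e : 0 < e -> \forall m \near \oo,
  `|r m * (F0 (tau + y / r m) - F0 tau) - derive1 F0 tau * y| <= e.
Proof.
have y1 : 0 < `|y| + 1 by rewrite ltr_wpDl.
move=> e0.
have e1 : 0 < e / (`|y| + 1) by rewrite divr_gt0.
have [dl dl0 h] := derive_expansion F0_derivable e1.
have d1 : 0 < dl / (`|y| + 1) by rewrite divr_gt0.
near=> m.
have s0 : 0 < r m.
  by rewrite sqrtr_gt0 ltr0n; near: m; exact: nbhs_infty_gt.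
have h1 : (r m)^-1 <= dl / (`|y| + 1) by near: m; exact: sqrt_nat_inv_le.
have yE : `|y / r m| = `|y| * (r m)^-1.
  by rewrite normrM [`|_^-1|]gtr0_norm ?invr_gt0.
have h2 : `|y / r m| < dl.
  rewrite yE; move: h1; rewrite ler_pdivlMr//.
  have := s0; rewrite -invr_gt0 => s0i h6; nra.
have := h (tau + y / r m); rewrite addrAC subrr add0r => /(_ h2); rewrite yE => h3.
have -> : r m * (F0 (tau + y / r m) - F0 tau) - derive1 F0 tau * y =
  r m * (F0 (tau + y / r m) - F0 tau - derive1 F0 tau * (y / r m)).
  by field; rewrite gt_eqF.
rewrite normrM gtr0_norm//; apply: (@le_trans _ _ (r m * (e / (`|y| + 1) * (`|y| * (r m)^-1)))).
  by rewrite ler_pM2l.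
rewrite (_ : _ * _ = e * (`|y| / (`|y| + 1))); last by field; rewrite !gt_eqF.
by rewrite ler_piMr ?(ltW e0)// ler_pdivrMr // mul1r lerDl.
Unshelve. all: end_near.
Qed.

Lemma Fm_near_tau y e : 0 < e -> \forall m \near \oo,
  `|r m * (F_ m (tau + y / r m) - F0 tau) - derive1 F0 tau * y| <= e.
Proof.
move=> e0; have e2 : 0 < e / 2 by rewrite divr_gt0.
near=> m.
have h1 : a < tau + y / r m < b by near: m; exact: near_tau.
have h2 : forall t, a <= t <= b -> `|r m * (F_ m t - F0 t)| <= e / 2.
  by near: m; exact: F_unif.
have h3 : `|r m * (F0 (tau + y / r m) - F0 tau) - derive1 F0 tau * y| <= e / 2.
  by near: m; exact: F0_near_tau.
set t := tau + _ in h1 h3 *.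
have {}h2 : `|r m * (F_ m t - F0 t)| <= e / 2.
  by apply: h2; case/andP: h1 => ? ?; rewrite !ltW.
rewrite (_ : _ - _ = r m * (F_ m t - F0 t) + (r m * (F0 t - F0 tau) - derive1 F0 tau * y)); last by ring.
by rewrite [leRHS]splitr (le_trans (ler_normD _ _))// lerD.
Unshelve. all: end_near.
Qed.

(** In [W_increment_le], [L] is fixed such that the far pairs use up half of e; then m grows until
    the near pairs, of order L / sqrt m, use up at most the other half. *)
Lemma pr_increment_small y u e : 0 < u -> 0 < e -> \forall m \near \oo,
  pr P [set x | u <= `|W m (tau + y / r m) x - W m tau x|] <= e.
Proof.
move=> u0 e0.
have /andP[at_ tb] := tau_itv.
have K0 : 0 <= K by have := al_sum 0; rewrite big_geq.
have eu0 : 0 < e * u ^+ 2 / 2 by rewrite divr_gt0 ?mulr_gt0 ?exprn_gt0.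
pose L := (Num.truncn (2 * K / (e * u ^+ 2 / 2))).+1.
have L0 : (0 < L)%N by [].
have hL : 2 * K / L%:R ^+ 2 <= e * u ^+ 2 / 2.
  rewrite ler_pdivrMr ?exprn_gt0// [leRHS]mulrC -ler_pdivrMr//.
  apply: (le_trans (ltW (truncnS_gt _))); rewrite -/L.
  by rewrite (expr2 L%:R) ler_peMl// ler1n.
have Lr0 : 0 < (2 * L)%:R :> R by rewrite ltr0n muln_gt0.
have e2 : 0 < e * u ^+ 2 / 2 / (2 * L)%:R by rewrite divr_gt0.
(* Bounds sqrt m times the increment of F_m: the linear term plus an error of 1 at either end. *)
pose B := `|derive1 F0 tau| * `|y| + 1 + 1.
have B0 : 0 < B by rewrite ltr_wpDl// addr_ge0// mulr_ge0.
near=> m.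
have m0 : (0 < m)%N by near: m; exact: nbhs_infty_gt.
have s0 : 0 < r m by rewrite sqrtr_gt0 ltr0n.
have /andP[h1 h2] : a < tau + y / r m < b by near: m; exact: near_tau.
have h3 : `|r m * (F_ m (tau + y / r m) - F0 tau) - derive1 F0 tau * y| <= 1.
  by near: m; exact: Fm_near_tau.
have h4 : `|r m * (F_ m (tau + 0 / r m) - F0 tau) - derive1 F0 tau * 0| <= 1.
  by near: m; exact: Fm_near_tau.
have h5 : (r m)^-1 <= e * u ^+ 2 / 2 / (2 * L)%:R / B.
  by near: m; apply: sqrt_nat_inv_le; exact: divr_gt0.
have t01 : 0 < tau < 1 by rewrite (lt_trans a_gt0)//= (lt_trans tb).
have s01 : 0 < tau + y / r m < 1 by rewrite (lt_trans a_gt0)//= (lt_trans h2).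
apply: (le_trans (W_increment_le m0 s01 t01 u0 L0)).
rewrite ler_pdivrMr ?exprn_gt0// [leRHS]splitr lerD// mulrC -ler_pdivlMr//.
move: h4; rewrite mul0r addr0 mulr0 subr0 => h4.
have : r m * `|F_ m (tau + y / r m) - F_ m tau| <= B.
  rewrite -[X in X * _]gtr0_norm// -normrM.
  rewrite (_ : _ * _ = (r m * (F_ m (tau + y / r m) - F0 tau) - derive1 F0 tau * y)
     + derive1 F0 tau * y - r m * (F_ m tau - F0 tau)); last by ring.
  rewrite (le_trans (ler_normB _ _))// lerD// (le_trans (ler_normD _ _))// addrC lerD//.
  by rewrite normrM.
rewrite mulrC -ler_pdivlMr//; move=> /le_trans; apply.
by rewrite mulrC -ler_pdivlMr.
Unshelve. all: end_near.
Qed.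

End processes.

Lemma near_forall_le (Q : nat -> nat -> Prop) (J : nat) : (forall j, \forall m \near \oo, Q j m) ->
  \forall m \near \oo, forall j, (j <= J)%N -> Q j m.
Proof.
move=> h; elim: J => [|J IH].
  by near=> m; move=> j; rewrite leqn0 => /eqP->; near: m; exact: h.
near=> m; move=> j; rewrite leq_eqVlt ltnS => /predU1P[->|]; first by near: m; exact: h.
by move: j; near: m.
Unshelve. all: end_near.
Qed.

(** Telescoping from 1 / j^2 <= 1 / (j - 1) - 1 / j; the induction carries the sharper bound 1 / J -
    1 / (J + i). *)
Lemma sum_inv_square_le {R : realType} (J n : nat) : (0 < J)%N ->
  \sum_(j < n | (J < j)%N) (j%:R : R) ^- 2 <= J%:R^-1.
Proof.
move=> J0.
have [nJ|Jn] := leqP n J.+1.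
  rewrite big_pred0 ?invr_ge0// => j; apply/negbTE; rewrite -leqNgt.
  by rewrite -ltnS (leq_trans (ltn_ord j)).
have -> : n = (J + (n - J.+1)).+1 by rewrite -addSn subnKC// ltnW.
move: (n - J.+1)%N => i.
apply: (@le_trans _ _ (J%:R^-1 - (J + i)%:R^-1)); last by rewrite gerBl invr_ge0.
rewrite big_mkcond/=; elim: i => [|i IH].
  by rewrite addn0 subrr big1// => j _; rewrite ltnNge -ltnS ltn_ord.
rewrite addnS big_ord_recr/= (le_trans (lerD IH (lexx _)))//.
rewrite ifT ?ltnS ?leq_addr// -[(J + i).+1%:R]natr1.
have x0 : 0 < (J + i)%:R :> R by rewrite ltr0n addn_gt0 J0.
move: ((J + i)%:R : R) x0 => y y0.
rewrite -addrA lerD2l -subr_ge0.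
rewrite (_ : _ - _ = (y * (y + 1) ^+ 2)^-1); last by field; rewrite !gt_eqF// addr_gt0.
by rewrite invr_ge0 mulr_ge0 ?sqr_ge0// ltW.
Qed.

Lemma measurable_exists2 d (T : measurableType d) (I : finType) (Q : pred I) (A : I -> set T) :
  (forall i, measurable (A i)) -> measurable [set x | exists2 i, Q i & A i x].
Proof.
by move=> mA; apply: fin_bigcup_measurable; [exact: finite_finset|move=> i _; exact: mA].
Qed.

(** * Comparison of the number of false rejections with the process at tau *)

Section rejections_near_tau.
Context {R : realType} {k : nat} d {Omega : measurableType d} {P : probability Omega R}.
Variables (M : @factor_model R k d Omega P) (q muA : R) (w : 'rV[R]_k).
Local Notation W m t := (Wm M muA w m false t).
Local Notation F_ m t := (Fm M muA w m false t).
Local Notation F0 := (F M muA w false).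
Local Notation r m := (Num.sqrt (m%:R : R)).
Local Notation V m x := (false_rejections M q muA w m x).
Local Notation N m x := ((nonnulls M m x)%:R : R).
Variable K : R.
Hypothesis al_sum : forall n, \sum_(1 <= l < n) l%:R ^+ 2 * alpha M l <= K.
Hypothesis sqrt_pi1 : forall e, 0 < e -> \forall m \near \oo, r m * pi1 M m <= e.
Variables (a b tau : R).
Hypothesis a_gt0 : 0 < a.
Hypothesis b_lt1 : b < 1.
Hypothesis tau_itv : a < tau < b.
Hypothesis F0_derivable : derivable F0 tau 1.
Hypothesis F_unif : forall e, 0 < e -> \forall m \near \oo,
  forall t, a <= t <= b -> `|r m * (F_ m t - F0 t)| <= e.
Hypothesis q_gt0 : 0 < q.
Hypothesis F0_tau : F0 tau = tau / q.
Local Notation c := (1 - q * derive1 F0 tau).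
Hypothesis c_gt0 : 0 < c.
Local Notation X m x := (r m * ((V m x)%:R / m%:R - tau / q)).

Let t01 m y : a < tau + y / r m < b -> 0 < tau + y / r m < 1.
Proof. by move=> /andP[h1 h2]; rewrite (lt_trans a_gt0)//= (lt_trans h2). Qed.

Let tau01 : 0 < tau < 1.
Proof. by case/andP: tau_itv => h1 h2; rewrite (lt_trans a_gt0)//= (lt_trans h2). Qed.

(** The height that the process must reach for the rejected fraction to be tau / q + y / sqrt m. A
    shift y of that fraction moves the threshold by q y, which turns the slope 1 / q - F0'(tau) into
    [c]. *)
Let boundary y e : 0 < e -> \forall m \near \oo,
  `|r m * ((tau + q * y / r m) / q - F_ m (tau + q * y / r m)) - c * y| <= e.
Proof.
move=> e0; near=> m.
have r0 : 0 < r m by rewrite sqrtr_gt0 ltr0n; near: m; exact: nbhs_infty_gt.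
have h : `|r m * (F_ m (tau + q * y / r m) - F0 tau) - derive1 F0 tau * (q * y)| <= e.
  near: m; exact: (@Fm_near_tau _ _ _ _ _ M muA w a b).
rewrite -normrN; move: h; rewrite F0_tau.
rewrite (_ : r m * _ - _ = - (r m * ((tau + q * y / r m) / q - F_ m (tau + q * y / r m)) - c * y))//.
by field; rewrite !gt_eqF.
Unshelve. all: end_near.
Qed.

Lemma measurable_X_le m y : (0 < m)%N -> measurable [set x | X m x <= y].
Proof.
move=> m0.
exact: (measurable_rejections M muA w q_gt0 (fun v _ => r m * (v%:R / m%:R - tau / q) <= y) m0).
Qed.

Lemma measurable_X_gt m y : (0 < m)%N -> measurable [set x | y < X m x].
Proof.
move=> m0.
exact: (measurable_rejections M muA w q_gt0 (fun v _ => y < r m * (v%:R / m%:R - tau / q)) m0).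
Qed.

(** If the process reached the boundary at [t], then R >= t m / q, and V >= R - N would push X above
    y. So W_m(t) lies below the boundary, and W_m(tau) differs little from it. *)
Lemma false_rejections_cdf_le y rho e : 0 < rho -> 0 < e -> \forall m \near \oo,
  pr P [set x | X m x <= y] <= pr P [set x | W m tau x <= c * y + rho] + e.
Proof.
move=> rho0 e0.
(* The margin kap sqrt m pays for the nonnulls and raises the boundary by c kap = rho / 4; the
   boundary error takes another rho / 4, the increment rho / 2. *)
pose kap := rho / (4 * c).
have kap0 : 0 < kap by rewrite divr_gt0// mulr_gt0.
have rho2 : 0 < rho / 2 by rewrite divr_gt0.
have rho4 : 0 < rho / 4 by rewrite divr_gt0.
have e2 : 0 < e / 2 by rewrite divr_gt0.
near=> m.
have m0 : (0 < m)%N by near: m; exact: nbhs_infty_gt.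
have r0 : 0 < r m by rewrite sqrtr_gt0 ltr0n.
have hN : pr P [set x | kap * r m <= N m x] <= e / 2 by near: m; exact: pr_nonnulls_small.
have hI : pr P [set x | rho / 2 <= `|W m (tau + q * (y + kap) / r m) x - W m tau x|] <= e / 2.
  near: m; exact: (@pr_increment_small _ _ _ _ _ M muA w K _ a b).
have ht : a < tau + q * (y + kap) / r m < b by near: m; exact: near_tau.
have hB : `|r m * ((tau + q * (y + kap) / r m) / q - F_ m (tau + q * (y + kap) / r m)) - c * (y + kap)| <= rho / 4.
  by near: m; exact: boundary.
set t := tau + q * (y + kap) / r m in hI ht hB.
have mW : measurable_fun setT (W m tau) by exact: measurable_fun_Wm.
have mA := measurable_set_le (c * y + rho) mW.
have mB : measurable [set x | rho / 2 <= `|W m t x - W m tau x|].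
  by apply: measurable_Wm_increment => //; exact: t01.
have mC : measurable [set x | kap * r m <= N m x] by exact: measurable_nonnulls.
apply: (@le_trans _ _ (pr P ([set x | W m tau x <= c * y + rho] `|`
   ([set x | rho / 2 <= `|W m t x - W m tau x|] `|` [set x | kap * r m <= N m x])))); last first.
  rewrite (le_trans (pr_setU_le _ _ _))//; first exact: measurableU.
  by rewrite lerD2l [leRHS]splitr (le_trans (pr_setU_le _ _ _))// lerD.
apply: le_pr; first exact: measurable_X_le.
  by apply: measurableU => //; exact: measurableU.
move=> x /= hX.
have [h1|h1] := leP (kap * r m) (N m x); first by right; right.
have [h2|h2] := leP (rho / 2) `|W m t x - W m tau x|; first by right; left.
left.
have h3 : W m t x < r m * (t / q - F_ m t).
  rewrite ltNge; apply/negP => h3.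
  pose s := r m; have mE : m%:R = s * s by rewrite -expr2 sqr_sqrtr.
  have h4 : t * m%:R / q <= m%:R * F_ m t + r m * W m t x.
    have : r m * (r m * (t / q - F_ m t)) <= r m * W m t x by rewrite ler_pM2l.
    by rewrite -/s mE; lra.
  have h5 := rejections_ge q_gt0 m0 h4.
  have /andP[_] := false_rejections_bounds M muA w q_gt0 x m0.
  rewrite -(ler_nat R) natrD => h6.
  have : r m * y < r m * X m x; last by rewrite ltr_pM2l// ltNge hX.
  have -> : r m * X m x = (V m x)%:R - m%:R * tau / q.
    by rewrite -/s mE; field; rewrite !gt_eqF.
  have h7 : t * m%:R / q = m%:R * tau / q + (y + kap) * r m.
    by rewrite /t -/s mE; field; rewrite !gt_eqF.
  lra.
move: h2 hB; rewrite ltr_norml ler_norml => /andP[h2 h2'] /andP[hB hB'].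
have h4 : c * kap = rho / 4 by rewrite /kap; field; rewrite gt_eqF.
move: hB'; rewrite [c * (y + kap)]mulrDr h4.
set u := c * y in h4 *.
by move: h3; set v := r m * _; lra.
Unshelve. all: end_near.
Qed.

Variable c1 : R.
Hypothesis c1_gt0 : 0 < c1.
Hypothesis gap : forall t, tau <= t <= b -> c1 * (t - tau) <= t / q - F0 t.
Hypothesis q_lt_b : q < b.

(* With t* = R q / m the BH threshold, this is the first point of the grid
   tau + q (y + j h) / sqrt m, j >= 1, beyond t*: there the empirical process is
   at least as large as the boundary, up to the step of the grid. *)
Let exceedance m x y h : (0 < m)%N -> 0 < h -> a < tau + q * y / r m < b -> q + q * h / r m <= b ->
  y < X m x -> N m x < h * r m ->
  exists j, let t := tau + q * (y + j%:R * h) / r m in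
    a <= t <= b /\ r m * (t / q - F_ m t) - 2 * h < W m t x.
Proof.
move=> m0 h0 /andP[ay _] qb Xy Nx.
have r0 : 0 < r m by rewrite sqrtr_gt0 ltr0n.
pose s := r m; have mE : m%:R = s * s by rewrite -expr2 sqr_sqrtr.
have s0 : 0 < s by [].
pose Rx : R := (rejections M q muA w m x)%:R.
have RV : (V m x)%:R <= Rx.
  by rewrite ler_nat; have /andP[] := false_rejections_bounds M muA w q_gt0 x m0.
have Rm : Rx <= m%:R by rewrite ler_nat rejections_le_m.
(* The position of the threshold R q / m on the grid, counted in steps from tau + q y / sqrt m. *)
pose z := (s * (Rx / m%:R - tau / q) - y) / h.
have z0 : 0 < z.
  rewrite divr_gt0// subr_gt0; apply: (lt_le_trans Xy); rewrite -/s ler_pM2l// lerD2r.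
  by rewrite ler_pM2r// invr_gt0 ltr0n.
have /andP[z1 z2] := truncn_itv (ltW z0).
exists (Num.truncn z).+1 => t.
have RE : Rx = m%:R * tau / q + s * (y + z * h).
  by rewrite /z mE; field; rewrite !gt_eqF.
have zlt : z * h < (Num.truncn z).+1%:R * h by rewrite ltr_pM2r.
have zge : (Num.truncn z).+1%:R * h <= z * h + h.
  by rewrite -natr1 mulrDl mul1r lerD2r ler_pM2r.
have tstar : Rx * q / m%:R = tau + q * (y + z * h) / s.
  by rewrite RE mE; field; rewrite !gt_eqF.
have tR : Rx * q / m%:R <= t.
  by rewrite tstar lerD2l ler_pM2r ?invr_gt0// ler_pM2l// lerD2l ltW.
(* R <= m puts the threshold below q, and one grid step beyond q still stays below b. *)
have tb : t <= b.
  apply: le_trans qb; apply: (@le_trans _ _ (Rx * q / m%:R + q * h / s)).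
    by rewrite tstar -addrA lerD2l -mulrDl ler_pM2r ?invr_gt0// -mulrDr ler_pM2l// -addrA lerD2l.
  by rewrite lerD2r ler_pdivrMr ?ltr0n// mulrC ler_pM2l.
have ta : a <= t.
  apply: le_trans (ltW ay) _; apply: le_trans tR; rewrite tstar lerD2l ler_pM2r ?invr_gt0//.
  by rewrite ler_pM2l// lerDl mulr_ge0// ltW.
split; first by rewrite ta tb.
have := rejections_le q_gt0 m0 tR; rewrite -/Rx -/s => h1.
have h2 : m%:R * t / q <= Rx + s * h.
  have -> : m%:R * t / q = m%:R * tau / q + s * (y + (Num.truncn z).+1%:R * h).
    by rewrite /t -/s mE; field; rewrite !gt_eqF.
  by rewrite RE -addrA lerD2l -mulrDr ler_pM2l// -addrA lerD2l.
(* One [h] of the loss 2 h pays for rounding up to the grid, the other for the nonnulls. *)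
rewrite -(ltr_pM2l s0) -/s.
have -> : s * (s * (t / q - F_ m t) - 2 * h) = m%:R * t / q - m%:R * F_ m t - 2 * (s * h).
  by rewrite mE; ring.
by move: Nx; rewrite -/s [h * s]mulrC; lra.
Qed.

(* Chebyshev at each of the grid points beyond the J-th, where the process must
   exceed g j; the bound does not depend on the number n of points. *)
Let far_grid m y h g J n : (0 < m)%N -> 0 < h -> 0 < g -> (0 < J)%N ->
  pr P [set x | exists2 j : 'I_n, (J < j)%N && (a < tau + q * (y + j%:R * h) / r m <= b) &
    (if a < tau + q * (y + j%:R * h) / r m <= b then
      [set x | g * j%:R <= `|W m (tau + q * (y + j%:R * h) / r m) x|] else set0) x] <=
  (2 + 2 * K) / g ^+ 2 / J%:R.
Proof.
move=> m0 h0 g0 J0; pose t j := tau + q * (y + j%:R * h) / r m.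
have t1 j : a < t j <= b -> 0 < t j < 1.
  by move=> /andP[h1 h2]; rewrite (lt_trans a_gt0)//= (le_lt_trans h2).
have K0 : 0 <= K by have := al_sum 0; rewrite big_geq.
have Kg : 0 <= (2 + 2 * K) / g ^+ 2 by rewrite divr_ge0 ?sqr_ge0 ?addr_ge0 ?mulr_ge0.
apply: le_trans (pr_bigcup_le _ _ _) _.
  move=> j; case: ifPn => // /t1 tj; apply: measurable_set_ge.
  by apply: (measurableT_comp (f := fun z : R => `|z|)) => //; exact: measurable_fun_Wm.
apply: (@le_trans _ _ (\sum_(j < n | (J < j)%N) ((2 + 2 * K) / g ^+ 2 * (j%:R : R) ^- 2))); last first.
  by rewrite -mulr_sumr ler_wpM2l ?sum_inv_square_le.
rewrite [leRHS](bigID (fun j : 'I_n => a < t j <= b))/= -[leLHS]addr0 lerD//; last first.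
  by apply: sumr_ge0 => j _; rewrite mulr_ge0 ?invr_ge0 ?sqr_ge0.
apply: ler_sum => j /andP[Jj tj]; rewrite tj.
have j0 : 0 < j%:R :> R by rewrite ltr0n (leq_ltn_trans _ Jj).
apply: le_trans (W_tail_ge muA w al_sum m0 (t1 _ tj) (mulr_gt0 g0 j0)) _.
by rewrite exprMn invfM mulrA.
Qed.

(** The probability e is shared by three events: too many nonnulls, a large increment between tau
    and one of the grid points 0, ..., J, and an exceedance beyond the J-th point. Outside them X >
    y forces W_m(tau) > c y - rho. *)
Lemma false_rejections_cdf_ge y rho e : 0 < rho -> 0 < e -> \forall m \near \oo,
  pr P [set x | W m tau x <= c * y - rho] - e <= pr P [set x | X m x <= y].
Proof.
move=> rho0 e0.
(* At a near point the losses are 2 h from the grid and the nonnulls, h from the boundary and h from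
   the increment, hence less than rho = 8 h. At the j-th far point the boundary is at least 2 g j up
   to an error h. *)
pose h := rho / 8; have h0 : 0 < h by rewrite divr_gt0.
pose g := c1 * q * h / 4; have g0 : 0 < g by rewrite divr_gt0 ?mulr_gt0.
have K0 : 0 <= K by have := al_sum 0; rewrite big_geq.
have e3 : 0 < e / 3 by rewrite divr_gt0.
(* The three summands ensure, for j > J: y + j h >= j h / 2; 3 h <= g j, so that the errors leave g
   j of the 2 g j; and a total Chebyshev bound of at most e / 3. *)
pose J := (Num.truncn (2 * `|y| / h + 12 / (c1 * q) + (2 + 2 * K) / g ^+ 2 / (e / 3))).+1.
have J0 : (0 < J)%N by [].
have [Jy Jc JK] : [/\ 2 * `|y| <= J%:R * h, 12 <= J%:R * (c1 * q) & (2 + 2 * K) / g ^+ 2 / J%:R <= e / 3].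
  have cq0 : 0 < c1 * q by rewrite mulr_gt0.
  have i1 : 0 <= 2 * `|y| / h by rewrite divr_ge0 ?mulr_ge0// ltW.
  have i2 : 0 <= 12 / (c1 * q) by rewrite divr_ge0// ltW.
  have i3 : 0 <= (2 + 2 * K) / g ^+ 2 / (e / 3).
    by rewrite divr_ge0 ?(ltW e3)// divr_ge0 ?sqr_ge0// addr_ge0// mulr_ge0.
  have := truncnS_gt (2 * `|y| / h + 12 / (c1 * q) + (2 + 2 * K) / g ^+ 2 / (e / 3)).
  rewrite -/J => lJ; split.
  - rewrite -ler_pdivrMr//; lra.
  - rewrite -ler_pdivrMr//; lra.
  - rewrite ler_pdivrMr ?ltr0n// [leRHS]mulrC -ler_pdivrMr//; lra.
pose e4 := e / 3 / J.+1%:R.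
have e40 : 0 < e4 by rewrite divr_gt0.
have bq0 : 0 < (b - q) / (q * h) by rewrite divr_gt0 ?subr_gt0// mulr_gt0.
near=> m.
have m0 : (0 < m)%N by near: m; exact: nbhs_infty_gt.
have r0 : 0 < r m by rewrite sqrtr_gt0 ltr0n.
have hN : pr P [set x | h * r m <= N m x] <= e / 3 by near: m; exact: pr_nonnulls_small.
have hI : forall j, (j <= J)%N ->
    pr P [set x | h <= `|W m (tau + q * (y + j%:R * h) / r m) x - W m tau x|] <= e4.
  near: m; apply: near_forall_le => j; exact: (@pr_increment_small _ _ _ _ _ M muA w K _ a b).
have hB : forall j, (j <= J)%N ->
    `|r m * ((tau + q * (y + j%:R * h) / r m) / q - F_ m (tau + q * (y + j%:R * h) / r m))
      - c * (y + j%:R * h)| <= h.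
  by near: m; apply: near_forall_le => j; exact: boundary.
have ht : forall j, (j <= J)%N -> a < tau + q * (y + j%:R * h) / r m < b.
  by near: m; apply: near_forall_le => j; exact: near_tau.
have hF : forall t, a <= t <= b -> `|r m * (F_ m t - F0 t)| <= h by near: m; exact: F_unif.
have hq : q + q * h / r m <= b.
  rewrite -lerBrDl -ler_pdivlMl ?mulr_gt0// mulrC; near: m; exact: sqrt_nat_inv_le.
pose t (j : nat) := tau + q * (y + j%:R * h) / r m.
(* Every grid point up to b has an index below n. This n grows with m, but the bound in [far_grid]
   does not depend on it. *)
pose n := (Num.truncn (((b - tau) * r m / q - y) / h)).+1.
have mW : measurable_fun setT (W m tau) by exact: measurable_fun_Wm.
pose EA := [set x | c * y - rho < W m tau x].
have mA' := measurable_set_le (c * y - rho) mW.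
have EAE : EA = ~` [set x | W m tau x <= c * y - rho].
  by apply/seteqP; split => x /=; rewrite /EA/= ltNge => /negP.
have mA : measurable EA by rewrite EAE; exact: measurableC.
pose EN := [set x | h * r m <= N m x].
have mN : measurable EN by exact: measurable_nonnulls.
pose A1 (j : 'I_J.+1) := [set x | h <= `|W m (t j) x - W m tau x|].
have mA1 j : measurable (A1 j).
  by apply: measurable_Wm_increment => //; apply: t01; apply: ht; rewrite -ltnS.
pose E1 := [set x | exists2 j : 'I_J.+1, predT j & A1 j x].
have mE1 : measurable E1 by exact: measurable_exists2.
have hE1 : pr P E1 <= e / 3.
  apply: le_trans (pr_bigcup_le _ _ mA1) _.
  apply: (@le_trans _ _ (\sum_(j < J.+1) e4)).
    by apply: ler_sum => j _; apply: hI; rewrite -ltnS.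
  by rewrite sum_cst_ord /e4 mulrC divfK.
pose A2 (j : 'I_n) := if a < t j <= b then [set x | g * j%:R <= `|W m (t j) x|] else set0.
pose E2 := [set x | exists2 j : 'I_n, (J < j)%N && (a < t j <= b) & A2 j x].
have mE2 : measurable E2.
  apply: measurable_exists2 => j; rewrite /A2; case: ifPn => // /andP[tj1 tj2].
  apply: measurable_set_ge; apply: (measurableT_comp (f := fun z : R => `|z|)) => //.
  by apply: measurable_fun_Wm => //; rewrite (lt_trans a_gt0)//= (le_lt_trans tj2).
have hE2 : pr P E2 <= e / 3 by apply: le_trans JK; exact: far_grid.
have mU := measurableU _ _ mN (measurableU _ _ mE1 mE2).
have main : [set x | y < X m x] `<=` EA `|` (EN `|` (E1 `|` E2)).
  move=> x /= Xy.
  have [h1|h1] := leP (h * r m) (N m x); first by right; left.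
  have ay : a < tau + q * y / r m < b by have := ht 0%N isT; rewrite mul0r addr0.
  have [j [/= tj]] := exceedance m0 h0 ay hq Xy h1; rewrite -/(t j) in tj * => hW.
  have [jJ|Jj] := leqP j J.
    have [h2|h2] := leP h `|W m (t j) x - W m tau x|.
      have jJ' : (j < J.+1)%N by [].
      by right; right; left; exists (Ordinal jJ').
    left; move: h2 (hB j jJ); rewrite -/(t j) ltr_norml ler_norml => /andP[_ h2] /andP[h3 _].
    have h4 : 0 <= c * (j%:R * h) by rewrite mulr_ge0 ?(ltW c_gt0)// mulr_ge0// ltW.
    rewrite /EA/= (_ : rho = 8 * h); last by rewrite /h; field.
    move: h2 h3 h4 hW; rewrite [c * (y + _)]mulrDr.
    set u1 := c * y; set u2 := c * (j%:R * h); set u3 := r m * _; lra.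
  right; right; right.
  have jy : `|y| <= j%:R * h / 2.
    rewrite ler_pdivlMr// mulrC (le_trans Jy)// ler_pM2r// ler_nat ltnW//.
  have jy2 : j%:R * h / 2 <= y + j%:R * h by have := ler_norm (- y); rewrite normrN; lra.
  have j0 : 0 < j%:R :> R by rewrite ltr0n (leq_ltn_trans _ Jj).
  have jh0 : 0 < j%:R * h / 2 by rewrite divr_gt0// mulr_gt0.
  have /andP[atau tau_b] := tau_itv.
  have tauj : tau <= t j.
    by rewrite lerDl divr_ge0 ?(ltW r0)// mulr_ge0 ?(ltW q_gt0)// (le_trans (ltW jh0)).
  have atj : a < t j by exact: lt_le_trans tauj.
  have /andP[_ tjb] := tj.
  have jn : (j < n)%N.
    rewrite -(ltr_nat R); apply: le_lt_trans (truncnS_gt _); rewrite ler_pdivlMr// lerBrDl.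
    by rewrite ler_pdivlMr// mulrC -ler_pdivrMr// lerBrDl.
  exists (Ordinal jn); first by rewrite /= Jj atj tjb.
  rewrite /A2/= atj tjb/=; apply: le_trans (ler_norm _).
  have h2 : c1 * (q * (j%:R * h / 2)) <= r m * (t j / q - F0 (t j)).
    apply: (@le_trans _ _ (r m * (c1 * (t j - tau)))).
      rewrite (_ : r m * _ = c1 * (q * (y + j%:R * h))); last by rewrite /t; field; rewrite gt_eqF.
      by rewrite ler_pM2l// ler_pM2l.
    by rewrite ler_pM2l//; apply: gap; rewrite tauj tjb.
  have := hF _ tj; rewrite ler_norml => /andP[_ h3].
  have h4 : 3 * h <= g * j%:R.
    have : 12 <= j%:R * (c1 * q) by rewrite (le_trans Jc)// ler_pM2r ?mulr_gt0// ler_nat ltnW.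
    rewrite -(ler_pM2r h0 12) /g; set u := j%:R * (c1 * q) * h => h4.
    by rewrite (_ : _ * j%:R = u / 4); [lra|rewrite /u; field].
  have h5 : c1 * (q * (j%:R * h / 2)) = 2 * (g * j%:R) by rewrite /g; field.
  move: hW h2 h3; rewrite h5 !mulrBr; set u1 := r m * (t j / q).
  by set u2 := r m * F_ m (t j); set u3 := r m * F0 (t j); lra.
have X1 : pr P [set x | y < X m x] = 1 - pr P [set x | X m x <= y].
  rewrite -prC; last exact: measurable_X_le.
  by congr pr; apply/seteqP; split => x /=; rewrite ltNge => /negP.
have A1E : pr P EA = 1 - pr P [set x | W m tau x <= c * y - rho] by rewrite EAE prC.
have : pr P [set x | y < X m x] <= pr P EA + e.
  apply: le_trans (le_pr P _ _ main) _; [exact: measurable_X_gt|exact: measurableU|].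
  apply: le_trans (pr_setU_le P mA mU) _; rewrite lerD2l.
  apply: le_trans (pr_setU_le P mN (measurableU _ _ mE1 mE2)) _.
  have := pr_setU_le P mE1 mE2; lra.
rewrite X1 A1E; lra.
Unshelve. all: end_near.
Qed.

End rejections_near_tau.

(** * Convergence of the false discovery proportion *)

Section false_discovery_proportion.
Context {R : realType} {k : nat} d {Omega : measurableType d} {P : probability Omega R}.
Variables (M : @factor_model R k d Omega P) (q muA : R) (w : 'rV[R]_k).
Local Notation W m t := (Wm M muA w m false t).
Local Notation F_ m t := (Fm M muA w m false t).
Local Notation F0 := (F M muA w false).
Local Notation r m := (Num.sqrt (m%:R : R)).
Local Notation N m x := ((nonnulls M m x)%:R : R).
Variable K : R.
Hypothesis al_sum : forall n, \sum_(1 <= l < n) l%:R ^+ 2 * alpha M l <= K.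
Hypothesis sqrt_pi1 : forall e, 0 < e -> \forall m \near \oo, r m * pi1 M m <= e.
Variable a : R.
Hypothesis a_itv : 0 < a < 1.
Hypothesis F0_a : a / q < F0 a.
Hypothesis q_gt0 : 0 < q.
Hypothesis Fm_cvg : F_ m a @[m --> \oo] --> F0 a.

(** 1 - FDP = (R - V) / R is at most N / R, where N counts the nonnulls: the numerator is o(sqrt m)
    in probability and the denominator is of order m. *)
Lemma FDP_cvg : cvg_in_probability P (fun m x => r m * (FDP M q muA w m x - 1)) 0.
Proof.
move=> e e0; have /andP[a0 a1] := a_itv.
(* Half of the gap at [a]: the convergence of F_m(a) and the fluctuation W_m(a) / sqrt m may each
   cost [dl], and the line is still reached. *)
pose dl := (F0 a - a / q) / 2.
have dl0 : 0 < dl by rewrite divr_gt0// subr_gt0.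
have K0 : 0 <= K by have := al_sum 0; rewrite big_geq.
pose B m := [set x | e <= `|r m * (FDP M q muA w m x - 1) - 0|].
have mB m : (0 < m)%N -> measurable (B m).
  move=> m0.
  exact: (measurable_rejections M muA w q_gt0
    (fun v s => e <= `|r m * (v%:R / (maxn s 1)%:R - 1) - 0|) m0).
suff h : pr P (B m) @[m --> \oo] --> (0 : R).
  apply/fine_cvgP; split; last exact: h.
  by near=> m; apply: fin_num_measure; apply: mB; near: m; exact: nbhs_infty_gt.
apply/cvgr0Pnorm_le => e' e'0.
have e2 : 0 < e' / 2 by rewrite divr_gt0.
have eta0 : 0 < e * (a / q) by rewrite mulr_gt0// divr_gt0.
have t0 : 0 < e' / 2 * dl ^+ 2 by rewrite mulr_gt0// exprn_gt0.
near=> m.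
have m0 : (0 < m)%N by near: m; exact: nbhs_infty_gt.
have r0 : 0 < r m by rewrite sqrtr_gt0 ltr0n.
have hN : pr P [set x | e * (a / q) * r m <= N m x] <= e' / 2 by near: m; exact: pr_nonnulls_small.
have hF : F0 a - dl <= F_ m a.
  have : `|F0 a - F_ m a| <= dl by near: m; move/cvgrPdist_le : Fm_cvg; apply.
  by rewrite ler_norml => /andP[_]; lra.
have hm : (2 + 2 * K) / (e' / 2 * dl ^+ 2) <= m%:R by near: m; exact: nbhs_infty_ger.
pose s := r m; have mE : m%:R = s * s by rewrite -expr2 sqr_sqrtr.
have hW : pr P [set x | dl * s <= `|W m a x|] <= e' / 2.
  apply: le_trans (W_tail_ge muA w al_sum m0 a_itv (mulr_gt0 dl0 r0)) _.
  have den0 : 0 < dl ^+ 2 * m%:R by rewrite mulr_gt0 ?ltr0n// (exprn_gt0 2 dl0).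
  by rewrite exprMn sqr_sqrtr// ler_pdivrMr// mulrA -ler_pdivrMl// mulrC.
have mN : measurable [set x | e * (a / q) * r m <= N m x] by exact: measurable_nonnulls.
have mW : measurable [set x | dl * s <= `|W m a x|].
  apply: measurable_set_ge; apply: (measurableT_comp (f := fun z : R => `|z|)) => //.
  exact: measurable_fun_Wm.
rewrite ger0_norm ?pr_ge0// [leRHS]splitr.
apply: le_trans (lerD hN hW); apply: le_trans (pr_setU_le P mN mW).
apply: le_pr; [exact: mB|exact: measurableU|].
move=> x; rewrite /B/= subr0 => hx.
have [h1|h1] := leP (dl * s) `|W m a x|; [by right|left].
move: h1; rewrite ltr_norml => /andP[h1 _].
have h2 : a * m%:R / q <= m%:R * F_ m a + r m * W m a x.
  have : s * (s * (a / q)) <= s * (s * F_ m a + W m a x).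
    rewrite ler_pM2l//; apply: (@le_trans _ _ (s * (F0 a - dl) - s * dl)); last first.
      by rewrite lerD// ?ler_pM2l// mulrC ltW.
    by rewrite -mulrBr ler_pM2l// /dl; lra.
  by rewrite -/s mE; lra.
have h3 := rejections_ge q_gt0 m0 h2.
have := false_rejections_bounds M muA w q_gt0 x m0.
set V := false_rejections _ _ _ _ _ _; set S := rejections _ _ _ _ _ _ in h3 *.
rewrite -!(ler_nat R) natrD => /andP[VS SV].
have S0 : 0 < S%:R :> R by apply: lt_le_trans h3; rewrite !mulr_gt0 ?invr_gt0 ?ltr0n.
have FE : FDP M q muA w m x - 1 = - ((S%:R - V%:R) / S%:R).
  have -> : FDP M q muA w m x = V%:R / S%:R.
    by rewrite /FDP /bh_FDP (maxn_idPl _)// -(ltr0n R).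
  by field; rewrite gt_eqF.
move: hx; rewrite FE mulrN normrN ger0_norm; last first.
  by rewrite mulr_ge0 ?(ltW r0)// divr_ge0 ?subr_ge0.
rewrite -/s [s * (_ / _)]mulrA ler_pdivlMr// => hx.
have h4 : s * (e * (a / q) * s) <= s * N m x; last by rewrite ler_pM2l in h4.
apply: (@le_trans _ _ (s * (S%:R - V%:R))); last by rewrite ler_pM2l// lerBlDl.
apply: le_trans hx; rewrite (_ : s * _ = e * (a * m%:R / q)); last by rewrite mE; ring.
by rewrite ler_pM2l.
Unshelve. all: end_near.
Qed.

End false_discovery_proportion.

(** * Transfer of the central limit theorem to the false rejections *)

Section false_rejections_clt.
Context {R : realType} {k : nat} d {Omega : measurableType d} {P : probability Omega R}.
Variables (M : @factor_model R k d Omega P) (muA : R) (w : 'rV[R]_k).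
Local Notation W m t := (Wm M muA w m false t).
Variable K : R.
Hypothesis al_sum : forall n, \sum_(1 <= l < n) l%:R ^+ 2 * alpha M l <= K.
Variables (tau c v : R).
Hypothesis tau_itv : 0 < tau < 1.
Hypothesis c_gt0 : 0 < c.
Hypothesis cm_cvg : cm M muA w m false false tau tau @[m --> \oo] --> v.
Variable X : nat -> Omega -> R.
Hypothesis mX : forall m y, (0 < m)%N -> measurable [set x | X m x <= y].
Hypothesis X_le : forall y rho e, 0 < rho -> 0 < e -> \forall m \near \oo,
  pr P [set x | X m x <= y] <= pr P [set x | W m tau x <= c * y + rho] + e.
Hypothesis X_ge : forall y rho e, 0 < rho -> 0 < e -> \forall m \near \oo,
  pr P [set x | W m tau x <= c * y - rho] - e <= pr P [set x | X m x <= y].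

Lemma cvg_in_distribution_of_Wm : cvg_in_distribution P X (normal_law 0 (c ^- 2 * v)).
Proof.
have [z zE] := barPhi_surj tau_itv.
have cvz : cm M muA w m false false (barPhi z) (barPhi z) @[m --> \oo] --> v by rewrite zE.
have v0 : 0 <= v := cm_lim_ge0 cvz.
have cv0 : 0 <= c ^- 2 * v by rewrite mulr_ge0// invr_ge0 sqr_ge0.
have [Q [QE _]] := normal_law_probability cv0.
move=> y; set H := (fun z : R => _) => Hc.
have HE t : fine (normal_law 0 v `]-oo, c * t]%classic) = H t by rewrite /H normal_law_scale.
suff h : pr P [set x | X m x <= y] @[m --> \oo] --> H y.
  have -> : normal_law 0 (c ^- 2 * v) [set` `]-oo, y]] = (H y)%:E.
    by rewrite /H -QE fineK// fin_num_measure.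
  apply/fine_cvgP; split; last exact: h.
  by near=> m; apply: fin_num_measure; apply: mX; near: m; exact: nbhs_infty_gt.
apply/cvgrPdist_le => e e0.
have e3 : 0 < e / 3 by rewrite divr_gt0.
have [dl dl0 hdl] : exists2 dl : R, 0 < dl & forall t, `|t - y| < dl -> `|H y - H t| <= e / 3.
  move/cvgrPdist_le : Hc => /(_ _ e3) [dl dl0 h]; exists dl => // t ht; apply: h.
  by rewrite /ball_/= distrC.
(* Half of c dl / 2, so that the thresholds c y + rho and c y - rho are strictly inside those at y +
   dl / 2 and y - dl / 2, as [Wm_cdf] requires; continuity of [H] at y closes the sandwich. *)
pose rho := c * (dl / 4).
have rho0 : 0 < rho by rewrite mulr_gt0// divr_gt0.
have nd (s : R) : `|s| = 1 -> `|y + s * (dl / 2) - y| < dl.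
  by move=> s1; rewrite addrAC subrr add0r normrM s1 mul1r gtr0_norm ?divr_gt0// ltr_pdivrMr// ltr_pMr// ltr1n.
have H1 := hdl _ (nd 1 (normr1 _)).
have H2 := hdl _ (nd (-1) (normrN1 _)).
have lt1 : c * y + rho < c * (y + 1 * (dl / 2)) by rewrite mul1r mulrDr ltrD2l ltr_pM2l//; lra.
have lt2 : c * (y + -1 * (dl / 2)) < c * y - rho.
  by rewrite mulN1r mulrBr ltrD2l ltrN2 ltr_pM2l//; lra.
have [W1 _] := Wm_cdf al_sum cvz lt1 e3.
have [_ W2] := Wm_cdf al_sum cvz lt2 e3.
near=> m.
have h1 : pr P [set x | X m x <= y] <= pr P [set x | W m tau x <= c * y + rho] + e / 3.
  by near: m; exact: X_le.
have h2 : pr P [set x | W m tau x <= c * y - rho] - e / 3 <= pr P [set x | X m x <= y].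
  by near: m; exact: X_ge.
have h3 : pr P [set x | W m tau x <= c * y + rho] <= H (y + 1 * (dl / 2)) + e / 3.
  by rewrite -HE -zE; near: m; exact: W1.
have h4 : H (y + -1 * (dl / 2)) - e / 3 <= pr P [set x | W m tau x <= c * y - rho].
  by rewrite -HE -zE; near: m; exact: W2.
move: H1 H2; rewrite !ler_norml => /andP[h5 h6] /andP[h7 h8].
by apply/andP; split; lra.
Unshelve. all: end_near.
Qed.

End false_rejections_clt.

(** The premise of the second conclusion gives the asserted variance, which divides by (1 - q
    G'(tau))^2, its intended meaning; [crossing_slope_gt0] strengthens it to positivity. *)
Theorem corollary5p2 (R : realType) (k : nat) (q muA : R)
    (d : measure_display) (Omega : measurableType d) (P : probability Omega R)
    (M : @factor_model R k d Omega P) (w : 'rV[R]_k) (a b : R)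
    (F := F M muA w) (G := G M muA w) (tau := tau_star M q muA w) :
  0 < q < 1 -> 0 < muA ->
  pi1 M =o_\oo (fun m : nat => (Num.sqrt (m%:R : R))^-1) ->
  (* the interval [a, b] *)
  0 < a < q -> q < b < 1 -> a / q < G a ->
  [set t | a < t < b /\ G t = t / q] = [set tau] ->
  (* (1) *)
  (ereal_sup [set y | exists m (i : 'I_m), y = (sqnorm2 (loading M i))%:E]
     < 1%:E)%E ->
  (* (2) *)
  (exists (Q : nat) (g : R),
     [/\ ~~ odd Q, (2 < Q)%N, 0 < g, g / (2 + g) + 2 / Q%:R < 1 &
         (\sum_(1 <= l <oo)
            (l%:R ^+ (Q - 2) * alpha M l `^ (g / (Q%:R + g)))%:E < +oo)%E]) ->
  (* (3) *)
  (forall (t : R) (r : bool), 0 <= t <= 1 ->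
     cvgn (fun m => Fm M muA w m r t)) ->
  (* (4) *)
  0 < tau ->
  tau = sup [set t | 0 < t < 1 /\ t / q < G t] ->
  ~ limit_point [set t | 0 < t < 1 /\ G t = t / q] tau ->
  (* (5) *)
  (forall (s t : R) (r0 r1 : bool), a <= s <= b -> a <= t <= b ->
     cvgn (fun m => pi_ M r0 m * pi_ M r1 m / m%:R *
       \sum_(i < m) gam M muA w r0 i t * gam M muA w r1 i s) /\
     cvgn (fun m => pi_ M r0 m * pi_ M r1 m / m%:R *
       \sum_(i < m) \sum_(j < m | j != i)
         rho_tilde (gam M muA w r0 i t) (gam M muA w r1 j s) (Gam M i j))) ->
  (* (6) *)
  (forall r : bool, derivable (F r) tau 1) ->
  (* (7) *)
  (forall r : bool,
     ereal_sup [set (`|Num.sqrt m%:R * (Fm M muA w m r t - F r t)|)%:E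
               | t in `[a, b]] @[m --> \oo] --> 0%E) ->
  cvg_in_probability P
    (fun m x => Num.sqrt m%:R * (FDP M q muA w m x - 1)) 0 /\
  (1 - q * derive1 G tau != 0 ->
   cvg_in_distribution P
     (fun m x => Num.sqrt m%:R *
        ((false_rejections M q muA w m x)%:R / m%:R - tau / q))
     (normal_law 0 (sigma2_R3 M q muA w))).
Proof.
move=> /andP[q0 q1] _ hpi1 /andP[a0 aq] /andP[qb b1] Ga tau_set h1 [Q [g [Qodd Q2 g0 _ hsum]]].
move=> h3 tau0 _ _ h5 h6 h7.
have [K al_sum] := alpha_sum Qodd Q2 g0 hsum.
have spi := sqrt_pi1_small hpi1.
have GF : G = F false.
  by apply/funext => t; rewrite /G /Defs.G (F_true0 muA w spi) addr0.
have [tau_itv Gtau] : a < tau < b /\ G tau = tau / q.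
  by have : [set tau] tau by []; rewrite -tau_set.
have /andP[a_tau tau_b] := tau_itv.
have F0_tau : F false tau = tau / q by rewrite -GF.
have F_cvg t : 0 <= t <= 1 -> cvgn (fun m => Fm M muA w m false t) by exact: h3.
have F_unif e : 0 < e -> \forall m \near \oo, forall t, a <= t <= b ->
    `|Num.sqrt (m%:R : R) * (Fm M muA w m false t - F false t)| <= e.
  move=> e0; have e0' : (0%:E < e%:E)%E by rewrite lte_fin.
  have : \forall m \near \oo, (ereal_sup [set (`|Num.sqrt m%:R * (Fm M muA w m false t - F false t)|)%:E
      | t in `[a, b]] < e%:E)%E by exact: (h7 false _ (open_ereal_lt' e0')).
  apply: filterS => m hm t ht; rewrite -lee_fin; apply: le_trans (ltW hm).
  by apply: ereal_sup_ubound; exists t => //; rewrite /= in_itv.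
have a01 : 0 < a < 1 by rewrite a0 (lt_trans aq).
have tau01 : 0 < tau < 1 by rewrite tau0 (lt_trans tau_b).
split.
  apply: (FDP_cvg (K := K) _ spi a01) => //; first by rewrite -/F -GF.
  by apply: F_cvg_to => //; case/andP: a01 => ? ?; rewrite !ltW.
rewrite GF => c_neq0.
have F_lt t : tau < t < 1 -> F false t < t / q.
  by apply: simes_lt; [rewrite -GF|exact: ltW].
have tau0b : 0 < tau < b by rewrite tau0.
have F_cont : continuous (F false \o barPhi) by exact: F_barPhi_continuous.
have c_gt0 := crossing_slope_gt0 q0 F0_tau tau0b b1 F_lt (h6 false) c_neq0.
have [c1 c10 gap] := crossing_gap q0 F0_tau tau0b b1 F_lt (h6 false) c_neq0 F_cont.
have [z zE] := barPhi_surj tau01.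
(* The limit that defines [c] at (tau, tau) exists because [cm_formula] writes [cm] as a combination
   of three convergent sequences, so the [limn] in [sigma2_R3] is a genuine limit. *)
have cm_cvg : cvgn (fun m => cm M muA w m false false tau tau).
  have tau_ab : a <= tau <= b by rewrite !ltW.
  have [s1 s2] := h5 tau tau false false tau_ab tau_ab.
  have hF : Fm M muA w m false tau @[m --> \oo] --> F false tau by apply: F_cvg; case/andP: tau01 => ? ?; rewrite !ltW.
  apply/cvg_ex; eexists; apply: cvg_trans; last exact: (cvgD (cvgB hF s1) s2).
  apply: near_eq_cvg; near=> m.
  by rewrite -zE cm_formula//; near: m; exact: nbhs_infty_gt.
rewrite /sigma2_R3 -/tau -/G GF.
apply: (cvg_in_distribution_of_Wm al_sum tau01 c_gt0 cm_cvg).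
- by move=> m y m0; exact: measurable_X_le.
- by move=> y rho e; apply: (false_rejections_cdf_le al_sum spi a0 b1 tau_itv (h6 false) F_unif q0 F0_tau c_gt0).
- by move=> y rho e; apply: (false_rejections_cdf_ge al_sum spi a0 b1 tau_itv (h6 false) F_unif q0 F0_tau c_gt0 c10 gap qb).
Unshelve. all: end_near.
Qed.
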